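(* Let $K>1$, $\theta\in(-\pi/2,\pi/2]$, $c\in\mathbb{C}\setminus\mathcal{M}_{K,\theta}$ and let $m=m(c)$ be the escape time. Then $\Psi$ is $C^1$ in a neighbourhood of $c$, and $$D_c\Psi=[Df_0^n(\Psi(c))]^{-1}D_cQ_n$$ holds for every $n\ge m+1$. Moreover, the limits $R_\infty=\lim_nR_n$, $S_\infty=\lim_nS_n$ and $\lambda_\infty=\lim_n\lambda_n$, where $$\lambda_n:=\prod_{j=0}^{n-1}\frac{|h(P_j(c))|}{|h(w_j)|},$$ all exist, with $\lambda_\infty\in(0,\infty)$ and $\det S_\infty=1$, and $$D_c\Psi=\lambda_\infty S_\infty R_\infty.$$ In particular $\operatorname{sign}\det D_c\Psi=\operatorname{sign}\det R_\infty$, and $c\mapsto\det D_c\Psi$ is continuous on $\mathbb{C}\setminus\mathcal{M}_{K,\theta}$. Finally, the quantity $s=\sum_{j=0}^\infty\|\mathcal{E}_j\|$ satisfies $$s\le\pi mK^m+\frac{4C'K^2|c|K^m}{(|P_m(c)|-1)^2}.$$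
   Context: Fix $K>1$ and $\theta\in(-\pi/2,\pi/2]$. Let $h(z)=\frac{K+1}{2}z+e^{2i\theta}\frac{K-1}{2}\overline{z}$ (real-linear stretch by factor $K$ in the direction $e^{i\theta}$). For $c\in\mathbb{C}$ let $f_c(z)=h(z)^2+c$, with iterates $f_c^n$. Set $I(f_c)=\{z: f_c^n(z)\to\infty\}$, $BO(f_c)=\mathbb{C}\setminus I(f_c)$, $\mathcal{M}_{K,\theta}=\{c:0\in BO(f_c)\}$, and $P_n(c)=f_c^n(c)=f_c^{n+1}(0)$, $n\ge0$. $D_c$ is the real ($2\times 2$) derivative in $c$; $\|\cdot\|$ is the operator norm of real-linear maps of the plane. Böttcher coordinate $\psi_c$ (known, Fletcher–Fryer): near infinity put $\psi_0=\mathrm{id}$ and $\psi_{k+1}=f_0^{-1}\circ\psi_k\circ f_c$, the branch of $f_0^{-1}$ being chosen so that $\psi_{k+1}(z)=z+o(1)$ as $|z|\to\infty$. The sequence $(\psi_k)$ converges uniformly on a neighbourhood of infinity $U_c$ (which may be taken with $f_c(U_c)\subset U_c$ and $U_c\cup\{\infty\}$ simply connected) to a quasiconformal map $\psi_c$ with $\psi_c\circ f_c=f_0\circ\psi_c$ on $U_c$. If $c\notin\mathcal{M}_{K,\theta}$ and $n$ is the least integer with $c\in f_c^{-n}(U_c)$, then $\psi_c$ extends, by lifting curves under $f_c$ and $f_0$, to an injective continuous map on $f_c^{-n}(U_c)$ still satisfying $\psi_c\circ f_c=f_0\circ\psi_c$; this extension is uniquely determined by $\psi_c|_{U_c}$ and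 is again denoted $\psi_c$. Then $\Psi(c):=\psi_c(c)$ for $c\in\mathbb{C}\setminus\mathcal{M}_{K,\theta}$. Constants: $a=a(K,\theta)\ge1$ and $C'=C'(K,\theta)$ are fixed constants such that on $\mathcal{D}=\{(c,z):|z|\ge a\sqrt{1+|c|}\}$ the unextended coordinate $\psi_c(z)$ is defined and jointly $C^1$ in $(c,z)$, with (implied constants depending only on $K,\theta$) $\partial_c\psi_c,\partial_{\overline c}\psi_c=O(|z|^{-1})$, $\partial_z\psi_c=1+O(|c|/|z|^2)$, $\partial_{\overline z}\psi_c=O(|c|/|z|^2)$, and $|\psi_c(z)-z|\le C'|c|/|z|$. Put $$\kappa_0:=\max\{4,\;1+\sqrt{2K},\;2KC',\;a^2+1\},\qquad \kappa_c:=\max\{|c|,\kappa_0\},\qquad m(c):=\min\{i\ge0:|P_i(c)|\ge\kappa_c\}$$ (the escape time, finite for $c\notin\mathcal{M}_{K,\theta}$). For $c\notin\mathcal{M}_{K,\theta}$ (so $P_i(c)\ne0$ for all $i$): $Q_n(c):=\psi_c(P_n(c))$ (defined e.g. whenever $(c,P_n(c))\in\mathcal{D}$, which holds for $n\ge m(c)$); $w_j:=f_0^j(\Psi(c))$, which is nonzero for all $j\ge 0$. $A_j$ denotes multiplication by $\alpha_j:=2h(P_j(c))$; $\Pi_0=I$, $\Pi_j=(A_{j-1}h)\cdots(A_0h)$ for $j\ge1$; $R_n:=I+\sum_{j=1}^n\Pi_j^{-1}$ (so that $D_cP_n=\Pi_nR_n$). Let $\beta_j:=2h(w_j)$, $\phi_j:=\arg\alpha_j$,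 $\chi_j:=\arg\beta_j$, let $\delta_j$ be the principal value of $\phi_j-\chi_j$ (so $|\delta_j|\le\pi$), and let $\mathcal{R}_\phi$ be rotation by angle $\phi$. Set $$Y_n:=(\mathcal{R}_{\phi_{n-1}}h)\cdots(\mathcal{R}_{\phi_0}h),\quad \tilde Y_n:=(\mathcal{R}_{\chi_{n-1}}h)\cdots(\mathcal{R}_{\chi_0}h),\quad Y_0=\tilde Y_0=I,\quad S_n:=\tilde Y_n^{-1}Y_n,$$ $$v_j:=h^{-1}\mathcal{R}_{\delta_j}h,\qquad \mathcal{E}_j:=Y_j^{-1}(v_j-I)Y_j .$$ *)

(* Defs.v *)
From Stdlib Require Import Reals.
From Coquelicot Require Import Coquelicot.
Open Scope R_scope.

(** The plane is [C = R * R]; its real structure is [C_R_NormedModule], whose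
    norm is the Euclidean one.  A matrix acts on the column [(Re z, Im z)]. *)

Definition M2 : Type := @matrix R 2 2.

Definition coef (A : M2) (i j : nat) : R := coeff_mat 0 A i j.

Definition mat2 (a00 a01 a10 a11 : R) : M2 :=
  mk_matrix 2 2 (fun i j =>
    match i, j with
    | O, O => a00
    | O, _ => a01
    | _, O => a10
    | _, _ => a11
    end).

Definition mat_act (A : M2) (z : C) : C :=
  (coef A 0 0 * Re z + coef A 0 1 * Im z,
   coef A 1 0 * Re z + coef A 1 1 * Im z).

(** Meaningful only for real-linear [L]. *)
Definition lin_mat (L : C -> C) : M2 :=
  mat2 (Re (L (RtoC 1))) (Re (L Ci)) (Im (L (RtoC 1))) (Im (L Ci)).

Definition I2 : M2 := @Mone R_Ring 2.
Definition madd (A B : M2) : M2 := @plus (@matrix_AbelianMonoid R_AbelianMonoid 2 2) A B.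
Definition msub (A B : M2) : M2 := @minus (@matrix_AbelianGroup R_AbelianGroup 2 2) A B.
Definition mmul (A B : M2) : M2 := @Mmult R_Ring 2 2 2 A B.
Definition mscal (t : R) (A : M2) : M2 := mk_matrix 2 2 (fun i j => t * coef A i j).
Definition msum (u : nat -> M2) (n m : nat) : M2 :=
  @sum_n_m (@matrix_AbelianMonoid R_AbelianMonoid 2 2) u n m.
Definition mdet (A : M2) : R := coef A 0 0 * coef A 1 1 - coef A 0 1 * coef A 1 0.

(** Meaningful only when [mdet A <> 0]. *)
Definition minv (A : M2) : M2 :=
  mscal (/ mdet A) (mat2 (coef A 1 1) (- coef A 0 1) (- coef A 1 0) (coef A 0 0)).

Definition opnorm (A : M2) : R :=
  real (Lub_Rbar (fun x => exists z : C, Cmod z <= 1 /\ x = Cmod (mat_act A z))).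

(** Coquelicot puts no topology on matrices; limits and continuity are entrywise. *)
Definition is_lim_mat (u : nat -> M2) (A : M2) : Prop :=
  forall i j : nat, (i < 2)%nat -> (j < 2)%nat ->
    is_lim_seq (fun n => coef (u n) i j) (coef A i j).

Definition continuous_mat {T : UniformSpace} (F : T -> M2) (x : T) : Prop :=
  forall i j : nat, (i < 2)%nat -> (j < 2)%nat ->
    continuous (fun y => coef (F y) i j) x.

(** Jacobian matrix, total through [Derive]; it is the real derivative of [F]
    at [z] when [differentiable_at F z] holds. *)
Definition Dmat (F : C -> C) (z : C) : M2 :=
  mat2 (Derive (fun t => Re (F (t, Im z))) (Re z))
       (Derive (fun t => Re (F (Re z, t))) (Im z))
       (Derive (fun t => Im (F (t, Im z))) (Re z))
       (Derive (fun t => Im (F (Re z, t))) (Im z)).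

Definition differentiable_at (F : C -> C) (z : C) : Prop :=
  @filterdiff R_AbsRing C_R_NormedModule C_R_NormedModule
    F (@locally C_R_NormedModule z) (mat_act (Dmat F z)).

Definition C1_near (F : C -> C) (z : C) : Prop :=
  @locally C_UniformSpace z (fun z' =>
    differentiable_at F z' /\ @continuous_mat C_UniformSpace (Dmat F) z').

(** Wirtinger components of a real-linear map: [A v = wd A * v + wdbar A * Cconj v]. *)
Definition wd (A : M2) : C :=
  ((mat_act A (RtoC 1) - Ci * mat_act A Ci) / RtoC 2)%C.
Definition wdbar (A : M2) : C :=
  ((mat_act A (RtoC 1) + Ci * mat_act A Ci) / RtoC 2)%C.

(** Principal argument in [(-PI, PI]] of a nonzero complex number. *)
Definition Arg (z : C) : R :=
  if Rle_dec 0 (Im z) then acos (Re z / Cmod z) else - acos (Re z / Cmod z).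

Definition cis (t : R) : C := (cos t, sin t).

(** The representative in [(-PI, PI]] of [t] modulo [2 * PI]. *)
Definition principal_value (t : R) : R := Arg (cis t).

Definition Rot (t : R) : M2 := lin_mat (fun z => (cis t * z)%C).

Definition h (K theta : R) (z : C) : C :=
  (RtoC ((K + 1) / 2) * z + cis (2 * theta) * RtoC ((K - 1) / 2) * Cconj z)%C.

Definition fc (K theta : R) (c z : C) : C :=
  (h K theta z * h K theta z + c)%C.

Definition f0 (K theta : R) : C -> C := fc K theta (RtoC 0).

Definition escapes (K theta : R) (c z : C) : Prop :=
  is_lim_seq (fun n => Cmod (Nat.iter n (fc K theta c) z)) p_infty.

Definition BO (K theta : R) (c z : C) : Prop := ~ escapes K theta c z.

Definition Mset (K theta : R) (c : C) : Prop := BO K theta c (RtoC 0).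

Definition P (K theta : R) (n : nat) (c : C) : C := Nat.iter n (fc K theta c) c.

(** Metric definition of quasiconformality, for an embedding of an open set. *)
Definition quasiconformal_on (U : C -> Prop) (g : C -> C) : Prop :=
  (forall z, U z -> @continuous C_UniformSpace C_UniformSpace g z) /\
  (forall z w, U z -> U w -> g z = g w -> z = w) /\
  exists H : R, forall z, U z -> exists r0 : R, 0 < r0 /\
    forall x y, Cmod (x - z)%C = Cmod (y - z)%C -> Cmod (x - z)%C < r0 ->
      Cmod (g x - g z)%C <= H * Cmod (g y - g z)%C.

(** The neighbourhoods [U_c] of infinity are taken of this form; with infinity
    added they are simply connected. *)
Definition exterior_disc (r : R) (z : C) : Prop := r < Cmod z.

(** [psi] is the limit on [U] of the sequence [psi_0 = id],
    [psi_(k+1) = f_0^-1 o psi_k o f_c].  A branch of [f_0^-1] along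
    [psi_k o f_c] is a continuous solution [psi_(k+1)] of
    [f_0 o psi_(k+1) = psi_k o f_c]. *)
Definition is_bottcher (K theta : R) (c : C) (U : C -> Prop) (psi : C -> C) : Prop :=
  (forall z, U z -> U (fc K theta c z)) /\
  (exists psik : nat -> C -> C,
      (forall z, U z -> psik O z = z) /\
      (forall k z, U z -> @continuous C_UniformSpace C_UniformSpace (psik k) z) /\
      (forall k z, U z -> f0 K theta (psik (S k) z) = psik k (fc K theta c z)) /\
      (forall k (eps : R), 0 < eps -> exists r : R, forall z,
          U z -> r < Cmod z -> Cmod (psik (S k) z - z)%C < eps) /\
      (forall eps : R, 0 < eps -> exists N : nat, forall k z,
          (N <= k)%nat -> U z -> Cmod (psik k z - psi z)%C < eps)) /\
  quasiconformal_on U psi /\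
  (forall z, U z -> psi (fc K theta c z) = f0 K theta (psi z)).

(** [E] is the extension of [psi] from [U] to [f_c^-n(U)], [n] least with
    [c] in [f_c^-n(U)]. *)
Definition is_bottcher_extension (K theta : R) (c : C) (U : C -> Prop)
    (psi E : C -> C) : Prop :=
  exists n : nat,
    let A := fun z : C => U (Nat.iter n (fc K theta c) z) in
    A c /\
    (forall i, (i < n)%nat -> ~ U (Nat.iter i (fc K theta c) c)) /\
    (forall z, U z -> E z = psi z) /\
    (forall z, A z -> @continuous C_UniformSpace C_UniformSpace E z) /\
    (forall z w, A z -> A w -> E z = E w -> z = w) /\
    (forall z, A z -> E (fc K theta c z) = f0 K theta (E z)).

Definition CC : UniformSpace := prod_UniformSpace C_UniformSpace C_UniformSpace.

Definition Dset (a : R) (p : C * C) : Prop :=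
  a * sqrt (1 + Cmod (fst p)) <= Cmod (snd p).

Definition Dint (a : R) (p : C * C) : Prop := @locally CC p (Dset a).

Definition D_c (psi : C -> C -> C) (p : C * C) : M2 :=
  Dmat (fun c => psi c (snd p)) (fst p).
Definition D_z (psi : C -> C -> C) (p : C * C) : M2 :=
  Dmat (psi (fst p)) (snd p).

(** [Dset a] is closed, so derivatives are only considered at its interior
    points; this is the weakest reading of "C^1 on [Dset a]". *)
Definition bottcher_estimates (rho : C -> R) (psi : C -> C -> C) (a C' : R) : Prop :=
  (forall c z, Dset a (c, z) -> exterior_disc (rho c) z) /\
  (forall p : C * C, Dint a p ->
     @filterdiff R_AbsRing
       (prod_NormedModule R_AbsRing C_R_NormedModule C_R_NormedModule)
       C_R_NormedModule
       (fun q : C * C => psi (fst q) (snd q))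
       (@locally (prod_NormedModule R_AbsRing C_R_NormedModule C_R_NormedModule) p)
       (fun d : C * C => (mat_act (D_c psi p) (fst d) + mat_act (D_z psi p) (snd d))%C) /\
     @continuous_mat CC (D_c psi) p /\
     @continuous_mat CC (D_z psi) p) /\
  (exists B : R, forall c z, Dint a (c, z) ->
     Cmod (wd (D_c psi (c, z))) <= B / Cmod z /\
     Cmod (wdbar (D_c psi (c, z))) <= B / Cmod z /\
     Cmod (wd (D_z psi (c, z)) - RtoC 1)%C <= B * Cmod c / Cmod z ^ 2 /\
     Cmod (wdbar (D_z psi (c, z))) <= B * Cmod c / Cmod z ^ 2) /\
  (forall c z, Dset a (c, z) -> Cmod (psi c z - z)%C <= C' * Cmod c / Cmod z).

Definition kappa0 (K a C' : R) : R :=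
  Rmax 4 (Rmax (1 + sqrt (2 * K)) (Rmax (2 * K * C') (a ^ 2 + 1))).

Definition kappa (K a C' : R) (c : C) : R := Rmax (Cmod c) (kappa0 K a C').

Definition is_escape_time (K theta a C' : R) (c : C) (m : nat) : Prop :=
  kappa K a C' c <= Cmod (P K theta m c) /\
  forall i, (i < m)%nat -> Cmod (P K theta i c) < kappa K a C' c.

(** In what follows [w] stands for [Psi(c)], so that [w_ K theta w j] is [w_j]. *)

Definition Psi (psi_ext : C -> C -> C) (c : C) : C := psi_ext c c.

Definition Q (K theta : R) (psi : C -> C -> C) (n : nat) (c : C) : C :=
  psi c (P K theta n c).

Definition Hmat (K theta : R) : M2 := lin_mat (h K theta).

Definition alpha (K theta : R) (c : C) (j : nat) : C :=
  (RtoC 2 * h K theta (P K theta j c))%C.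

Definition Amat (K theta : R) (c : C) (j : nat) : M2 :=
  lin_mat (fun z => (alpha K theta c j * z)%C).

Fixpoint Pi_ (K theta : R) (c : C) (j : nat) : M2 :=
  match j with
  | O => I2
  | S i => mmul (mmul (Amat K theta c i) (Hmat K theta)) (Pi_ K theta c i)
  end.

Definition R_ (K theta : R) (c : C) (n : nat) : M2 :=
  madd I2 (msum (fun j => minv (Pi_ K theta c j)) 1 n).

Definition w_ (K theta : R) (w : C) (j : nat) : C := Nat.iter j (f0 K theta) w.

Definition beta (K theta : R) (w : C) (j : nat) : C :=
  (RtoC 2 * h K theta (w_ K theta w j))%C.

Definition phi (K theta : R) (c : C) (j : nat) : R := Arg (alpha K theta c j).
Definition chi (K theta : R) (w : C) (j : nat) : R := Arg (beta K theta w j).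
Definition delta (K theta : R) (c w : C) (j : nat) : R :=
  principal_value (phi K theta c j - chi K theta w j).

Fixpoint rot_prod (K theta : R) (angle : nat -> R) (n : nat) : M2 :=
  match n with
  | O => I2
  | S i => mmul (mmul (Rot (angle i)) (Hmat K theta)) (rot_prod K theta angle i)
  end.

Definition Y (K theta : R) (c : C) : nat -> M2 := rot_prod K theta (phi K theta c).
Definition Ytilde (K theta : R) (w : C) : nat -> M2 := rot_prod K theta (chi K theta w).

Definition S_ (K theta : R) (c w : C) (n : nat) : M2 :=
  mmul (minv (Ytilde K theta w n)) (Y K theta c n).

Definition v_ (K theta : R) (c w : C) (j : nat) : M2 :=
  mmul (minv (Hmat K theta)) (mmul (Rot (delta K theta c w j)) (Hmat K theta)).

Definition E_ (K theta : R) (c w : C) (j : nat) : M2 :=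
  mmul (minv (Y K theta c j))
       (mmul (msub (v_ K theta c w j) I2) (Y K theta c j)).

Fixpoint lambda_ (K theta : R) (c w : C) (n : nat) : R :=
  match n with
  | O => 1
  | S j => lambda_ K theta c w j *
           (Cmod (h K theta (P K theta j c)) / Cmod (h K theta (w_ K theta w j)))
  end.

(* Main.v *)
(** The delicate point is that [Psi] is continuous: [psi_ext c] is only known to be some continuous
    injective extension from an exterior disc whose radius depends arbitrarily on [c].  If
    [Cmod (P n c) > rho c], the ray [t * P n c], [t >= 1], avoids the critical orbit
    [P 0 c, ..., P (n-1) c], because [fc] does not decrease moduli outside the disc of radius
    [rho c]; this rests on [{h z ^ 2}], [Cmod z = 1], being an ellipse with a focus at [0].  So the
    ray lifts by [f_c^n] to a path from [c] to infinity, along which [psi] continues to a value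
    at [c].  For the least [n] this value is [Psi c], and an explicit homotopy of rays shows that
    it does not depend on [n].  For a fixed large [n] it varies continuously with [c].

    Then [f_0^n (Psi c) = Q_n c] near [c], and [f_0^n] has invertible derivatives along the orbit
    of [Psi c], so [Psi] is [C^1] and [D Psi] is given by the quotient of derivatives.  Writing
    each multiplication as a modulus times a rotation gives [lambda_n S_n R_n] up to an error that
    tends to [0], and [S_(n+1) - S_n] and [E_n] are both bounded by
    [K^(n+1) |exp (i delta_n) - 1|], with [exp (i delta_n) - 1 = O(|c| / |P_n|^2)]. *)

Require Import Defs.
From Stdlib Require Import Reals Lra Psatz Lia Classical ClassicalEpsilon Ranalysis5.
From Coquelicot Require Import Coquelicot.
Open Scope R_scope.

(** * The real-linear stretch *)

(** [h] does not commute with rotations, so the derivative products cannot be reduced to complex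
    numbers: moduli factor out, but the rotated stretches leave a distortion that may reach K^n
    after n steps. Convergence therefore rests on |P_n|^2 outgrowing K^n. The entries of [kappa0]
    are what this takes from the escape time on: 4, with |c| <= [kappa], gives |P_(i+1)| - 1 >=
    (|P_i| - 1)^2; 1 + sqrt(2K) gives (|P_m| - 1)^2 >= 2K, so that K^i / |P_(m+i)|^2 decays like
    2^-i; a^2 + 1 puts the orbit strictly inside the domain of the estimates; 2KC' keeps |h(w_j)| /
    |h(P_j)| within 1/2 of 1.

    Since [fc] is [h] followed by a squaring and a translation, a lift by an iterate is a succession
    of continuous square roots, which exist as long as the lifted map avoids the critical orbit.
    [psi_ext c] is given by its properties and not by a construction, so it is compared with [psi]
    along a lifted path that joins [c] to the region where both agree. *)

Lemma Cmod_sqr (z : C) : Cmod z ^ 2 = Re z ^ 2 + Im z ^ 2.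
Proof. unfold Cmod. rewrite pow2_sqrt; [reflexivity | nra]. Qed.

Lemma Cmod_le_of_sqr (z : C) (r : R) :
  0 <= r -> Re z ^ 2 + Im z ^ 2 <= r ^ 2 -> Cmod z <= r.
Proof.
  intros hr hz. rewrite <- Cmod_sqr in hz.
  apply Rsqr_incr_0_var; [unfold Rsqr; nra | exact hr].
Qed.

Lemma C_ext (z w : C) : Re z = Re w -> Im z = Im w -> z = w.
Proof. destruct z, w; simpl; intros; subst; reflexivity. Qed.

Lemma dot_le (a b x y : R) : a * x + b * y <= sqrt (a ^ 2 + b ^ 2) * sqrt (x ^ 2 + y ^ 2).
Proof.
  rewrite <- sqrt_mult by nra.
  apply Rsqr_incr_0_var; [| apply sqrt_pos].
  rewrite Rsqr_sqrt by nra. unfold Rsqr. pose proof (pow2_ge_0 (a * y - b * x)). nra.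
Qed.

(* The vectors [u - (e, 0)] with [|u| = 1] form the circle [|p|^2 + 2 e p1 = 1 - e^2],
   and [|y| - e y1] is the maximum of [<y, p>] over this circle.  The point [p] attains it at
   [y]; the witness is built from the point [p'] of the circle with abscissa
   [(rho / r)^2 p1]. *)
Lemma focal_descent (e y1 y2 c1 c2 rho r : R) :
  0 <= e < 1 -> 0 < rho < r -> (y1 + c1) ^ 2 + (y2 + c2) ^ 2 = r ^ 2 ->
  0 < sqrt (y1 ^ 2 + y2 ^ 2) ->
  exists x1 x2, (x1 + c1) ^ 2 + (x2 + c2) ^ 2 = rho ^ 2 /\
    (rho / r) ^ 2 * (sqrt (y1 ^ 2 + y2 ^ 2) - e * y1) <= sqrt (x1 ^ 2 + x2 ^ 2) - e * x1.
Proof.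
  intros he hr hd hy.
  set (m := sqrt (y1 ^ 2 + y2 ^ 2)) in *.
  assert (hm : m ^ 2 = y1 ^ 2 + y2 ^ 2) by (apply pow2_sqrt; nra).
  set (p1 := y1 / m - e). set (p2 := y2 / m).
  assert (hp : p1 ^ 2 + p2 ^ 2 + 2 * e * p1 = 1 - e ^ 2).
  { unfold p1, p2.
    replace ((y1 / m - e) ^ 2 + (y2 / m) ^ 2 + 2 * e * (y1 / m - e))
      with ((y1 ^ 2 + y2 ^ 2) / m ^ 2 - e ^ 2) by (field; lra).
    rewrite <- hm. field. lra. }
  assert (hN : y1 * p1 + y2 * p2 = m - e * y1).
  { unfold p1, p2.
    replace (y1 * (y1 / m - e) + y2 * (y2 / m)) with ((y1 ^ 2 + y2 ^ 2) / m - e * y1)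
      by (field; lra).
    rewrite <- hm. field. lra. }
  set (l := rho / r).
  assert (hl : 0 < l < 1).
  { unfold l. split; [apply Rdiv_lt_0_compat; lra|].
    apply Rmult_lt_reg_r with r; [lra|]. unfold Rdiv. rewrite Rmult_assoc, Rinv_l; lra. }
  assert (hlr : l * r = rho) by (unfold l; field; lra).
  set (D := sqrt (p1 ^ 2 + p2 ^ 2)).
  assert (hD : D ^ 2 = p1 ^ 2 + p2 ^ 2) by (apply pow2_sqrt; nra).
  assert (hD0 : 0 <= D) by apply sqrt_pos.
  (* [q] is the squared length of p' = (l^2 p1, t): requiring p' + (e, 0) to be a unit vector ([hu])
     forces t^2 = q - l^4 p1^2 and leaves the sign of t free. In particular |p'| >= l |p|. *)
  set (q := l ^ 2 * D ^ 2 + (1 - l ^ 2) * (1 - e ^ 2)).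
  assert (hl2 : 0 < l ^ 2 < 1) by nra.
  assert (he2 : 0 <= e ^ 2 < 1) by nra.
  assert (hq : 0 < q /\ l ^ 2 * D ^ 2 <= q).
  { assert (0 < (1 - l ^ 2) * (1 - e ^ 2)) by (apply Rmult_lt_0_compat; lra).
    assert (0 <= l ^ 2 * D ^ 2) by (apply Rmult_le_pos; nra).
    unfold q. split; lra. }
  assert (hq2 : (l ^ 2) ^ 2 * p2 ^ 2 <= q - (l ^ 2) ^ 2 * p1 ^ 2).
  { assert ((l ^ 2) ^ 2 * D ^ 2 <= l ^ 2 * D ^ 2).
    { apply Rmult_le_compat_r; nra. }
    rewrite hD in H at 1. rewrite Rmult_plus_distr_l in H. lra. }
  set (s := sqrt (q - (l ^ 2) ^ 2 * p1 ^ 2)).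
  assert (hs0 : 0 <= q - (l ^ 2) ^ 2 * p1 ^ 2).
  { apply Rle_trans with ((l ^ 2) ^ 2 * p2 ^ 2); [|exact hq2].
    apply Rmult_le_pos; nra. }
  assert (hs : s ^ 2 = q - (l ^ 2) ^ 2 * p1 ^ 2) by (apply pow2_sqrt; exact hs0).
  assert (hsp : 0 <= s) by apply sqrt_pos.
  assert (hsl : l ^ 2 * Rabs p2 <= s).
  { apply Rsqr_incr_0_var; [|exact hsp]. unfold Rsqr.
    replace (l ^ 2 * Rabs p2 * (l ^ 2 * Rabs p2)) with ((l ^ 2) ^ 2 * (Rabs p2) ^ 2) by ring.
    rewrite pow2_abs. lra. }
  (* The sign of t is chosen against c2. Since |t| >= l^2 |p2|, this makes -<c, p'> at least -l^2
     <c, p>. *)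
  assert (exists t, t ^ 2 = s ^ 2 /\ - c2 * (l ^ 2 * p2) <= - c2 * t) as [t [ht htc]].
  { pose proof (Rle_abs p2). pose proof (Rle_abs (- p2)) as H1. rewrite Rabs_Ropp in H1.
    assert (- s <= l ^ 2 * p2 <= s) by nra.
    destruct (Rle_dec 0 (- c2)).
    - exists s. split; [ring|nra].
    - exists (- s). split; [ring|nra]. }
  set (D' := sqrt q).
  assert (hD' : D' ^ 2 = q) by (apply pow2_sqrt; lra).
  assert (hD'0 : 0 < D') by (apply sqrt_lt_R0; lra).
  assert (hDD : l * D <= D').
  { apply Rsqr_incr_0_var; [|lra]. unfold Rsqr. nra. }
  (* The point of the circle |x + c| = rho that lies farthest in the direction p'. *)
  set (x1 := - c1 + rho * (l ^ 2 * p1) / D'). set (x2 := - c2 + rho * t / D').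
  exists x1, x2. split.
  { unfold x1, x2.
    replace ((- c1 + rho * (l ^ 2 * p1) / D' + c1) ^ 2 + (- c2 + rho * t / D' + c2) ^ 2)
      with (rho ^ 2 * ((l ^ 2) ^ 2 * p1 ^ 2 + t ^ 2) / D' ^ 2) by (field; lra).
    rewrite ht, hs, hD'. field. lra. }
  assert (hu : (l ^ 2 * p1 + e) ^ 2 + t ^ 2 = 1).
  { rewrite ht, hs. unfold q. rewrite hD. nra. }
  (* The comparison is |x| - e x1 >= <x, p'> = -<c, p'> + rho |p'| against l^2 (|y| - e y1) = l^2
     <y, p> <= l^2 (r |p| - <c, p>), where l^2 r |p| = rho l |p|. *)
  pose proof (dot_le x1 x2 (l ^ 2 * p1 + e) t) as hcs.
  rewrite hu, sqrt_1 in hcs.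
  assert (hx : x1 * (l ^ 2 * p1) + x2 * t = - c1 * (l ^ 2 * p1) - c2 * t + rho * D').
  { unfold x1, x2.
    replace ((- c1 + rho * (l ^ 2 * p1) / D') * (l ^ 2 * p1) + (- c2 + rho * t / D') * t)
      with (- c1 * (l ^ 2 * p1) - c2 * t + rho * ((l ^ 2) ^ 2 * p1 ^ 2 + t ^ 2) / D')
      by (field; lra).
    rewrite ht, hs.
    replace ((l ^ 2) ^ 2 * p1 ^ 2 + (q - (l ^ 2) ^ 2 * p1 ^ 2)) with (D' ^ 2) by (rewrite hD'; ring).
    field. lra. }
  pose proof (dot_le (y1 + c1) (y2 + c2) p1 p2) as hcs2.
  rewrite hd in hcs2. fold D in hcs2. rewrite sqrt_pow2 in hcs2 by lra.
  assert (l ^ 2 * (m - e * y1 - r * D) <= l ^ 2 * (- c1 * p1 - c2 * p2)).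
  { apply Rmult_le_compat_l; nra. }
  assert (l ^ 2 * (r * D) = rho * (l * D)) by (rewrite <- hlr; ring).
  assert (rho * (l * D) <= rho * D') by (apply Rmult_le_compat_l; lra).
  nra.
Qed.

Lemma cis_norm (t : R) : cos t ^ 2 + sin t ^ 2 = 1.
Proof. pose proof (sin2_cos2 t) as H. unfold Rsqr in H. nra. Qed.

Lemma Cmod_cis (t : R) : Cmod (cis t) = 1.
Proof. unfold Cmod, cis. simpl fst; simpl snd. rewrite cis_norm. apply sqrt_1. Qed.

Definition hinv (K theta : R) (y : C) : C :=
  ((RtoC ((K + 1) / 2) * y - cis (2 * theta) * RtoC ((K - 1) / 2) * Cconj y) / RtoC K)%C.

Section Stretch.
Context (K theta : R) (hK : 1 < K).
Notation h := (h K theta).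
Notation hinv := (hinv K theta).

Lemma h_plus (z w : C) : (h (z + w) = h z + h w)%C.
Proof. unfold Defs.h. rewrite Cplus_conj. ring. Qed.

Lemma h_opp (z : C) : (h (- z) = - h z)%C.
Proof. unfold Defs.h. rewrite Copp_conj. ring. Qed.

Lemma h_minus (z w : C) : (h (z - w) = h z - h w)%C.
Proof. unfold Cminus. rewrite h_plus, h_opp. reflexivity. Qed.

Lemma h_scal (t : R) (z : C) : (h (RtoC t * z) = RtoC t * h z)%C.
Proof.
  unfold Defs.h. rewrite Cmult_conj.
  replace (Cconj (RtoC t)) with (RtoC t) by (apply C_ext; simpl; ring). ring.
Qed.

Lemma h_0 : h (RtoC 0) = RtoC 0.
Proof. apply C_ext; unfold Defs.h; simpl; ring. Qed.


Lemma cis_conj (t : R) : (cis t * Cconj (cis t))%C = RtoC 1.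
Proof.
  pose proof (cis_norm t) as H.
  apply C_ext; unfold cis; simpl in *; lra.
Qed.

Lemma h_hinv (y : C) : h (hinv y) = y.
Proof.
  unfold Defs.h, hinv, Cdiv.
  rewrite !Cmult_conj, Cminus_conj, !Cmult_conj, Cconj_conj.
  replace (Cconj (/ RtoC K)) with (/ RtoC K)%C
    by (rewrite <- RtoC_inv by lra; apply C_ext; simpl; ring).
  replace (Cconj (RtoC ((K + 1) / 2))) with (RtoC ((K + 1) / 2)) by (apply C_ext; simpl; ring).
  replace (Cconj (RtoC ((K - 1) / 2))) with (RtoC ((K - 1) / 2)) by (apply C_ext; simpl; ring).
  set (E := cis (2 * theta)).
  transitivity (((RtoC ((K + 1) / 2) * RtoC ((K + 1) / 2)
     - (E * Cconj E) * (RtoC ((K - 1) / 2) * RtoC ((K - 1) / 2))) * / RtoC K * y)%C);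
    [ring|].
  unfold E. rewrite cis_conj, Cmult_1_l, <- !RtoC_mult, <- RtoC_minus, <- RtoC_inv by lra. rewrite <- RtoC_mult.
  replace (((K + 1) / 2 * ((K + 1) / 2) - (K - 1) / 2 * ((K - 1) / 2)) * / K) with 1 by (field; lra).
  apply Cmult_1_l.
Qed.

Lemma Cmod_RtoC_mult (t : R) (z : C) : Cmod (RtoC t * z) = Rabs t * Cmod z.
Proof. rewrite Cmod_mult, Cmod_R. reflexivity. Qed.

Lemma Cmod_conj (z : C) : Cmod (Cconj z) = Cmod z.
Proof. unfold Cmod. simpl. f_equal. ring. Qed.

Lemma h_le (z : C) : Cmod (h z) <= K * Cmod z.
Proof.
  unfold Defs.h. eapply Rle_trans; [apply Cmod_triangle|].
  rewrite !Cmod_mult, Cmod_cis, !Cmod_R, Cmod_conj, !Rabs_pos_eq by lra. lra.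
Qed.

(** The two coefficients of [h] have moduli (K + 1) / 2 and (K - 1) / 2, which differ by 1. *)
Lemma h_ge (z : C) : Cmod z <= Cmod (h z).
Proof.
  assert (H : Cmod (RtoC ((K + 1) / 2) * z)
    <= Cmod (h z) + Cmod (cis (2 * theta) * RtoC ((K - 1) / 2) * Cconj z)).
  { replace (RtoC ((K + 1) / 2) * z)%C
      with (h z + - (cis (2 * theta) * RtoC ((K - 1) / 2) * Cconj z))%C
      by (unfold Defs.h; ring).
    eapply Rle_trans; [apply Cmod_triangle|]. rewrite Cmod_opp. lra. }
  rewrite !Cmod_mult, Cmod_cis, !Cmod_R, Cmod_conj, !Rabs_pos_eq in H by lra. lra.
Qed.

Lemma h_eq_0 (z : C) : h z = RtoC 0 -> z = RtoC 0.
Proof.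
  intros H. apply Cmod_eq_0. pose proof (h_ge z) as H1. rewrite H, Cmod_0 in H1.
  pose proof (Cmod_ge_0 z). lra.
Qed.

Lemma h_inj (z w : C) : h z = h w -> z = w.
Proof.
  intros H. assert (H1 : (z - w)%C = RtoC 0) by (apply h_eq_0; rewrite h_minus, H; ring).
  replace z with ((z - w) + w)%C by ring. rewrite H1. ring.
Qed.

Lemma hinv_h (z : C) : hinv (h z) = z.
Proof. apply h_inj, h_hinv. Qed.

(* The squares [h z ^ 2] with [Cmod z = 1] form an ellipse with a focus at [0] and major axis
   in the direction [cis (2 * theta)]. *)
Lemma h_focal (z : C) :
  (K ^ 2 + 1) * Cmod (h z * h z) -
    (K ^ 2 - 1) * Re (h z * h z * Cconj (cis (2 * theta))) = 2 * K ^ 2 * Cmod z ^ 2.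
Proof.
  rewrite Cmod_mult.
  replace (Cmod (h z) * Cmod (h z)) with (Cmod (h z) ^ 2) by ring. rewrite !Cmod_sqr.
  pose proof (cis_norm (2 * theta)) as H. unfold Defs.h, cis.
  destruct z as [x y]. simpl in *.
  set (c := cos (2 * theta)) in *. set (s := sin (2 * theta)) in *.
  assert (Hs : s * s = 1 - c * c) by lra. clear H.
  set (a := (K + 1) / 2).
  replace ((K - 1) / 2) with (a - 1) by (unfold a; field).
  replace K with (2 * a - 1) by (unfold a; field).
  ring [Hs].
Qed.

Lemma csqrt_ex (z : C) : exists w : C, (w * w)%C = z.
Proof.
  pose proof (Cmod_sqr z) as Hz. pose proof (Cmod_ge_0 z) as Hp.
  pose proof (Rmax_Cmod z) as Hm.
  assert (Hx : Rabs (Re z) <= Cmod z) by (eapply Rle_trans; [apply Rmax_l|apply Hm]).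
  apply Rabs_le_between in Hx.
  set (a := sqrt ((Cmod z + Re z) / 2)). set (b := sqrt ((Cmod z - Re z) / 2)).
  assert (Ha : a * a = (Cmod z + Re z) / 2) by (apply sqrt_sqrt; lra).
  assert (Hb : b * b = (Cmod z - Re z) / 2) by (apply sqrt_sqrt; lra).
  assert (Hab : (2 * (a * b)) * (2 * (a * b)) = Im z * Im z).
  { replace ((2 * (a * b)) * (2 * (a * b))) with (4 * (a * a) * (b * b)) by ring.
    rewrite Ha, Hb. nra. }
  assert (Hab' : 2 * (a * b) = Im z \/ 2 * (a * b) = - Im z).
  { destruct (Req_dec (2 * (a * b)) (Im z)); [left; assumption|right].
    apply Rmult_eq_reg_l with (2 * (a * b) - Im z); [nra|lra]. }
  destruct Hab' as [H|H]; [exists (a, b) | exists (a, - b)]; apply C_ext; simpl; nra.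
Qed.

Lemma fc_opp (c z : C) : fc K theta c (- z) = fc K theta c z.
Proof. unfold fc. rewrite h_opp. ring. Qed.

Lemma fc_sq_eq (c z w : C) : fc K theta c z = fc K theta c w -> z = w \/ z = (- w)%C.
Proof.
  unfold fc. intros H.
  assert (H1 : ((h z - h w) * (h z + h w))%C = RtoC 0).
  { replace ((h z - h w) * (h z + h w))%C with ((h z * h z + c) - (h w * h w + c))%C by ring.
    rewrite H. ring. }
  destruct (Ceq_dec (h z - h w)%C (RtoC 0)) as [E|E].
  - left. apply h_inj. replace (h z) with ((h z - h w) + h w)%C by ring. rewrite E. ring.
  - right. apply h_inj. rewrite h_opp.
    destruct (Ceq_dec (h z + h w)%C (RtoC 0)) as [E'|E'].
    + replace (h z) with ((h z + h w) - h w)%C by ring. rewrite E'. ring.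
    + exfalso. exact (Cmult_neq_0 _ _ E E' H1).
Qed.

Lemma fc_0 (c : C) : fc K theta c (RtoC 0) = c.
Proof. unfold fc. rewrite h_0. ring. Qed.

Lemma Cmod_fc_le (c z : C) : Cmod (fc K theta c z) <= K ^ 2 * Cmod z ^ 2 + Cmod c.
Proof.
  unfold fc. eapply Rle_trans; [apply Cmod_triangle|]. rewrite Cmod_mult.
  pose proof (h_le z). pose proof (Cmod_ge_0 (h z)). nra.
Qed.

Lemma Cmod_fc_ge (c z : C) : Cmod z ^ 2 - Cmod c <= Cmod (fc K theta c z).
Proof.
  assert (H : Cmod (h z * h z) <= Cmod (fc K theta c z) + Cmod c).
  { replace (h z * h z)%C with (fc K theta c z + - c)%C by (unfold fc; ring).
    eapply Rle_trans; [apply Cmod_triangle|]. rewrite Cmod_opp. lra. }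
  rewrite Cmod_mult in H. pose proof (h_ge z). pose proof (Cmod_ge_0 z). nra.
Qed.

(* If [Cmod z] exceeded [r := Cmod (fc K theta c z)], then [focal_descent], applied to
   [h z ^ 2] and the radii [rho < r], would give a point outside the disc of radius [rho] whose
   image has modulus [rho]. *)
Lemma fc_expand (c : C) (rho : R) :
  0 < rho -> (forall z, rho < Cmod z -> rho < Cmod (fc K theta c z)) ->
  forall z, rho < Cmod z -> Cmod z <= Cmod (fc K theta c z).
Proof.
  intros hrho hinvar z hz.
  destruct (Rle_lt_dec (Cmod z) (Cmod (fc K theta c z))) as [|hlt]; [assumption|exfalso].
  pose proof (hinvar z hz) as hr.
  set (r := Cmod (fc K theta c z)) in *.
  (* Multiplying by [Cconj E] turns the major axis of the ellipse onto the real axis, the position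
     that [focal_descent] assumes, and preserves moduli. *)
  set (E := cis (2 * theta)).
  set (y := (h z * h z * Cconj E)%C). set (b := (c * Cconj E)%C).
  assert (HE : Cmod (Cconj E) = 1) by (rewrite Cmod_conj; apply Cmod_cis).
  assert (Hy : Cmod y = Cmod (h z * h z)) by (unfold y; rewrite Cmod_mult, HE; ring).
  pose proof (h_focal z) as HN. fold E in HN. fold y in HN. rewrite <- Hy in HN.
  (* The eccentricity of the ellipse. With it [h_focal] says that |y| - e Re y is a constant times
     |z|^2, so the focal form of the image recovers the modulus of the preimage. *)
  set (e := (K ^ 2 - 1) / (K ^ 2 + 1)).
  assert (HK2 : 1 < K ^ 2) by nra.
  assert (he : 0 <= e < 1).
  { unfold e. split; [apply Rdiv_le_0_compat; lra|].
    apply Rmult_lt_reg_r with (K ^ 2 + 1); [lra|].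
    unfold Rdiv. rewrite Rmult_assoc, Rinv_l; lra. }
  assert (hz0 : 0 < Cmod z ^ 2) by (apply pow_lt; lra).
  assert (Hfoc : Cmod y - e * Re y = 2 * K ^ 2 / (K ^ 2 + 1) * Cmod z ^ 2).
  { apply Rmult_eq_reg_l with (K ^ 2 + 1); [|lra].
    transitivity (2 * K ^ 2 * Cmod z ^ 2); [rewrite <- HN; unfold e; field; lra | field; lra]. }
  assert (hq : 0 < 2 * K ^ 2 / (K ^ 2 + 1)) by (apply Rdiv_lt_0_compat; lra).
  assert (hy0 : 0 < Cmod y).
  { rewrite Hy, Cmod_mult. pose proof (h_ge z). nra. }
  destruct (focal_descent e (Re y) (Im y) (Re b) (Im b) rho r) as [x1 [x2 [H1 H2]]].
  - exact he.
  - lra.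
  - transitivity (Cmod (y + b) ^ 2); [rewrite Cmod_sqr; reflexivity|].
    unfold y, b, r. f_equal.
    replace (h z * h z * Cconj E + c * Cconj E)%C with (fc K theta c z * Cconj E)%C
      by (unfold fc; ring).
    rewrite Cmod_mult, HE. ring.
  - exact hy0.
  - change (sqrt (Re y ^ 2 + Im y ^ 2)) with (Cmod y) in H2. rewrite Hfoc in H2.
    set (x := (x1, x2) : C). change (sqrt (x1 ^ 2 + x2 ^ 2)) with (Cmod x) in H2.
    destruct (csqrt_ex (x * E)) as [s Hs].
    set (z' := hinv s).
    assert (Hhz : (h z' * h z')%C = (x * E)%C) by (unfold z'; rewrite h_hinv; exact Hs).
    assert (Hx : (h z' * h z' * Cconj E)%C = x).
    { rewrite Hhz, <- Cmult_assoc. unfold E. rewrite cis_conj. ring. }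
    pose proof (h_focal z') as HN'. fold E in HN'. rewrite Hx in HN'.
    assert (Hxm : Cmod (h z' * h z') = Cmod x) by (rewrite Hhz, Cmod_mult; unfold E; rewrite Cmod_cis; ring).
    rewrite Hxm in HN'.
    assert (Hfoc' : Cmod x - e * x1 = 2 * K ^ 2 / (K ^ 2 + 1) * Cmod z' ^ 2).
    { apply Rmult_eq_reg_l with (K ^ 2 + 1); [|lra].
      transitivity (2 * K ^ 2 * Cmod z' ^ 2); [rewrite <- HN'; simpl; unfold e; field; nra | field; lra]. }
    rewrite Hfoc' in H2.
    (* The assumption r < |z| enters here: it gives (rho / r) |z| > rho. *)
    assert (Hz' : rho < Cmod z').
    { assert ((rho / r) ^ 2 * Cmod z ^ 2 <= Cmod z' ^ 2).
      { apply Rmult_le_reg_l with (2 * K ^ 2 / (K ^ 2 + 1)); [exact hq|]. lra. }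
      assert (Hrr : (rho / r) * r = rho) by (field; lra).
      assert (0 < rho / r) by (apply Rdiv_lt_0_compat; lra).
      assert (rho < rho / r * Cmod z) by (rewrite <- Hrr at 1; apply Rmult_lt_compat_l; lra).
      assert (rho ^ 2 < Cmod z' ^ 2) by nra.
      pose proof (Cmod_ge_0 z'). nra. }
    pose proof (hinvar z' Hz') as Hc.
    assert (Cmod (fc K theta c z') = rho).
    { transitivity (Cmod (x + b)).
      - rewrite <- Hx. unfold b.
        replace (h z' * h z' * Cconj E + c * Cconj E)%C with (fc K theta c z' * Cconj E)%C
          by (unfold fc; ring).
        rewrite Cmod_mult, HE. ring.
      - pose proof (Cmod_sqr (x + b)) as H3. simpl in H3, H1.
        unfold Cmod. rewrite <- (sqrt_pow2 rho) by lra. f_equal. simpl. lra. }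
    lra.
Qed.

End Stretch.

(** * Continuous square roots on boxes *)

(** The uniform structure of the target is fixed by hand, because the plane carries several
    convertible ones and unification may pick another. *)
Notation Ccont f x := (@continuous _ C_UniformSpace f x).
Notation Rcont f x := (@continuous _ R_UniformSpace f x).

Section Continuity.
Context {T : UniformSpace}.

Lemma Ccont_pair (f : T -> C) (x : T) :
  Rcont (fun y => Re (f y)) x -> Rcont (fun y => Im (f y)) x -> Ccont f x.
Proof.
  intros H1 H2 P [eps HP].
  assert (L1 := H1 _ (locally_ball (Re (f x)) eps)).
  assert (L2 := H2 _ (locally_ball (Im (f x)) eps)).
  unfold filtermap in *. generalize (filter_and _ _ L1 L2).
  apply filter_imp. intros y [A B]. apply HP. split; assumption.
Qed.

Lemma Ccont_Re (f : T -> C) (x : T) : Ccont f x -> Rcont (fun y => Re (f y)) x.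
Proof.
  intros H P [eps HP]. assert (L := H _ (locally_ball (f x) eps)). unfold filtermap in *.
  revert L. apply filter_imp. intros y Hy. apply HP. apply Hy.
Qed.

Lemma Ccont_Im (f : T -> C) (x : T) : Ccont f x -> Rcont (fun y => Im (f y)) x.
Proof.
  intros H P [eps HP]. assert (L := H _ (locally_ball (f x) eps)). unfold filtermap in *.
  revert L. apply filter_imp. intros y Hy. apply HP. apply Hy.
Qed.

Lemma Rcont_const (a : R) (x : T) : Rcont (fun _ : T => a) x.
Proof. apply continuous_const. Qed.

Lemma Rcont_plus (f g : T -> R) (x : T) : Rcont f x -> Rcont g x -> Rcont (fun y => f y + g y) x.
Proof. intros. apply (continuous_plus (V := R_NormedModule) f g); assumption. Qed.

Lemma Rcont_opp (f : T -> R) (x : T) : Rcont f x -> Rcont (fun y => - f y) x.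
Proof. intros. apply (continuous_opp (V := R_NormedModule) f); assumption. Qed.

Lemma Rcont_minus (f g : T -> R) (x : T) : Rcont f x -> Rcont g x -> Rcont (fun y => f y - g y) x.
Proof. intros. apply Rcont_plus; [|apply Rcont_opp]; assumption. Qed.

Lemma Rcont_mult (f g : T -> R) (x : T) : Rcont f x -> Rcont g x -> Rcont (fun y => f y * g y) x.
Proof. intros. apply (continuous_mult (K := R_AbsRing) f g); assumption. Qed.

Lemma Rcont_inv (f : T -> R) (x : T) : Rcont f x -> f x <> 0 -> Rcont (fun y => / f y) x.
Proof. intros. apply continuous_comp with (g := Rinv); [assumption|]. apply continuous_Rinv; assumption. Qed.

Lemma Rcont_div (f g : T -> R) (x : T) :
  Rcont f x -> Rcont g x -> g x <> 0 -> Rcont (fun y => f y / g y) x.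
Proof. intros. apply Rcont_mult; [|apply Rcont_inv]; assumption. Qed.

Lemma Rcont_sqrt (f : T -> R) (x : T) : Rcont f x -> Rcont (fun y => sqrt (f y)) x.
Proof.
  intros. apply continuous_comp with (g := sqrt); [assumption|]. apply continuous_sqrt.
Qed.

Lemma Rcont_Rmax (f g : T -> R) (x : T) : Rcont f x -> Rcont g x -> Rcont (fun y => Rmax (f y) (g y)) x.
Proof.
  intros Hf Hg P [eps HP].
  assert (L1 := Hf _ (locally_ball (f x) eps)).
  assert (L2 := Hg _ (locally_ball (g x) eps)).
  unfold filtermap in *. generalize (filter_and _ _ L1 L2). apply filter_imp. intros y [A B]. apply HP.
  apply Rabs_lt_between. apply Rabs_lt_between in A. apply Rabs_lt_between in B.
  unfold minus, plus, opp in *; simpl in *.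
  unfold Rmax. repeat destruct Rle_dec; lra.
Qed.

Lemma Rcont_Rmin (f g : T -> R) (x : T) : Rcont f x -> Rcont g x -> Rcont (fun y => Rmin (f y) (g y)) x.
Proof.
  intros Hf Hg.
  apply continuous_ext with (fun y => - Rmax (- f y) (- g y)).
  - intros y. rewrite <- (Ropp_involutive (Rmin (f y) (g y))), Ropp_Rmin. reflexivity.
  - apply Rcont_opp, Rcont_Rmax; apply Rcont_opp; assumption.
Qed.

Lemma Ccont_const (a : C) (x : T) : Ccont (fun _ : T => a) x.
Proof. apply continuous_const. Qed.

Lemma Ccont_RtoC (f : T -> R) (x : T) : Rcont f x -> Ccont (fun y => RtoC (f y)) x.
Proof. intros. apply Ccont_pair; [assumption|apply Rcont_const]. Qed.

Lemma Ccont_plus (f g : T -> C) (x : T) : Ccont f x -> Ccont g x -> Ccont (fun y => (f y + g y)%C) x.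
Proof.
  intros Hf Hg. pose proof (Ccont_Re _ _ Hf). pose proof (Ccont_Im _ _ Hf).
  pose proof (Ccont_Re _ _ Hg). pose proof (Ccont_Im _ _ Hg).
  apply Ccont_pair; simpl; apply Rcont_plus; assumption.
Qed.

Lemma Ccont_opp (f : T -> C) (x : T) : Ccont f x -> Ccont (fun y => (- f y)%C) x.
Proof.
  intros Hf. pose proof (Ccont_Re _ _ Hf). pose proof (Ccont_Im _ _ Hf).
  apply Ccont_pair; simpl; apply Rcont_opp; assumption.
Qed.

Lemma Ccont_minus (f g : T -> C) (x : T) : Ccont f x -> Ccont g x -> Ccont (fun y => (f y - g y)%C) x.
Proof. intros. apply Ccont_plus; [|apply Ccont_opp]; assumption. Qed.

Lemma Ccont_conj (f : T -> C) (x : T) : Ccont f x -> Ccont (fun y => Cconj (f y)) x.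
Proof.
  intros Hf. pose proof (Ccont_Re _ _ Hf). pose proof (Ccont_Im _ _ Hf).
  apply Ccont_pair; simpl; [|apply Rcont_opp]; assumption.
Qed.

Lemma Ccont_mult (f g : T -> C) (x : T) : Ccont f x -> Ccont g x -> Ccont (fun y => (f y * g y)%C) x.
Proof.
  intros Hf Hg. pose proof (Ccont_Re _ _ Hf). pose proof (Ccont_Im _ _ Hf).
  pose proof (Ccont_Re _ _ Hg). pose proof (Ccont_Im _ _ Hg).
  apply Ccont_pair; simpl; [apply Rcont_minus|apply Rcont_plus]; apply Rcont_mult; assumption.
Qed.

Lemma Rcont_Cmod (f : T -> C) (x : T) : Ccont f x -> Rcont (fun y => Cmod (f y)) x.
Proof.
  intros Hf. pose proof (Ccont_Re _ _ Hf). pose proof (Ccont_Im _ _ Hf).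
  unfold Cmod. simpl. apply Rcont_sqrt, Rcont_plus; apply Rcont_mult; try assumption;
  apply Rcont_mult; try assumption; apply Rcont_const.
Qed.

Lemma Ccont_div (f g : T -> C) (x : T) :
  Ccont f x -> Ccont g x -> g x <> RtoC 0 -> Ccont (fun y => (f y / g y)%C) x.
Proof.
  intros Hf Hg H0. apply Ccont_mult; [assumption|].
  pose proof (Ccont_Re _ _ Hg). pose proof (Ccont_Im _ _ Hg).
  assert (Hn : fst (g x) * (fst (g x) * 1) + snd (g x) * (snd (g x) * 1) <> 0).
  { intros E. apply H0. apply Cmod_eq_0. unfold Cmod. simpl. rewrite E. apply sqrt_0. }
  assert (Rcont (fun y => fst (g y) * (fst (g y) * 1) + snd (g y) * (snd (g y) * 1)) x).
  { apply Rcont_plus; apply Rcont_mult; try assumption; apply Rcont_mult; try assumption; apply Rcont_const. }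
  apply Ccont_pair; simpl; apply Rcont_div; try assumption. apply Rcont_opp; assumption.
Qed.

Lemma Ccont_h (K theta : R) (f : T -> C) (x : T) : Ccont f x -> Ccont (fun y => h K theta (f y)) x.
Proof.
  intros Hf. unfold h. apply Ccont_plus; apply Ccont_mult; try apply Ccont_const; try assumption.
  apply Ccont_conj; assumption.
Qed.

Lemma Ccont_hinv (K theta : R) (f : T -> C) (x : T) : Ccont f x -> Ccont (fun y => hinv K theta (f y)) x.
Proof.
  intros Hf. unfold hinv, Cdiv. apply Ccont_mult; [|apply Ccont_const].
  apply Ccont_minus; apply Ccont_mult; try apply Ccont_const; try assumption.
  apply Ccont_conj; assumption.
Qed.

Lemma Ccont_fc (K theta : R) (c f : T -> C) (x : T) :
  Ccont c x -> Ccont f x -> Ccont (fun y => fc K theta (c y) (f y)) x.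
Proof.
  intros Hc Hf. unfold fc. apply Ccont_plus; [|assumption].
  apply Ccont_mult; apply Ccont_h; assumption.
Qed.

Lemma Ccont_iter (K theta : R) (n : nat) (c f : T -> C) (x : T) :
  Ccont c x -> Ccont f x -> Ccont (fun y => Nat.iter n (fc K theta (c y)) (f y)) x.
Proof.
  intros Hc Hf. induction n as [|n IH]; simpl; [assumption|]. apply Ccont_fc; assumption.
Qed.

Lemma Ccont_comp (g : C -> C) (f : T -> C) (x : T) :
  Ccont f x -> @continuous C_UniformSpace C_UniformSpace g (f x) -> Ccont (fun y => g (f y)) x.
Proof. intros Hf Hg. exact (continuous_comp f g x Hf Hg). Qed.

End Continuity.

(* Junk on the negative real axis. *)
Definition sqrtp (z : C) : C :=
  (sqrt ((Cmod z + Re z) / 2), Im z / (2 * sqrt ((Cmod z + Re z) / 2))).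

Lemma sqrtp_arg_pos (z : C) : 0 < Re z -> 0 < sqrt ((Cmod z + Re z) / 2).
Proof. intros. apply sqrt_lt_R0. pose proof (Cmod_ge_0 z). lra. Qed.

Lemma sqrtp_sqr (z : C) : 0 < Re z -> (sqrtp z * sqrtp z)%C = z.
Proof.
  intros Hz. pose proof (sqrtp_arg_pos z Hz) as Ha. pose proof (Cmod_ge_0 z).
  unfold sqrtp. set (a := sqrt ((Cmod z + Re z) / 2)) in *.
  assert (Haa : a * a = (Cmod z + Re z) / 2) by (apply sqrt_sqrt; lra).
  pose proof (Cmod_sqr z) as Hc.
  apply C_ext; simpl; [|field; lra].
  replace (Im z / (2 * a) * (Im z / (2 * a))) with (Im z ^ 2 / (4 * (a * a))) by (field; lra).
  rewrite Haa.
  replace (Im z ^ 2) with (Cmod z ^ 2 - Re z ^ 2) by lra. field. lra.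
Qed.

(** Ensures that the product of roots in [sqrt_lift] is 1 at the base point, so that the lift starts
    at the prescribed root. *)
Lemma sqrtp_1 : sqrtp (RtoC 1) = RtoC 1.
Proof.
  unfold sqrtp. rewrite Cmod_1. simpl. replace ((1 + 1) / 2) with 1 by field. rewrite sqrt_1.
  apply C_ext; simpl; field.
Qed.

Lemma Ccont_sqrtp {T : UniformSpace} (f : T -> C) (x : T) :
  Ccont f x -> 0 < Re (f x) -> Ccont (fun y => sqrtp (f y)) x.
Proof.
  intros Hf H0. pose proof (Ccont_Re _ _ Hf). pose proof (Ccont_Im _ _ Hf).
  pose proof (sqrtp_arg_pos _ H0).
  assert (Rcont (fun y => sqrt ((Cmod (f y) + Re (f y)) / 2)) x).
  { apply Rcont_sqrt, Rcont_mult; [|apply Rcont_const]. apply Rcont_plus; [|assumption].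
    apply Rcont_Cmod; assumption. }
  apply Ccont_pair; simpl; [assumption|].
  apply Rcont_div; [assumption| |lra]. apply Rcont_mult; [apply Rcont_const|assumption].
Qed.

(* Parameter space of the liftings below; it plays the role of both [C * R] and [R * R]. *)
Definition X : UniformSpace := prod_UniformSpace C_UniformSpace R_UniformSpace.

Definition clampR (a b x : R) : R := Rmax a (Rmin b x).

Lemma clampR_in (a b x : R) : a <= b -> a <= clampR a b x <= b.
Proof. intros. unfold clampR, Rmax, Rmin. repeat destruct Rle_dec; lra. Qed.

Lemma clampR_id (a b x : R) : a <= x <= b -> clampR a b x = x.
Proof. intros. unfold clampR, Rmax, Rmin. repeat destruct Rle_dec; lra. Qed.

Definition inbox (a b x : X) : Prop :=
  Re (fst a) <= Re (fst x) <= Re (fst b) /\ Im (fst a) <= Im (fst x) <= Im (fst b) /\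
  snd a <= snd x <= snd b.

Lemma Ccont_fstX (x : X) : @continuous X C_UniformSpace (fun y => fst y) x.
Proof. apply continuous_fst. Qed.
Lemma Rcont_sndX (x : X) : @continuous X R_UniformSpace (fun y => snd y) x.
Proof. apply continuous_snd. Qed.

Lemma Xcont_pair {T : UniformSpace} (f : T -> C) (g : T -> R) (x : T) :
  Ccont f x -> Rcont g x -> @continuous T X (fun y => (f y, g y)) x.
Proof.
  intros Hf Hg P [eps HP].
  assert (L1 := Hf _ (locally_ball (f x) eps)). assert (L2 := Hg _ (locally_ball (g x) eps)).
  unfold filtermap in *. generalize (filter_and _ _ L1 L2). apply filter_imp. intros y [A B]. apply HP. split; assumption.
Qed.

Lemma Ccont_eps {T : UniformSpace} (f : T -> C) (x : T) (eps : R) :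
  Ccont f x -> 0 < eps -> locally x (fun y => Cmod (f y - f x)%C < eps).
Proof.
  intros Hf He.
  assert (He2 : 0 < eps / 2) by lra.
  assert (L := Hf _ (locally_ball (f x) (mkposreal _ He2))).
  unfold filtermap in L. revert L. apply filter_imp. intros y [A B]. simpl in A, B.
  change (Rabs (Re (f y) - Re (f x)) < eps / 2) in A.
  change (Rabs (Im (f y) - Im (f x)) < eps / 2) in B.
  eapply Rle_lt_trans; [apply Cmod_2Rmax|].
  assert (Hm : Rmax (Rabs (fst (f y - f x)%C)) (Rabs (snd (f y - f x)%C)) < eps / 2)
    by (apply Rmax_lub_lt; assumption).
  assert (H2 : sqrt 2 * sqrt 2 = 2) by (apply sqrt_sqrt; lra).
  assert (0 < sqrt 2) by (apply sqrt_lt_R0; lra).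
  assert (sqrt 2 < 2) by nra.
  assert (0 <= Rmax (Rabs (fst (f y - f x)%C)) (Rabs (snd (f y - f x)%C))).
  { eapply Rle_trans; [apply Rabs_pos|apply Rmax_l]. }
  nra.
Qed.

Lemma Rabs_minus_lt (p q r d1 d2 d : R) :
  Rabs (p - q) < d1 -> Rabs (q - r) < d2 -> d1 + d2 <= d -> Rabs (p - r) < d.
Proof.
  intros H1 H2 H3. apply Rabs_lt_between. apply Rabs_lt_between in H1.
  apply Rabs_lt_between in H2. lra.
Qed.

(** Near each point [u] varies by less than a quarter of its modulus there, and compactness makes
    the radius uniform. Two points near the same w then satisfy |u y - u x| < |w| / 2 while |u x| >
    3 |w| / 4. The local radii are doubled because y is within [d] of x, and x within [delta t] of
    the centre. *)
Lemma box_ratio (u : X -> C) (a b : X) :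
  (forall x, inbox a b x -> Ccont u x) -> (forall x, inbox a b x -> u x <> RtoC 0) ->
  exists d : posreal, forall x y : X, inbox a b x -> inbox a b y ->
    Rabs (Re (fst y) - Re (fst x)) < d -> Rabs (Im (fst y) - Im (fst x)) < d ->
    Rabs (snd y - snd x) < d -> Cmod (u y - u x)%C < Cmod (u x).
Proof.
  intros Hc H0.
  set (toX := fun t : Compactness.Tn 3 R => ((fst t, fst (snd t)), fst (snd (snd t))) : X).
  set (toT := fun x : X => (Re (fst x), (Im (fst x), (snd x, tt))) : Compactness.Tn 3 R).
  assert (Hex : forall t : Compactness.Tn 3 R, exists d : posreal, inbox a b (toX t) ->
    forall y : X, Rabs (Re (fst y) - Re (fst (toX t))) < 2 * d ->
      Rabs (Im (fst y) - Im (fst (toX t))) < 2 * d -> Rabs (snd y - snd (toX t)) < 2 * d ->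
      Cmod (u y - u (toX t))%C < Cmod (u (toX t)) / 4).
  { intros t. destruct (classic (inbox a b (toX t))) as [Ht|Ht].
    - pose proof (Cmod_gt_0 (u (toX t))) as [Hp _]. specialize (Hp (H0 _ Ht)).
      destruct (Ccont_eps u (toX t) (Cmod (u (toX t)) / 4) (Hc _ Ht)) as [eps He]; [lra|].
      assert (Hd : 0 < eps / 2) by (pose proof (cond_pos eps); lra).
      exists (mkposreal _ Hd). intros _ y H1 H2 H3. simpl in H1, H2, H3. apply He.
      pose proof (cond_pos eps).
      split; [split|]; match goal with |- ball ?p _ ?q => change (Rabs (q - p) < eps) end.
      + eapply Rlt_le_trans; [exact H1|lra].
      + eapply Rlt_le_trans; [exact H2|lra].
      + eapply Rlt_le_trans; [exact H3|lra].
    - exists (mkposreal 1 Rlt_0_1). tauto. }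
  assert (Hch : exists delta : Compactness.Tn 3 R -> posreal, forall t, inbox a b (toX t) ->
    forall y : X, Rabs (Re (fst y) - Re (fst (toX t))) < 2 * delta t ->
      Rabs (Im (fst y) - Im (fst (toX t))) < 2 * delta t -> Rabs (snd y - snd (toX t)) < 2 * delta t ->
      Cmod (u y - u (toX t))%C < Cmod (u (toX t)) / 4).
  { exists (fun t => proj1_sig (constructive_indefinite_description _ (Hex t))).
    intros t. exact (proj2_sig (constructive_indefinite_description _ (Hex t))). }
  destruct Hch as [delta Hdelta].
  destruct (compactness_value 3 (toT a) (toT b) delta) as [d Hd].
  exists d. intros x y Hx Hy H1 H2 H3.
  (* [compactness_value] yields the centre [t] only under a double negation. *)
  apply NNPP. intros Hn. apply (Hd (toT x)).
  { destruct Hx as [? [? ?]]. simpl. unfold Re, Im in *. tauto. }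
  intros [t [Ht [Hcl Hle]]]. apply Hn. clear Hn.
  destruct t as [t1 [t2 [t3 []]]]. simpl in Ht, Hcl.
  assert (Hb : inbox a b (toX (t1, (t2, (t3, tt))))) by (unfold inbox, Re, Im in *; simpl in *; tauto).
  specialize (Hdelta _ Hb).
  set (dt := delta (t1, (t2, (t3, tt)))) in *.
  destruct Hcl as [G1 [G2 [G3 _]]].
  assert (Ax : Cmod (u x - u (toX (t1, (t2, (t3, tt)))))%C < Cmod (u (toX (t1, (t2, (t3, tt))))) / 4).
  { apply Hdelta; simpl; pose proof (cond_pos dt); eapply Rlt_trans; try eassumption; lra. }
  assert (Ay : Cmod (u y - u (toX (t1, (t2, (t3, tt)))))%C < Cmod (u (toX (t1, (t2, (t3, tt))))) / 4).
  { change (pos d <= pos dt) in Hle.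
    apply Hdelta; simpl.
    - apply Rabs_minus_lt with (Re (fst x)) d dt; [assumption..|lra].
    - apply Rabs_minus_lt with (Im (fst x)) d dt; [assumption..|lra].
    - apply Rabs_minus_lt with (snd x) d dt; [assumption..|lra]. }
  set (w := u (toX (t1, (t2, (t3, tt))))) in *.
  assert (Hxy : Cmod (u y - u x)%C <= Cmod (u y - w)%C + Cmod (u x - w)%C).
  { replace (u y - u x)%C with ((u y - w) + - (u x - w))%C by ring.
    eapply Rle_trans; [apply Cmod_triangle|]. rewrite Cmod_opp. lra. }
  assert (Hw : Cmod w <= Cmod (u x - w)%C + Cmod (u x)).
  { replace w with (- (u x - w) + u x)%C at 1 by ring.
    eapply Rle_trans; [apply Cmod_triangle|]. rewrite Cmod_opp. lra. }
  pose proof (Cmod_ge_0 (u x - w)%C). lra.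
Qed.

(* Clamping [x] keeps the path inside the box, so that liftings built along it are total. *)
Definition seg (a b x0 : X) (s : R) (x : X) : X :=
  ((Re (fst x0) + s * (clampR (Re (fst a)) (Re (fst b)) (Re (fst x)) - Re (fst x0)),
    Im (fst x0) + s * (clampR (Im (fst a)) (Im (fst b)) (Im (fst x)) - Im (fst x0))) : C,
   snd x0 + s * (clampR (snd a) (snd b) (snd x) - snd x0)).

Lemma Rle_bounds (l p u : R) : l <= p <= u -> l <= u.
Proof. lra. Qed.

Lemma convex_in (l u p q s : R) : l <= p <= u -> l <= q <= u -> 0 <= s <= 1 -> l <= p + s * (q - p) <= u.
Proof. intros. split; nra. Qed.

Lemma seg_in (a b x0 : X) (s : R) (x : X) :
  inbox a b x0 -> 0 <= s <= 1 -> inbox a b (seg a b x0 s x).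
Proof.
  intros [H1 [H2 H3]] Hs. unfold seg, inbox; simpl.
  split; [|split]; (apply convex_in; [assumption | apply clampR_in; eapply Rle_bounds; eassumption | exact Hs]).
Qed.

Lemma seg_cont (a b x0 : X) (s : R) (x : X) : @continuous X X (seg a b x0 s) x.
Proof.
  assert (Hcl : forall (l u p : R) (f : X -> R), Rcont f x ->
    Rcont (fun y => p + s * (clampR l u (f y) - p)) x).
  { intros l u p f Hf. apply Rcont_plus; [apply Rcont_const|].
    apply Rcont_mult; [apply Rcont_const|]. apply Rcont_minus; [|apply Rcont_const].
    apply Rcont_Rmax; [apply Rcont_const|]. apply Rcont_Rmin; [apply Rcont_const|assumption]. }
  unfold seg. apply Xcont_pair.
  - apply Ccont_pair; simpl; apply Hcl.
    + exact (Ccont_Re _ _ (Ccont_fstX x)).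
    + exact (Ccont_Im _ _ (Ccont_fstX x)).
  - apply Hcl. apply Rcont_sndX.
Qed.

Lemma seg_0 (a b x0 x : X) : seg a b x0 0 x = x0.
Proof.
  destruct x0 as [[p q] r]. unfold seg. simpl. rewrite !Rmult_0_l, !Rplus_0_r. reflexivity.
Qed.

Lemma seg_1 (a b x0 x : X) : inbox a b x -> seg a b x0 1 x = x.
Proof.
  intros [H1 [H2 H3]]. destruct x as [[p q] r]. unfold seg. simpl in *.
  rewrite !clampR_id by assumption. repeat f_equal; ring.
Qed.

Lemma seg_base (a b x0 : X) (s : R) : inbox a b x0 -> seg a b x0 s x0 = x0.
Proof.
  intros [H1 [H2 H3]]. destruct x0 as [[p q] r]. unfold seg. simpl in *.
  rewrite !clampR_id by assumption. repeat f_equal; ring.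
Qed.

(** Bounding the sum of the three side lengths lets a single [N] serve all coordinates. *)
Lemma seg_step (a b x0 : X) (N : nat) (d : posreal) :
  inbox a b x0 ->
  Re (fst b) - Re (fst a) + (Im (fst b) - Im (fst a)) + (snd b - snd a) < INR N * d ->
  forall k x, (0 < N)%nat ->
    let y := seg a b x0 (INR k / INR N) x in
    let y' := seg a b x0 (INR (S k) / INR N) x in
    Rabs (Re (fst y') - Re (fst y)) < d /\ Rabs (Im (fst y') - Im (fst y)) < d /\
    Rabs (snd y' - snd y) < d.
Proof.
  intros [H1 [H2 H3]] HN k x Hpos. simpl.
  assert (HN0 : 0 < INR N) by (apply lt_0_INR; assumption).
  assert (Hgen : forall l u p q, l <= p <= u -> u - l < INR N * d ->
    Rabs (p + INR (S k) / INR N * (clampR l u q - p) - (p + INR k / INR N * (clampR l u q - p))) < d).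
  { intros l u p q Hp Hlu. rewrite S_INR.
    replace (p + (INR k + 1) / INR N * (clampR l u q - p) - (p + INR k / INR N * (clampR l u q - p)))
      with ((clampR l u q - p) / INR N) by (field; lra).
    assert (l <= clampR l u q <= u) by (apply clampR_in; lra).
    unfold Rdiv. rewrite Rabs_mult, (Rabs_pos_eq (/ INR N)) by (left; apply Rinv_0_lt_compat; lra).
    apply Rmult_lt_reg_r with (INR N); [lra|]. rewrite Rmult_assoc, Rinv_l by lra.
    rewrite Rmult_1_r, Rmult_comm. eapply Rle_lt_trans; [|exact Hlu]. apply Rabs_le. lra. }
  assert (Hsum : forall w1 w2 w3 M, 0 <= w1 -> 0 <= w2 -> 0 <= w3 -> w1 + w2 + w3 < M ->
    w1 < M /\ w2 < M /\ w3 < M) by (intros; lra).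
  destruct (Hsum _ _ _ _ (proj1 (Rminus_le_0 _ _) (Rle_bounds _ _ _ H1))
    (proj1 (Rminus_le_0 _ _) (Rle_bounds _ _ _ H2))
    (proj1 (Rminus_le_0 _ _) (Rle_bounds _ _ _ H3)) HN) as [W1 [W2 W3]].
  split; [|split]; apply Hgen; assumption.
Qed.

Fixpoint prodC (f : nat -> C) (n : nat) : C :=
  match n with O => RtoC 1 | S k => (prodC f k * f k)%C end.

Lemma prodC_cont {T : UniformSpace} (f : nat -> T -> C) (n : nat) (x : T) :
  (forall k, (k < n)%nat -> Ccont (f k) x) -> Ccont (fun y => prodC (fun k => f k y) n) x.
Proof.
  induction n as [|n IH]; intros H; simpl.
  - apply Ccont_const.
  - apply Ccont_mult; [apply IH; intros; apply H; lia | apply H; lia].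
Qed.

Lemma Re_div_pos (z w : C) : w <> RtoC 0 -> Cmod (z - w)%C < Cmod w -> 0 < Re (z / w)%C.
Proof.
  intros Hw H.
  assert (Hw' : 0 < Cmod w) by (apply Cmod_gt_0; assumption).
  assert (Hm : Cmod (z / w - RtoC 1)%C < 1).
  { replace (z / w - RtoC 1)%C with ((z - w) / w)%C by (field; assumption).
    rewrite Cmod_div by assumption. apply Rmult_lt_reg_r with (Cmod w); [assumption|].
    unfold Rdiv. rewrite Rmult_assoc, Rinv_l; lra. }
  pose proof (Rmax_Cmod (z / w - RtoC 1)%C) as H1.
  pose proof (Rmax_l (Rabs (fst (z / w - RtoC 1)%C)) (Rabs (snd (z / w - RtoC 1)%C))) as H2.
  assert (H3 : Rabs (fst (z / w - RtoC 1)%C) < 1) by lra.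
  apply Rabs_lt_between in H3. simpl in H3. unfold Re. simpl. lra.
Qed.

(* The root is [s0] times the telescoping product of the principal roots of the ratios of [u]
   at consecutive points of a subdivided segment from [x0]; by [box_ratio] a fine subdivision
   keeps these ratios in the right half-plane, uniformly in the end point. *)
Lemma sqrt_lift (u : X -> C) (a b x0 : X) (s0 : C) :
  (forall x, inbox a b x -> Ccont u x) -> (forall x, inbox a b x -> u x <> RtoC 0) ->
  inbox a b x0 -> (s0 * s0)%C = u x0 ->
  exists s : X -> C, (forall x, Ccont s x) /\ s x0 = s0 /\
    forall x, inbox a b x -> (s x * s x)%C = u x.
Proof.
  intros Hc H0 Hx0 Hs0.
  destruct (box_ratio u a b Hc H0) as [d Hd].
  set (W := Re (fst b) - Re (fst a) + (Im (fst b) - Im (fst a)) + (snd b - snd a)).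
  assert (HW : 0 <= W) by (destruct Hx0 as [? [? ?]]; unfold W, Re, Im in *; lra).
  (* Dividing by W + 1 covers the degenerate box with W = 0. *)
  destruct (archimed_cor1 (d / (W + 1))) as [N [HN HN0]].
  { apply Rdiv_lt_0_compat; [apply cond_pos|lra]. }
  assert (HNR : 0 < INR N) by (apply lt_0_INR; assumption).
  assert (HWN : W < INR N * d).
  { apply Rmult_lt_compat_r with (r := INR N * (W + 1)) in HN; [|nra].
    replace (/ INR N * (INR N * (W + 1))) with (W + 1) in HN by (field; lra).
    replace (d / (W + 1) * (INR N * (W + 1))) with (INR N * d) in HN by (field; lra). lra. }
  set (pt := fun (k : nat) => seg a b x0 (INR k / INR N)).
  assert (Hk : forall k, (k <= N)%nat -> 0 <= INR k / INR N <= 1).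
  { intros k Hk. split; [apply Rdiv_le_0_compat; [apply pos_INR|assumption]|].
    apply Rmult_le_reg_r with (INR N); [assumption|]. unfold Rdiv.
    rewrite Rmult_assoc, Rinv_l, Rmult_1_r, Rmult_1_l by lra. apply le_INR; assumption. }
  assert (Hin : forall k x, (k <= N)%nat -> inbox a b (pt k x)).
  { intros. apply seg_in; [assumption|]. apply Hk; assumption. }
  assert (Hpos : forall k x, (k < N)%nat -> 0 < Re (u (pt (S k) x) / u (pt k x))%C).
  { intros k x Hkn. apply Re_div_pos; [apply H0, Hin; lia|].
    destruct (seg_step a b x0 N d Hx0 HWN k x HN0) as [A [B D]].
    apply Hd; try assumption; apply Hin; lia. }
  assert (Hcu : forall k x, (k <= N)%nat -> Ccont (fun y => u (pt k y)) x).
  { intros k x Hkn. apply (continuous_comp (pt k) u); [apply seg_cont|]. apply Hc, Hin; assumption. }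
  exists (fun x => (s0 * prodC (fun k => sqrtp (u (pt (S k) x) / u (pt k x))) N)%C).
  split; [|split].
  - intros x. apply Ccont_mult; [apply Ccont_const|].
    apply prodC_cont with (f := fun k y => sqrtp (u (pt (S k) y) / u (pt k y))).
    intros k Hkn. apply Ccont_sqrtp; [|apply Hpos; assumption].
    apply Ccont_div; [apply Hcu; lia | apply Hcu; lia | apply H0, Hin; lia].
  - assert (Hp : forall n, prodC (fun k => sqrtp (u (pt (S k) x0) / u (pt k x0))) n = RtoC 1).
    { induction n as [|n IH]; [reflexivity|]. simpl prodC. rewrite IH. unfold pt.
      rewrite !seg_base by assumption.
      replace (u x0 / u x0)%C with (RtoC 1) by (field; apply H0; assumption).
      rewrite sqrtp_1. ring. }
    rewrite Hp. ring.
  - intros x Hx.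
    assert (Hp : forall n, (n <= N)%nat ->
      (s0 * prodC (fun k => sqrtp (u (pt (S k) x) / u (pt k x))) n *
       (s0 * prodC (fun k => sqrtp (u (pt (S k) x) / u (pt k x))) n))%C = u (pt n x)).
    { induction n as [|n IH]; intros Hn.
      - simpl. unfold pt. simpl. replace (0 / INR N) with 0 by (field; lra). rewrite seg_0, <- Hs0. ring.
      - simpl prodC.
        set (p := prodC (fun k => sqrtp (u (pt (S k) x) / u (pt k x))) n) in *.
        set (r := sqrtp (u (pt (S n) x) / u (pt n x))).
        replace (s0 * (p * r) * (s0 * (p * r)))%C with ((s0 * p * (s0 * p)) * (r * r))%C by ring.
        rewrite IH by lia. unfold r. rewrite sqrtp_sqr by (apply Hpos; lia).
        field. apply H0, Hin; lia. }
    rewrite Hp by lia. unfold pt. replace (INR N / INR N) with 1 by (field; lra).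
    rewrite seg_1 by assumption. reflexivity.
Qed.

(** * Lifting and orbits *)

(** Connectedness of the interval, through the intermediate value theorem. It is applied to the real
    part of the quotient of two lifts that agree up to sign. *)
Lemma sign_constant (g : R -> R) (a b : R) :
  (forall t, a <= t <= b -> Rcont g t) -> (forall t, a <= t <= b -> g t = 1 \/ g t = -1) ->
  forall s t, a <= s <= b -> a <= t <= b -> g s = g t.
Proof.
  intros Hc Hv.
  assert (Hlt : forall s t, a <= s <= b -> a <= t <= b -> s < t -> g s = g t).
  { intros s t Hs Ht Hst.
    assert (Hno : forall f : R -> R, (forall x, s <= x <= t -> Rcont f x) ->
      (forall x, s <= x <= t -> f x <> 0) -> ~ (f s < 0 /\ 0 < f t)).
    { intros f Hf Hf0 [H1 H2].
      destruct (Ranalysis5.IVT_interv f s t) as [x [Hx Hx0]]; try assumption.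
      - intros x Hx. apply continuity_pt_filterlim, Hf. assumption.
      - exact (Hf0 x Hx Hx0). }
    destruct (Hv s Hs) as [E1|E1]; destruct (Hv t Ht) as [E2|E2]; try congruence; exfalso.
    - apply (Hno (fun x => - g x)).
      + intros x Hx. apply Rcont_opp, Hc. lra.
      + intros x Hx. destruct (Hv x); lra.
      + lra.
    - apply (Hno g).
      + intros x Hx. apply Hc. lra.
      + intros x Hx. destruct (Hv x); lra.
      + lra. }
  intros s t Hs Ht. destruct (Rtotal_order s t) as [H|[H|H]].
  - apply Hlt; assumption.
  - subst; reflexivity.
  - symmetry. apply Hlt; assumption.
Qed.

Lemma Re_div_self (z : C) : z <> RtoC 0 -> Re (z / z)%C = 1.
Proof. intros. replace (z / z)%C with (RtoC 1) by (field; assumption). reflexivity. Qed.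

Lemma iter_shift {A : Type} (f : A -> A) (n : nat) (x : A) : Nat.iter (S n) f x = Nat.iter n f (f x).
Proof. induction n as [|n IH]; [reflexivity|]. simpl in *. rewrite <- IH. reflexivity. Qed.

Lemma iter_plus {A : Type} (f : A -> A) (n m : nat) (x : A) :
  Nat.iter (n + m) f x = Nat.iter n f (Nat.iter m f x).
Proof. induction n as [|n IH]; [reflexivity|]. simpl. rewrite IH. reflexivity. Qed.

Section Dynamics.
Context (K theta : R) (hK : 1 < K).
Notation f := (fc K theta).
Notation h := (h K theta).
Notation hinv := (hinv K theta).
Notation P := (P K theta).

Lemma P_S (n : nat) (c : C) : P (S n) c = f c (P n c).
Proof. reflexivity. Qed.

Lemma iter_0_P (n : nat) (c : C) : Nat.iter (S n) (f c) (RtoC 0) = P n c.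
Proof. rewrite iter_shift, fc_0. reflexivity. Qed.

Lemma P_at_0 (n : nat) : P n (RtoC 0) = RtoC 0.
Proof. induction n as [|n IH]; [reflexivity|]. rewrite P_S, IH. apply fc_0. Qed.

(** The outermost [f] is undone first: a continuous root of [top - cp] exists because [top] avoids
    [P 0 c = c], and [hinv] of that root is the next target. It avoids [P i c] for i < n because its
    image avoids [P (S i) c]. *)
Lemma lift_iter (n : nat) (cp : X -> C) (a b x0 : X) :
  (forall x, inbox a b x -> Ccont cp x) -> inbox a b x0 ->
  forall (top : X -> C) (zb : C),
  (forall x, inbox a b x -> Ccont top x) ->
  (forall x i, inbox a b x -> (i < n)%nat -> top x <> P i (cp x)) ->
  Nat.iter n (f (cp x0)) zb = top x0 ->
  exists z : X -> C, (forall x, inbox a b x -> Ccont z x) /\ z x0 = zb /\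
    forall x, inbox a b x -> Nat.iter n (f (cp x)) (z x) = top x.
Proof.
  intros Hcp Hx0. induction n as [|n IH]; intros top zb Htop Hav Hzb.
  - exists top. simpl in *. auto.
  - set (yb := Nat.iter n (f (cp x0)) zb).
    destruct (sqrt_lift (fun x => (top x - cp x)%C) a b x0 (h yb)) as [s [Hs1 [Hs2 Hs3]]].
    + intros x Hx. apply Ccont_minus; auto.
    + intros x Hx E. apply (Hav x O Hx); [lia|].
      replace (top x) with ((top x - cp x) + cp x)%C by ring. rewrite E. simpl. ring.
    + assumption.
    + rewrite <- Hzb. simpl. unfold yb, fc. ring.
    + assert (Hf : forall x, inbox a b x -> f (cp x) (hinv (s x)) = top x).
      { intros x Hx. unfold fc. rewrite !(h_hinv K theta hK), Hs3 by assumption. ring. }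
      destruct (IH (fun x => hinv (s x)) zb) as [z [Hz1 [Hz2 Hz3]]].
      * intros x Hx. apply Ccont_hinv, Hs1.
      * intros x i Hx Hi E. apply (Hav x (S i) Hx); [lia|]. rewrite <- Hf, E by assumption. reflexivity.
      * fold yb. rewrite Hs2. symmetry. apply (hinv_h K theta hK).
      * exists z. split; [assumption|]. split; [assumption|].
        intros x Hx. simpl. rewrite Hz3, Hf by assumption. reflexivity.
Qed.

(** By induction the images f z and f z' agree, so z' = z or z' = -z at each time. Avoiding [P n c],
    the image of 0 under the n + 1 iterates, keeps z away from 0, hence the sign cannot jump. *)
Lemma lift_unique (n : nat) (cp : R -> C) (a b t0 : R) :
  (forall t, a <= t <= b -> Ccont cp t) -> a <= t0 <= b ->
  forall z z' : R -> C,
  (forall t, a <= t <= b -> Ccont z t) -> (forall t, a <= t <= b -> Ccont z' t) ->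
  (forall t i, a <= t <= b -> (i < n)%nat -> Nat.iter n (f (cp t)) (z t) <> P i (cp t)) ->
  (forall t, a <= t <= b -> Nat.iter n (f (cp t)) (z' t) = Nat.iter n (f (cp t)) (z t)) ->
  z' t0 = z t0 -> forall t, a <= t <= b -> z' t = z t.
Proof.
  intros Hcp Ht0. induction n as [|n IH]; intros z z' Hz Hz' Hav Heq H0 t Ht.
  - apply Heq; assumption.
  - assert (Hf : forall t, a <= t <= b -> f (cp t) (z' t) = f (cp t) (z t)).
    { apply (IH (fun t => f (cp t) (z t)) (fun t => f (cp t) (z' t))).
      - intros s Hs. apply Ccont_fc; auto.
      - intros s Hs. apply Ccont_fc; auto.
      - intros s i Hs Hi. rewrite <- iter_shift. apply Hav; [assumption|lia].
      - intros s Hs. rewrite <- !iter_shift. apply Heq; assumption.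
      - rewrite H0. reflexivity. }
    assert (Hnz : forall s, a <= s <= b -> z s <> RtoC 0).
    { intros s Hs E. apply (Hav s n Hs); [lia|]. rewrite E. apply iter_0_P. }
    assert (Hpm : forall s, a <= s <= b -> z' s = z s \/ z' s = (- z s)%C).
    { intros s Hs. apply (fc_sq_eq K theta hK (cp s)). apply Hf; assumption. }
    set (g := fun s => Re (z' s / z s)%C).
    assert (Hg : forall s, a <= s <= b -> (z' s = z s -> g s = 1) /\ (z' s = (- z s)%C -> g s = -1)).
    { intros s Hs. unfold g. split; intros E; rewrite E.
      - apply Re_div_self, Hnz; assumption.
      - replace (- z s / z s)%C with (RtoC (-1)); [reflexivity|].
        replace (RtoC (-1)) with (- RtoC 1)%C by (apply C_ext; simpl; ring).
        field. apply Hnz; assumption. }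
    assert (Hg1 : g t = 1).
    { rewrite <- (proj1 (Hg t0 Ht0) H0). apply (sign_constant g a b); try assumption.
      - intros s Hs. apply Ccont_Re, Ccont_div; auto.
      - intros s Hs. destruct (Hpm s Hs); [left|right]; apply Hg; assumption. }
    destruct (Hpm t Ht) as [E|E]; [assumption|].
    pose proof (proj2 (Hg t Ht) E). lra.
Qed.

Lemma escapes_large (c : C) : ~ Mset K theta c ->
  forall M : R, exists N : nat, forall n, (N <= n)%nat -> M < Cmod (P n c).
Proof.
  intros Hc M. apply NNPP in Hc.
  destruct (proj1 (is_lim_seq_p_infty_Reals _) Hc M) as [N HN].
  exists N. intros n Hn. rewrite <- iter_0_P. apply HN. lia.
Qed.

(** A criterion that looks at one finite time, hence persists under small changes of the parameter,
    unlike the limit that defines [Mset]. *)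
Lemma notM_of_large (c : C) (N : nat) :
  4 <= Cmod (P N c) -> Cmod c <= Cmod (P N c) -> ~ Mset K theta c.
Proof.
  intros H4 Hc HM. apply HM. unfold escapes.
  assert (Hg : forall k, 4 + INR k <= Cmod (P (k + N) c) /\ Cmod c <= Cmod (P (k + N) c)).
  { induction k as [|k [IH1 IH2]]; [simpl; lra|].
    change (S k + N)%nat with (S (k + N)). rewrite P_S, S_INR. pose proof (Cmod_fc_ge K theta hK c (P (k + N) c)).
    pose proof (pos_INR k). split; nra. }
  apply is_lim_seq_incr_n with (N := S N).
  apply is_lim_seq_le_p_loc with (u := fun k => INR k).
  - exists O. intros k _. replace (k + S N)%nat with (S (k + N)) by lia. rewrite iter_0_P.
    destruct (Hg k). lra.
  - apply is_lim_seq_INR.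
Qed.

Lemma notM_neq_0 (c : C) : ~ Mset K theta c -> c <> RtoC 0.
Proof.
  intros Hc E. destruct (escapes_large c Hc 0) as [N HN].
  specialize (HN N (le_n N)). rewrite E, P_at_0, Cmod_0 in HN. lra.
Qed.

(** Used in the contrapositive, as properness: a far image under the n-th iterate has only far
    preimages, uniformly in bounded parameters. *)
Lemma iter_bounded (n : nat) (Rc Rz : R) :
  exists M, forall c z, Cmod c <= Rc -> Cmod z <= Rz -> Cmod (Nat.iter n (f c) z) <= M.
Proof.
  induction n as [|n [M HM]].
  - exists Rz. intros; assumption.
  - exists (K ^ 2 * M ^ 2 + Rc). intros c z Hc Hz. simpl.
    eapply Rle_trans; [apply (Cmod_fc_le K theta hK)|].
    specialize (HM c z Hc Hz). pose proof (Cmod_ge_0 (Nat.iter n (f c) z)).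
    assert (Cmod (Nat.iter n (f c) z) ^ 2 <= M ^ 2) by nra.
    assert (0 <= K ^ 2) by nra. nra.
Qed.

(** * Consequences of the conjugacy on a single exterior disc *)

Section Bottcher.
Context (c : C) (rho : R) (psi : C -> C).
Hypothesis hb : is_bottcher K theta c (exterior_disc rho) psi.
Hypothesis hc : ~ Mset K theta c.
Notation f0 := (f0 K theta).

Lemma bott_inv (z : C) : rho < Cmod z -> rho < Cmod (f c z).
Proof. apply (proj1 hb). Qed.

Lemma bott_eq (z : C) : rho < Cmod z -> psi (f c z) = f0 (psi z).
Proof. apply hb. Qed.

Lemma bott_inj (z w : C) : rho < Cmod z -> rho < Cmod w -> psi z = psi w -> z = w.
Proof. apply hb. Qed.

Lemma bott_cont (z : C) : rho < Cmod z -> @continuous C_UniformSpace C_UniformSpace psi z.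
Proof. apply hb. Qed.

(** z and -z have the same image under [f c], so psi(-z) is psi(z) or -psi(z); injectivity leaves
    only the latter. *)
Lemma bott_odd (z : C) : rho < Cmod z -> z <> RtoC 0 -> psi (- z)%C = (- psi z)%C.
Proof.
  intros Hz Hz0. assert (Hz' : rho < Cmod (- z)%C) by (rewrite Cmod_opp; assumption).
  assert (H : f0 (psi (- z)%C) = f0 (psi z)) by (rewrite <- !bott_eq, fc_opp by assumption; reflexivity).
  destruct (fc_sq_eq K theta hK _ _ _ H) as [E|E]; [|assumption].
  exfalso. apply Hz0. apply bott_inj in E; try assumption.
  assert (E2 : (RtoC 2 * z)%C = RtoC 0).
  { replace (RtoC 2 * z)%C with (z - - z)%C by (apply C_ext; simpl; ring).
    rewrite E. ring. }
  destruct (Ceq_dec z (RtoC 0)) as [|N]; [assumption|].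
  exfalso. refine (Cmult_neq_0 _ _ _ N E2). intros E3. apply RtoC_inj in E3. lra.
Qed.

Lemma f0_0 : f0 (RtoC 0) = RtoC 0.
Proof. apply fc_0. Qed.

(** [rho] is an arbitrary real, so the exterior disc could a priori be the whole plane or the
    punctured plane. Positivity is what [fc_expand] and the outward motion along rays require. *)
Lemma rho_pos : 0 < rho.
Proof.
  pose proof (notM_neq_0 c hc) as Hc0.
  destruct (Rtotal_order rho 0) as [H|[H|H]]; [exfalso|exfalso|assumption].
  - (* an odd continuous function vanishes at 0, and then so does [c] by injectivity *)
    assert (Hall : forall z, rho < Cmod z) by (intros z; pose proof (Cmod_ge_0 z); lra).
    assert (Hz : psi (RtoC 0) = RtoC 0).
    { apply NNPP. intros Hne.
      assert (Hp : 0 < Cmod (psi (RtoC 0))) by (apply Cmod_gt_0; assumption).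
      destruct (Ccont_eps psi (RtoC 0) _ (bott_cont _ (Hall _)) Hp) as [eps He].
      set (t := RtoC (eps / 2)).
      pose proof (cond_pos eps).
      assert (Ht : t <> RtoC 0) by (unfold t; intros E; apply RtoC_inj in E; lra).
      assert (B1 : Cmod (psi t - psi (RtoC 0))%C < Cmod (psi (RtoC 0))).
      { apply He. split; simpl.
        - change (Rabs (eps / 2 - 0) < eps). rewrite Rabs_pos_eq; lra.
        - change (Rabs (0 - 0) < eps). rewrite Rabs_pos_eq; lra. }
      assert (B2 : Cmod (psi (- t)%C - psi (RtoC 0))%C < Cmod (psi (RtoC 0))).
      { apply He. split; simpl.
        - change (Rabs (- (eps / 2) - 0) < eps). rewrite Rminus_0_r, Rabs_Ropp, Rabs_pos_eq; lra.
        - change (Rabs (- 0 - 0) < eps). rewrite Ropp_0, Rabs_pos_eq; lra. }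
      rewrite bott_odd in B2 by auto.
      assert (H2 : Cmod (RtoC 2 * psi (RtoC 0))%C
        <= Cmod (psi t - psi (RtoC 0))%C + Cmod (- psi t - psi (RtoC 0))%C).
      { replace (RtoC 2 * psi (RtoC 0))%C
          with (- ((psi t - psi (RtoC 0)) + (- psi t - psi (RtoC 0))))%C
          by (apply C_ext; simpl; ring).
        rewrite Cmod_opp. apply Cmod_triangle. }
      rewrite Cmod_RtoC_mult, Rabs_pos_eq in H2 by lra. lra. }
    apply Hc0. apply bott_inj; auto. rewrite Hz.
    rewrite <- (fc_0 K theta c), bott_eq, Hz by auto. apply f0_0.
  - (* [c <> 0] has a root, whose image leaves the punctured plane *)
    destruct (csqrt_ex (- c)%C) as [s Hs].
    assert (Hf : f c (hinv s) = RtoC 0) by (unfold fc; rewrite (h_hinv K theta hK), Hs; ring).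
    assert (Hz : hinv s <> RtoC 0).
    { intros E. rewrite E, fc_0 in Hf. contradiction. }
    assert (Hm : rho < Cmod (hinv s)) by (rewrite H; apply Cmod_gt_0; assumption).
    apply bott_inv in Hm. rewrite Hf, Cmod_0 in Hm. lra.
Qed.

Lemma bott_neq_0 (z : C) : rho < Cmod z -> psi z <> RtoC 0.
Proof.
  intros Hz E. pose proof rho_pos.
  assert (Hz0 : z <> RtoC 0) by (intros E'; rewrite E', Cmod_0 in Hz; lra).
  apply Hz0. pose proof (bott_odd z Hz Hz0) as Ho. rewrite E in Ho.
  assert (E1 : z = (- z)%C).
  { apply bott_inj; [assumption|rewrite Cmod_opp; assumption|]. rewrite Ho, E. ring. }
  apply Cmod_eq_0.
  assert (E2 : Cmod (RtoC 2 * z)%C = 0).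
  { replace (RtoC 2 * z)%C with (z - - z)%C by (apply C_ext; simpl; ring).
    rewrite <- E1. replace (z - z)%C with (RtoC 0) by ring. apply Cmod_0. }
  rewrite Cmod_RtoC_mult, Rabs_pos_eq in E2 by lra. lra.
Qed.

Lemma bott_expand (z : C) : rho < Cmod z -> Cmod z <= Cmod (f c z).
Proof. apply (fc_expand K theta hK c rho rho_pos bott_inv). Qed.

Lemma orbit_mono (i k : nat) : rho < Cmod (P i c) ->
  Cmod (P i c) <= Cmod (P (k + i) c).
Proof.
  intros Hi. induction k as [|k IH]; [simpl; lra|].
  eapply Rle_trans; [exact IH|]. change (S k + i)%nat with (S (k + i)). rewrite P_S. apply bott_expand. lra.
Qed.

(** Either |P_i| <= rho < |P_n|, or the orbit is already outside the disc at time i and its moduli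
    no longer decrease. *)
Lemma orbit_le (n i : nat) : rho < Cmod (P n c) -> (i <= n)%nat -> Cmod (P i c) <= Cmod (P n c).
Proof.
  intros Hn Hi. destruct (Rle_lt_dec (Cmod (P i c)) rho) as [|Hr]; [lra|].
  replace n with ((n - i) + i)%nat by lia. apply orbit_mono; assumption.
Qed.

(** A coincidence would make the orbit return to [P i c] along an arithmetic progression of times,
    contrary to escape. *)
Lemma orbit_neq (n i : nat) : (i < n)%nat -> P n c <> P i c.
Proof.
  intros Hi E.
  assert (Hper : forall q, P (q * (n - i) + i) c = P i c).
  { induction q as [|q IH]; [reflexivity|].
    replace (S q * (n - i) + i)%nat with ((n - i) + (q * (n - i) + i))%nat by lia.
    unfold Defs.P. rewrite iter_plus. change (Nat.iter (q * (n - i) + i) (f c) c) with (P (q * (n - i) + i) c).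
    rewrite IH. unfold Defs.P. rewrite <- iter_plus. replace (n - i + i)%nat with n by lia. exact E. }
  destruct (escapes_large c hc (Cmod (P i c))) as [N HN].
  specialize (HN (N * (n - i) + i)%nat). rewrite Hper in HN.
  assert (N <= N * (n - i) + i)%nat by nia. specialize (HN H). lra.
Qed.

(** At t = 1 this is the absence of periodicity; for t > 1 the point is strictly larger in modulus
    than every earlier orbit point. *)
Lemma ray_avoids (n i : nat) (t : R) : rho < Cmod (P n c) -> (i < n)%nat -> 1 <= t ->
  (RtoC t * P n c)%C <> P i c.
Proof.
  intros Hn Hi Ht E. pose proof rho_pos.
  destruct (Req_dec t 1) as [->|Hne].
  - apply (orbit_neq n i Hi). rewrite <- E. ring.
  - pose proof (orbit_le n i Hn (Nat.lt_le_incl _ _ Hi)) as Hle.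
    rewrite <- E, Cmod_RtoC_mult, Rabs_pos_eq in Hle by lra. nra.
Qed.

Lemma ray_exterior (n : nat) (t : R) : rho < Cmod (P n c) -> 1 <= t -> rho < Cmod (RtoC t * P n c)%C.
Proof.
  intros Hn Ht. rewrite Cmod_RtoC_mult, Rabs_pos_eq by lra. pose proof rho_pos. nra.
Qed.

Lemma iter_exterior (n : nat) (z : C) : rho < Cmod z -> rho < Cmod (Nat.iter n (f c) z).
Proof. intros Hz. induction n as [|n IH]; simpl; [assumption|]. apply bott_inv; assumption. Qed.

Lemma bott_iter (n : nat) (z : C) : rho < Cmod z ->
  Nat.iter n f0 (psi z) = psi (Nat.iter n (f c) z).
Proof.
  intros Hz. induction n as [|n IH]; simpl; [reflexivity|].
  rewrite IH, bott_eq; [reflexivity|]. apply iter_exterior; assumption.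
Qed.
End Bottcher.
End Dynamics.

(** * Continuation along rays *)

Section Ray.
Context (K theta : R) (hK : 1 < K).
Notation f := (fc K theta).
Notation h := (h K theta).
Notation hinv := (hinv K theta).
Notation P := (P K theta).
Notation f0 := (f0 K theta).

(* [w] is the value at [c] of the continuation of [psi] along the lift by [f_c^n], starting at
   [c], of the ray [t * P_n c]. *)
Definition ray_cont (c : C) (psi : C -> C) (n : nat) (w : C) (T : R) : Prop :=
  exists z e : R -> C,
    (forall t, 1 <= t <= T -> Ccont z t) /\ (forall t, 1 <= t <= T -> Ccont e t) /\
    z 1 = c /\ e 1 = w /\
    (forall t, 1 <= t <= T -> Nat.iter n (f c) (z t) = (RtoC t * P n c)%C) /\
    (forall t, 1 <= t <= T -> Nat.iter n f0 (e t) = psi (RtoC t * P n c)%C) /\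
    e T = psi (z T).

(** The ray is followed to every sufficiently large finite [T]: far out the lift lies where [psi]
    itself is defined and can anchor the path [e]. *)
Definition ray_value (c : C) (psi : C -> C) (n : nat) (w : C) : Prop :=
  exists T0, 1 <= T0 /\ forall T, T0 <= T -> ray_cont c psi n w T.

Lemma Rcont_id (t : R) : Rcont (fun s : R => s) t.
Proof. apply continuous_id. Qed.

Section Fixed.
Context (c : C) (rho : R) (psi : C -> C).
Hypothesis hb : is_bottcher K theta c (exterior_disc rho) psi.
Hypothesis hc : ~ Mset K theta c.

Lemma far_preimage (n : nat) (r : R) :
  exists M, 0 <= M /\ forall z, M < Cmod (Nat.iter n (f c) z) -> r < Cmod z.
Proof.
  destruct (iter_bounded K theta hK n (Cmod c) r) as [M HM].
  exists (Rmax 0 M). split; [apply Rmax_l|]. intros z Hz.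
  apply Rnot_le_lt. intros Hle. specialize (HM c z (Rle_refl _) Hle).
  pose proof (Rmax_r 0 M). lra.
Qed.

(** The path [e] is [E] composed with the lift of the ray. The lift stays in the domain of [E]
    because its n-th image lies on the ray, outside the disc. *)
Lemma ray_value_ext (E : C -> C) (hE : is_bottcher_extension K theta c (exterior_disc rho) psi E) :
  exists n, rho < Cmod (P n c) /\ (forall i, rho < Cmod (P i c) -> (n <= i)%nat) /\
    ray_value c psi n (E c).
Proof.
  destruct hE as [n [HA [Hmin [HEU [HEc [_ HEf]]]]]].
  exists n. split; [exact HA|]. split.
  { intros i Hi. apply Nat.nlt_ge. intros Hlt. exact (Hmin i Hlt Hi). }
  assert (HP : rho < Cmod (P n c)) by exact HA.
  destruct (far_preimage n rho) as [M [HM0 HM]].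
  pose proof (rho_pos K theta hK c rho psi hb hc) as Hrho.
  (* Chosen so that T0 |P_n| = |P_n| + M exceeds [M]; the lift is then exterior at its end. *)
  set (T0 := 1 + M / Cmod (P n c)).
  assert (HT0 : 1 <= T0).
  { unfold T0. assert (0 <= M / Cmod (P n c)) by (apply Rdiv_le_0_compat; lra). lra. }
  exists T0. split; [exact HT0|]. intros T HT.
  (* A path is lifted over a box that is degenerate in the complex coordinate. *)
  set (a := ((RtoC 0, 1) : X)). set (b := ((RtoC 0, T) : X)).
  destruct (lift_iter K theta hK n (fun _ => c) a b a) with (top := fun x : X => (RtoC (snd x) * P n c)%C)
    (zb := c) as [Z [HZ1 [HZ2 HZ3]]].
  - intros; apply Ccont_const.
  - unfold inbox, a, b; simpl. repeat split; lra.
  - intros x Hx. apply Ccont_mult; [|apply Ccont_const]. apply Ccont_RtoC, Rcont_sndX.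
  - intros x i [_ [_ Hx]] Hi. simpl in Hx. apply (ray_avoids K theta hK c rho psi hb hc); tauto.
  - simpl. fold (P n c). rewrite Cmult_1_l. reflexivity.
  - set (z := fun t : R => Z (RtoC 0, t)).
    assert (Hin : forall t, 1 <= t <= T -> inbox a b (RtoC 0, t)).
    { intros t Ht. unfold inbox, a, b; simpl. repeat split; lra. }
    assert (Hz : forall t, 1 <= t <= T -> Ccont z t).
    { intros t Ht. apply (continuous_comp (fun s : R => (RtoC 0, s) : X) Z).
      - apply Xcont_pair; [apply Ccont_const|apply Rcont_id].
      - apply HZ1, Hin, Ht. }
    assert (Hzn : forall t, 1 <= t <= T -> Nat.iter n (f c) (z t) = (RtoC t * P n c)%C).
    { intros t Ht. apply (HZ3 (RtoC 0, t)), Hin, Ht. }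
    assert (HzA : forall t, 1 <= t <= T -> rho < Cmod (Nat.iter n (f c) (z t))).
    { intros t Ht. rewrite Hzn by assumption.
      apply (ray_exterior K theta hK c rho psi hb hc); tauto. }
    assert (HEn : forall k y, exterior_disc rho (Nat.iter n (f c) y) ->
      exterior_disc rho (Nat.iter n (f c) (Nat.iter k (f c) y)) /\
      Nat.iter k f0 (E y) = E (Nat.iter k (f c) y)).
    { induction k as [|k IH]; intros y Hy; [split; [exact Hy|reflexivity]|].
      destruct (IH y Hy) as [I1 I2]. simpl. split.
      - rewrite <- iter_shift. simpl. apply (bott_inv K theta c rho psi hb). exact I1.
      - rewrite I2, HEf by exact I1. reflexivity. }
    exists z, (fun t => E (z t)).
    split; [exact Hz|]. split; [|split; [exact HZ2|split; [|split; [exact Hzn|split]]]].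
    + intros t Ht. apply Ccont_comp; [apply Hz, Ht|]. apply HEc. apply HzA, Ht.
    + unfold z. change (E (Z a) = E c). rewrite HZ2. reflexivity.
    + intros t Ht. rewrite (proj2 (HEn n (z t) (HzA t Ht))), Hzn by assumption.
      apply HEU. apply (ray_exterior K theta hK c rho psi hb hc); tauto.
    + apply HEU. apply HM. rewrite Hzn by lra. rewrite Cmod_RtoC_mult, Rabs_pos_eq by lra.
      apply Rlt_le_trans with (T0 * Cmod (P n c)); [|apply Rmult_le_compat_r; lra].
      unfold T0. replace ((1 + M / Cmod (P n c)) * Cmod (P n c)) with (Cmod (P n c) + M) by (field; lra).
      lra.
Qed.

(* The lifts of [s |-> homot n s t] by [f_c^(n+1)] deform the path of [ray_value c psi n] into
   that of [ray_value c psi (S n)]. *)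
Definition homot (n : nat) (s t : R) : C :=
  (RtoC (t ^ 2 * (1 - s) + s * t) * (h (P n c) * h (P n c)) + RtoC (1 - s + s * t) * c)%C.

Lemma homot_0 (n : nat) (t : R) : homot n 0 t = f c (RtoC t * P n c)%C.
Proof.
  unfold homot, fc. rewrite h_scal.
  replace (t ^ 2 * (1 - 0) + 0 * t) with (t * t) by ring.
  replace (1 - 0 + 0 * t) with 1 by ring. rewrite RtoC_mult. ring.
Qed.

Lemma homot_1 (n : nat) (t : R) : homot n 1 t = (RtoC t * P (S n) c)%C.
Proof.
  unfold homot. rewrite P_S. unfold fc.
  replace (t ^ 2 * (1 - 1) + 1 * t) with t by ring.
  replace (1 - 1 + 1 * t) with t by ring. ring.
Qed.

Lemma homot_base (n : nat) (s : R) : homot n s 1 = P (S n) c.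
Proof.
  unfold homot. rewrite P_S. unfold fc.
  replace (1 ^ 2 * (1 - s) + s * 1) with 1 by ring.
  replace (1 - s + s * 1) with 1 by ring. ring.
Qed.

(** With coefficients a and b, the point is b f_c(x P_n) for x = sqrt(a / b) >= 1, so [bott_expand]
    applies at x P_n; and b x = sqrt(a b) >= sqrt t because a >= t and b >= 1. The deformation thus
    stays exterior and, for t > 1, avoids the critical orbit by modulus. *)
Lemma homot_ge (n : nat) (s t : R) : rho < Cmod (P n c) -> 0 <= s <= 1 -> 1 <= t ->
  sqrt t * Cmod (P n c) <= Cmod (homot n s t).
Proof.
  intros Hn Hs Ht. pose proof (rho_pos K theta hK c rho psi hb hc) as Hrho.
  set (a := t ^ 2 * (1 - s) + s * t). set (b := 1 - s + s * t).
  assert (Hb : 1 <= b) by (unfold b; nra).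
  assert (Hba : b <= a).
  { assert (0 <= (1 - s) * (t ^ 2 - 1)) by (apply Rmult_le_pos; nra). unfold a, b; nra. }
  assert (Hta : t <= a).
  { assert (0 <= (1 - s) * (t ^ 2 - t)) by (apply Rmult_le_pos; nra). unfold a; nra. }
  set (x := sqrt (a / b)).
  assert (Hab : 1 <= a / b).
  { apply Rmult_le_reg_r with b; [lra|]. unfold Rdiv. rewrite Rmult_assoc, Rinv_l; lra. }
  assert (Hx2 : x * x = a / b) by (apply sqrt_sqrt; lra).
  assert (Hx : 1 <= x) by (unfold x; rewrite <- sqrt_1; apply sqrt_le_1; lra).
  assert (Hh : homot n s t = (RtoC b * f c (RtoC x * P n c))%C).
  { unfold homot, fc. fold a b. rewrite h_scal.
    replace a with (b * (x * x)) by (rewrite Hx2; field; lra).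
    rewrite !RtoC_mult. ring. }
  rewrite Hh, Cmod_RtoC_mult, Rabs_pos_eq by lra.
  assert (H1 : x * Cmod (P n c) <= Cmod (f c (RtoC x * P n c)%C)).
  { replace (x * Cmod (P n c)) with (Cmod (RtoC x * P n c)%C)
      by (rewrite Cmod_RtoC_mult, Rabs_pos_eq; lra).
    apply (bott_expand K theta hK c rho psi hb hc).
    apply (ray_exterior K theta hK c rho psi hb hc); assumption. }
  assert (H2 : sqrt t <= b * x).
  { apply Rsqr_incr_0_var; [|nra]. rewrite Rsqr_sqrt by lra. unfold Rsqr.
    replace (b * x * (b * x)) with (b * b * (x * x)) by ring. rewrite Hx2.
    replace (b * b * (a / b)) with (b * a) by (field; lra). nra. }
  apply Rle_trans with (b * x * Cmod (P n c)); [apply Rmult_le_compat_r; lra|].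
  rewrite Rmult_assoc. apply Rmult_le_compat_l; lra.
Qed.

Lemma ray_value_S (n : nat) (w : C) :
  rho < Cmod (P n c) -> ray_value c psi n w -> ray_value c psi (S n) w.
Proof.
  intros Hn [T0 [HT0 Hray]]. pose proof (rho_pos K theta hK c rho psi hb hc) as Hrho.
  assert (HSn : rho < Cmod (P (S n) c)).
  { rewrite P_S. apply (bott_inv K theta c rho psi hb). assumption. }
  destruct (far_preimage (S n) rho) as [M [HM0 HM]].
  (* [homot_ge] only grows like sqrt t, so T >= q^2 is required to get sqrt T |P_n| >= |P_n| + M on
     the whole far edge. *)
  set (q := 1 + M / Cmod (P n c)).
  assert (Hq : 1 <= q).
  { unfold q. assert (0 <= M / Cmod (P n c)) by (apply Rdiv_le_0_compat; lra). lra. }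
  exists (T0 + q ^ 2). split; [nra|]. intros T HT.
  assert (HT1 : 1 <= T) by nra.
  assert (HTq : q <= sqrt T).
  { rewrite <- (sqrt_pow2 q) by lra. apply sqrt_le_1; nra. }
  destruct (Hray T ltac:(nra)) as [z [e [Hz [He [Hz1 [He1 [Hzn [Hen HeT]]]]]]]].
  set (a := ((RtoC 0, 1) : X)). set (b := ((RtoC 1, T) : X)).
  assert (Hin : forall s t, 0 <= s <= 1 -> 1 <= t <= T -> inbox a b (RtoC s, t)).
  { intros s t Hs Ht. unfold inbox, a, b; simpl. repeat split; lra. }
  assert (Hout : forall x : X, inbox a b x -> 0 <= Re (fst x) <= 1 /\ 1 <= snd x <= T).
  { intros x [H1 [_ H3]]. split; [exact H1|exact H3]. }
  set (top := fun x : X => homot n (Re (fst x)) (snd x)).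
  assert (Htopc : forall x : X, Ccont top x).
  { intros x. pose proof (Ccont_Re _ _ (Ccont_fstX x)) as H1. pose proof (Rcont_sndX x) as H2.
    unfold top, homot.
    assert (Rcont (fun y : X => 1 - Re (fst y)) x) by (apply Rcont_minus; [apply Rcont_const|assumption]).
    apply Ccont_plus; (apply Ccont_mult; [apply Ccont_RtoC|apply Ccont_const]).
    - apply Rcont_plus; apply Rcont_mult; try assumption.
      simpl. apply Rcont_mult; [assumption|]. apply Rcont_mult; [assumption|apply Rcont_const].
    - apply Rcont_plus; [assumption|]. apply Rcont_mult; assumption. }
  assert (Htopext : forall x, inbox a b x -> rho < Cmod (top x)).
  { intros x Hx. destruct (Hout x Hx) as [H1 H2].
    eapply Rlt_le_trans; [|apply homot_ge; [assumption|assumption|tauto]].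
    assert (1 <= sqrt (snd x)) by (rewrite <- sqrt_1; apply sqrt_le_1; lra). nra. }
  assert (Htopav : forall x i, inbox a b x -> (i < S n)%nat -> top x <> P i c).
  { intros x i Hx Hi E. destruct (Hout x Hx) as [H1 [H2 H3]].
    destruct (Req_dec (snd x) 1) as [E1|E1].
    - unfold top in E. rewrite E1, homot_base in E.
      exact (orbit_neq K theta c hc (S n) i Hi E).
    - pose proof (homot_ge n _ _ Hn H1 H2) as Hge.
      change (homot n (Re (fst x)) (snd x)) with (top x) in Hge. rewrite E in Hge.
      pose proof (orbit_le K theta hK c rho psi hb hc n i Hn ltac:(lia)).
      assert (1 < sqrt (snd x)) by (rewrite <- sqrt_1; apply sqrt_lt_1; lra). nra. }
  assert (Hbase : inbox a b a) by (apply Hin; lra).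
  destruct (lift_iter K theta hK (S n) (fun _ => c) a b a (fun x _ => Ccont_const c x) Hbase top c)
    as [Z [HZc [HZ1 HZn]]].
  { intros x _. apply Htopc. }
  { exact Htopav. }
  { unfold top, a. simpl snd; simpl fst. rewrite homot_base. reflexivity. }
  assert (Hf0n : Nat.iter n f0 w = psi (P n c)).
  { rewrite <- He1, Hen by lra. rewrite Cmult_1_l. reflexivity. }
  (* The same deformation seen through [psi], lifted by [f0]. The critical orbit of [f0] is the
     single point 0, which [psi] omits. *)
  destruct (lift_iter K theta hK (S n) (fun _ => RtoC 0) a b a (fun x _ => Ccont_const _ x) Hbase
    (fun x => psi (top x)) w) as [W [HWc [HW1 HWn]]].
  { intros x Hx. apply Ccont_comp; [apply Htopc|].
    apply (bott_cont K theta c rho psi hb). apply Htopext, Hx. }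
  { intros x i Hx _. rewrite P_at_0. apply (bott_neq_0 K theta hK c rho psi hb hc), Htopext, Hx. }
  { unfold top, a. simpl snd; simpl fst. rewrite homot_base, P_S.
    rewrite (bott_eq K theta c rho psi hb) by assumption. rewrite <- Hf0n. reflexivity. }
  assert (Hpath : forall (V : X -> C) (s0 : R), (forall x, inbox a b x -> Ccont V x) -> 0 <= s0 <= 1 ->
    forall t, 1 <= t <= T -> Ccont (fun t => V (RtoC s0, t)) t).
  { intros V s0 HV Hs0 t Ht. apply (continuous_comp (fun t : R => (RtoC s0, t) : X) V).
    - apply Xcont_pair; [apply Ccont_const|apply Rcont_id].
    - apply HV, Hin; assumption. }
  assert (Hpath' : forall (V : X -> C) (t0 : R), (forall x, inbox a b x -> Ccont V x) -> 1 <= t0 <= T ->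
    forall s, 0 <= s <= 1 -> Ccont (fun s => V (RtoC s, t0)) s).
  { intros V t0 HV Ht0 s Hs. apply (continuous_comp (fun s : R => (RtoC s, t0) : X) V).
    - apply Xcont_pair; [apply Ccont_RtoC, Rcont_id|apply Rcont_const].
    - apply HV, Hin; assumption. }
  assert (HZ0 : forall t, 1 <= t <= T -> Z (RtoC 0, t) = z t).
  { intros t Ht. symmetry.
    apply (lift_unique K theta hK (S n) (fun _ => c) 1 T 1) with (z := fun t => Z (RtoC 0, t));
      try assumption; try lra.
    - intros; apply Ccont_const.
    - apply (Hpath Z 0 HZc). lra.
    - intros s i Hs Hi. rewrite HZn by (apply Hin; lra). apply Htopav; [apply Hin; lra|assumption].
    - intros s Hs. rewrite HZn by (apply Hin; lra). unfold top. simpl fst; simpl snd.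
      change (Re (RtoC 0)) with 0. rewrite homot_0. simpl. rewrite Hzn by assumption. reflexivity.
    - rewrite Hz1. symmetry. exact HZ1. }
  assert (HW0 : forall t, 1 <= t <= T -> W (RtoC 0, t) = e t).
  { intros t Ht. symmetry.
    apply (lift_unique K theta hK (S n) (fun _ => RtoC 0) 1 T 1) with (z := fun t => W (RtoC 0, t));
      try assumption; try lra.
    - intros; apply Ccont_const.
    - apply (Hpath W 0 HWc). lra.
    - intros s i Hs Hi. rewrite HWn by (apply Hin; lra). rewrite P_at_0.
      apply (bott_neq_0 K theta hK c rho psi hb hc), Htopext, Hin; lra.
    - intros s Hs. rewrite HWn by (apply Hin; lra). unfold top. simpl fst; simpl snd.
      change (Re (RtoC 0)) with 0. rewrite homot_0, (bott_eq K theta c rho psi hb).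
      + change (f0 (Nat.iter n f0 (e s)) = f0 (psi (RtoC s * P n c)%C)). rewrite Hen by assumption. reflexivity.
      + apply (ray_exterior K theta hK c rho psi hb hc); tauto.
    - rewrite He1. symmetry. exact HW1. }
  assert (HTT : 1 <= T <= T) by lra.
  assert (HZT : forall s, 0 <= s <= 1 -> rho < Cmod (Z (RtoC s, T))).
  { intros s Hs. apply HM. rewrite HZn by (apply Hin; lra). unfold top; simpl fst; simpl snd.
    eapply Rlt_le_trans; [|apply homot_ge; [assumption|assumption|lra]].
    apply Rlt_le_trans with (q * Cmod (P n c)); [|apply Rmult_le_compat_r; lra].
    unfold q. replace ((1 + M / Cmod (P n c)) * Cmod (P n c)) with (Cmod (P n c) + M) by (field; lra).
    lra. }
  (* On the far edge psi(Z) and W are both lifts of the same path by iterates of [f0]. They agree at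
     s = 0, by the path already given, hence also at s = 1. *)
  assert (HTop : forall s, 0 <= s <= 1 -> psi (Z (RtoC s, T)) = W (RtoC s, T)).
  { intros s Hs.
    apply (lift_unique K theta hK (S n) (fun _ => RtoC 0) 0 1 0) with (z := fun s => W (RtoC s, T))
      (z' := fun s => psi (Z (RtoC s, T))); try assumption; try lra.
    - intros; apply Ccont_const.
    - apply (Hpath' W T HWc HTT).
    - intros t Ht. apply Ccont_comp; [apply (Hpath' Z T HZc HTT); assumption|].
      apply (bott_cont K theta c rho psi hb), HZT, Ht.
    - intros t i Ht Hi. rewrite HWn by (apply Hin; lra). rewrite P_at_0.
      apply (bott_neq_0 K theta hK c rho psi hb hc), Htopext, Hin; lra.
    - intros t Ht. rewrite HWn by (apply Hin; lra).
      rewrite <- (HZn (RtoC t, T)) by (apply Hin; lra).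
      apply (bott_iter K theta c rho psi hb (S n)). apply HZT, Ht.
    - rewrite HZ0, HW0 by lra. symmetry. exact HeT. }
  (* The deformation fixes the end t = 1, so the lifts are constant along that edge: the point [c]
     and the value [w] survive from s = 0 to s = 1. *)
  assert (HZB : forall s, 0 <= s <= 1 -> Z (RtoC s, 1) = c).
  { intros s Hs. symmetry.
    apply (lift_unique K theta hK (S n) (fun _ => c) 0 1 0) with (z := fun s => Z (RtoC s, 1))
      (z' := fun _ => c); try assumption; try lra.
    - intros; apply Ccont_const.
    - apply (Hpath' Z 1 HZc). lra.
    - intros; apply Ccont_const.
    - intros t i Ht Hi. rewrite HZn by (apply Hin; lra). apply Htopav; [apply Hin; lra|assumption].
    - intros t Ht. rewrite HZn by (apply Hin; lra). unfold top; simpl fst; simpl snd.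
      rewrite homot_base. reflexivity.
    - symmetry. exact HZ1. }
  assert (HWB : forall s, 0 <= s <= 1 -> W (RtoC s, 1) = w).
  { intros s Hs. symmetry.
    apply (lift_unique K theta hK (S n) (fun _ => RtoC 0) 0 1 0) with (z := fun s => W (RtoC s, 1))
      (z' := fun _ => w); try assumption; try lra.
    - intros; apply Ccont_const.
    - apply (Hpath' W 1 HWc). lra.
    - intros; apply Ccont_const.
    - intros t i Ht Hi. rewrite HWn by (apply Hin; lra). rewrite P_at_0.
      apply (bott_neq_0 K theta hK c rho psi hb hc), Htopext, Hin; lra.
    - intros t Ht. rewrite HWn by (apply Hin; lra). unfold top; simpl fst; simpl snd.
      rewrite homot_base, P_S, (bott_eq K theta c rho psi hb) by assumption.
      rewrite <- Hf0n. reflexivity.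
    - symmetry. exact HW1. }
  exists (fun t => Z (RtoC 1, t)), (fun t => W (RtoC 1, t)).
  split; [apply (Hpath Z 1 HZc); lra|]. split; [apply (Hpath W 1 HWc); lra|].
  split; [apply HZB; lra|]. split; [apply HWB; lra|].
  split; [|split].
  - intros t Ht. rewrite HZn by (apply Hin; lra). unfold top; simpl fst; simpl snd.
    apply homot_1.
  - intros t Ht. transitivity (psi (top (RtoC 1, t))); [apply HWn, Hin; lra|].
    unfold top; simpl fst; simpl snd. change (Re (RtoC 1)) with 1. rewrite homot_1. reflexivity.
  - symmetry. apply HTop. lra.
Qed.

Lemma ray_value_le (n k : nat) (w : C) :
  rho < Cmod (P n c) -> ray_value c psi n w -> ray_value c psi (k + n) w.
Proof.
  intros Hn Hw. induction k as [|k IH]; [exact Hw|].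
  apply ray_value_S; [|exact IH].
  eapply Rlt_le_trans; [exact Hn|]. apply (orbit_mono K theta hK c rho psi hb hc). assumption.
Qed.
End Fixed.
End Ray.

(** * Continuity of Psi *)

Section Plane.
Context (K theta : R) (hK : 1 < K).
Context (rho : C -> R) (psi psi_ext : C -> C -> C).
Hypothesis hpsi : forall c, is_bottcher K theta c (exterior_disc (rho c)) (psi c).
Hypothesis hext : forall c, ~ Mset K theta c ->
  is_bottcher_extension K theta c (exterior_disc (rho c)) (psi c) (psi_ext c).
Context (a C' : R) (ha : 1 <= a).
Hypothesis hest : bottcher_estimates rho psi a C'.
Notation f := (fc K theta).
Notation h := (h K theta).
Notation P := (P K theta).
Notation f0 := (f0 K theta).

(** The strict inequality makes the point interior to [Dset], where the differentiability of [psi]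
    is assumed. *)
Definition Dstrict (c z : C) : Prop := a * sqrt (1 + Cmod c) < Cmod z.

Lemma locally_pos {T : UniformSpace} (g : T -> R) (x : T) :
  Rcont g x -> 0 < g x -> locally x (fun y => 0 < g y).
Proof.
  intros Hg H0. apply (Hg (fun v => 0 < v)).
  exists (mkposreal _ H0). intros v Hv. apply Rabs_lt_between in Hv.
  unfold minus, plus, opp in Hv; simpl in Hv. lra.
Qed.

Lemma locally_lt {T : UniformSpace} (g1 g2 : T -> R) (x : T) :
  Rcont g1 x -> Rcont g2 x -> g1 x < g2 x -> locally x (fun y => g1 y < g2 y).
Proof.
  intros H1 H2 Hlt.
  assert (H : locally x (fun y => 0 < g2 y - g1 y)).
  { apply locally_pos; [apply Rcont_minus; assumption|lra]. }
  revert H. apply filter_imp. intros y Hy. lra.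
Qed.

Lemma Rcont_Dbound {T : UniformSpace} (g : T -> C) (x : T) :
  Ccont g x -> Rcont (fun y => a * sqrt (1 + Cmod (g y))) x.
Proof.
  intros Hg. apply Rcont_mult; [apply Rcont_const|]. apply Rcont_sqrt, Rcont_plus; [apply Rcont_const|].
  apply Rcont_Cmod, Hg.
Qed.

Lemma Dstrict_Dint (c z : C) : Dstrict c z -> Dint a (c, z).
Proof.
  intros H. unfold Dint.
  assert (L : @locally CC (c, z) (fun q => a * sqrt (1 + Cmod (fst q)) < Cmod (snd q))).
  { apply (@locally_lt CC (fun q => a * sqrt (1 + Cmod (fst q))) (fun q => Cmod (snd q))).
    - apply (@Rcont_Dbound CC). apply continuous_fst.
    - apply (@Rcont_Cmod CC). apply continuous_snd.
    - exact H. }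
  revert L. apply filter_imp. intros q Hq. left. exact Hq.
Qed.

Lemma Dstrict_ext (c z : C) : Dstrict c z -> rho c < Cmod z.
Proof. intros H. apply (proj1 hest). left. exact H. Qed.

Lemma psi_joint_cont {T : UniformSpace} (g1 g2 : T -> C) (x : T) :
  Dstrict (g1 x) (g2 x) -> Ccont g1 x -> Ccont g2 x -> Ccont (fun y => psi (g1 y) (g2 y)) x.
Proof.
  intros HD H1 H2.
  assert (Hp : @continuous CC C_UniformSpace (fun q : CC => psi (fst q) (snd q)) (g1 x, g2 x)).
  { destruct (proj1 (proj2 hest) (g1 x, g2 x) (Dstrict_Dint _ _ HD)) as [Hd _].
    apply (@filterdiff_continuous R_AbsRing
      (prod_NormedModule R_AbsRing C_R_NormedModule C_R_NormedModule) C_R_NormedModule).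
    exact (ex_intro _ _ Hd). }
  apply (continuous_comp (fun y => (g1 y, g2 y) : CC) (fun q : CC => psi (fst q) (snd q))); [|exact Hp].
  intros Q [eps HQ].
  assert (L1 := H1 _ (locally_ball (g1 x) eps)). assert (L2 := H2 _ (locally_ball (g2 x) eps)).
  unfold filtermap in *. generalize (filter_and _ _ L1 L2). apply filter_imp.
  intros y [U V]. apply HQ. split; assumption.
Qed.

Lemma Ccont_P {T : UniformSpace} (n : nat) (g : T -> C) (x : T) : Ccont g x -> Ccont (fun y => P n (g y)) x.
Proof. intros Hg. apply (Ccont_iter K theta n g g); assumption. Qed.

(* On a box of parameters [c'] and times [1 <= t <= T1] the lifts of the rays [t * P N c'] are
   jointly continuous.  At the far end [t = T1] their images are values of [psi], and at [t = 1]
   they are [Psi c'] by [ray_value_le]; this transfers the joint continuity of [psi] to [Psi],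
   although [rho c'] need not depend continuously on [c']. *)
Lemma Psi_cont (c : C) : ~ Mset K theta c -> @continuous C_UniformSpace C_UniformSpace (Psi psi_ext) c.
Proof.
  intros hc.
  destruct (escapes_large K theta c hc (Rmax 4 (Rmax (Cmod c) (a * sqrt (1 + Cmod c))))) as [N HN].
  specialize (HN N (le_n N)).
  assert (H1 : 4 < Cmod (P N c)) by (eapply Rle_lt_trans; [|exact HN]; apply Rmax_l).
  assert (H2 : Cmod c < Cmod (P N c)).
  { eapply Rle_lt_trans; [|exact HN]. eapply Rle_trans; [apply Rmax_l|apply Rmax_r]. }
  assert (H3 : a * sqrt (1 + Cmod c) < Cmod (P N c)).
  { eapply Rle_lt_trans; [|exact HN]. eapply Rle_trans; [apply Rmax_r|apply Rmax_r]. }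
  assert (Hid : @continuous C_UniformSpace C_UniformSpace (fun y => y) c) by apply continuous_id.
  assert (HPc : @continuous C_UniformSpace R_UniformSpace (fun y => Cmod (P N y)) c).
  { apply (@Rcont_Cmod C_UniformSpace), (@Ccont_P C_UniformSpace). exact Hid. }
  assert (L : @locally C_UniformSpace c (fun c' => 4 < Cmod (P N c') /\ Cmod c' < Cmod (P N c') /\
    a * sqrt (1 + Cmod c') < Cmod (P N c'))).
  { apply filter_and; [|apply filter_and]; apply (@locally_lt C_UniformSpace); try assumption.
    - apply (@Rcont_const C_UniformSpace).
    - apply (@Rcont_Cmod C_UniformSpace); exact Hid.
    - apply (@Rcont_Dbound C_UniformSpace); exact Hid. }
  destruct L as [eps Heps].
  (* The lifting lemma takes place on a closed box, hence a half-side strictly below [eps]. *)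
  set (r := eps / 2). assert (Hr : 0 < r < eps) by (unfold r; pose proof (cond_pos eps); lra).
  set (lo := (Re c - r, Im c - r) : C). set (hi := (Re c + r, Im c + r) : C).
  set (Qs := fun c' : C => Rabs (Re c' - Re c) <= r /\ Rabs (Im c' - Im c) <= r).
  assert (HQ : forall c', Qs c' -> 4 < Cmod (P N c') /\ Cmod c' < Cmod (P N c') /\
    a * sqrt (1 + Cmod c') < Cmod (P N c')).
  { intros c' [Q1 Q2]. apply Heps. split.
    - change (Rabs (Re c' - Re c) < eps). lra.
    - change (Rabs (Im c' - Im c) < eps). lra. }
  assert (HQc : Qs c) by (unfold Qs; rewrite !Rminus_diag, Rabs_R0; lra).
  assert (Hseg : forall c' s, Qs c' -> 0 <= s <= 1 -> Qs (c + RtoC s * (c' - c))%C).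
  { intros c' s [Q1 Q2] Hs. unfold Qs. simpl.
    apply Rabs_le_between in Q1. apply Rabs_le_between in Q2. unfold Re, Im in *.
    split; apply Rabs_le; nra. }
  assert (HQM : forall c', Qs c' -> ~ Mset K theta c').
  { intros c' Hc'. destruct (HQ c' Hc') as [A1 [A2 _]]. apply (notM_of_large K theta hK c' N); lra. }
  assert (HQD : forall c' t, Qs c' -> 1 <= t -> Dstrict c' (RtoC t * P N c')%C).
  { intros c' t Hc' Ht. destruct (HQ c' Hc') as [A1 [_ A3]]. unfold Dstrict.
    rewrite Cmod_RtoC_mult, Rabs_pos_eq by lra. nra. }
  assert (HQr : forall c', Qs c' -> rho c' < Cmod (P N c')).
  { intros c' Hc'. apply Dstrict_ext. rewrite <- (Cmult_1_l (P N c')). apply HQD; [assumption|lra]. }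
  set (Rc := Cmod c + 2 * r).
  assert (HQR : forall c', Qs c' -> Cmod c' <= Rc).
  { intros c' [Q1 Q2]. unfold Rc.
    replace c' with (c + (c' - c))%C by ring. eapply Rle_trans; [apply Cmod_triangle|].
    apply Rplus_le_compat_l. eapply Rle_trans; [apply Cmod_2Rmax|].
    assert (Hm : Rmax (Rabs (fst (c' - c)%C)) (Rabs (snd (c' - c)%C)) <= r) by (apply Rmax_lub; assumption).
    assert (Hs2 : sqrt 2 * sqrt 2 = 2) by (apply sqrt_sqrt; lra).
    pose proof (sqrt_pos 2). assert (sqrt 2 <= 2) by nra.
    assert (0 <= Rmax (Rabs (fst (c' - c)%C)) (Rabs (snd (c' - c)%C))).
    { eapply Rle_trans; [apply Rabs_pos|apply Rmax_l]. }
    nra. }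
  destruct (iter_bounded K theta hK N Rc (a * sqrt (1 + Rc))) as [M HM].
  (* As |P_N| > 4, every lift of t P_N with t >= T1 lies in the domain where [psi] is jointly
     continuous, for all parameters of the box at once. *)
  set (T1 := 1 + Rmax 0 M).
  assert (HT1 : 1 <= T1) by (unfold T1; pose proof (Rmax_l 0 M); lra).
  assert (Hfar : forall c' z t, Qs c' -> T1 <= t -> Nat.iter N (f c') z = (RtoC t * P N c')%C -> Dstrict c' z).
  { intros c' z t Hc' Ht Hz. unfold Dstrict. pose proof (HQR c' Hc') as Hle.
    apply Rle_lt_trans with (a * sqrt (1 + Rc)).
    { apply Rmult_le_compat_l; [lra|]. apply sqrt_le_1; pose proof (Cmod_ge_0 c'); lra. }
    apply Rnot_le_lt. intros Hn. specialize (HM c' z Hle Hn). rewrite Hz in HM.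
    rewrite Cmod_RtoC_mult, Rabs_pos_eq in HM by lra.
    destruct (HQ c' Hc') as [A1 _]. pose proof (Rmax_r 0 M). unfold T1 in *. nra. }
  set (bl := ((lo, 1) : X)). set (bh := ((hi, T1) : X)).
  assert (Hin : forall c' t, Qs c' -> 1 <= t <= T1 -> inbox bl bh (c', t)).
  { intros c' t [Q1 Q2] Ht. apply Rabs_le_between in Q1. apply Rabs_le_between in Q2.
    unfold inbox, bl, bh, lo, hi, Re, Im in *; simpl. repeat split; lra. }
  assert (Hout : forall x : X, inbox bl bh x -> Qs (fst x) /\ 1 <= snd x <= T1).
  { intros [q t] [I1 [I2 I3]]. unfold bl, bh, lo, hi, Qs, Re, Im in *. simpl in *.
    split; [split; apply Rabs_le; lra|exact I3]. }
  assert (Hb1 : inbox bl bh (c, 1)) by (apply Hin; [assumption|lra]).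
  assert (HbT : inbox bl bh (c, T1)) by (apply Hin; [assumption|lra]).
  set (top := fun x : X => (RtoC (snd x) * P N (fst x))%C).
  assert (Htopc : forall x : X, Ccont top x).
  { intros x. apply Ccont_mult; [apply Ccont_RtoC, Rcont_sndX|]. apply (@Ccont_P X), Ccont_fstX. }
  assert (Htopav : forall x i, inbox bl bh x -> (i < N)%nat -> top x <> P i (fst x)).
  { intros x i Hx Hi. destruct (Hout x Hx) as [Hq Ht].
    apply (ray_avoids K theta hK (fst x) (rho (fst x)) (psi (fst x))); auto; tauto. }
  destruct (lift_iter K theta hK N (fun x : X => fst x) bl bh (c, 1) (fun x _ => Ccont_fstX x) Hb1 top c)
    as [Z [HZc [HZ1 HZn]]].
  { intros x _; apply Htopc. }
  { exact Htopav. }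
  { unfold top; simpl. rewrite Cmult_1_l. reflexivity. }
  assert (HZn' : forall c' t, Qs c' -> 1 <= t <= T1 -> Nat.iter N (f c') (Z (c', t)) = (RtoC t * P N c')%C).
  { intros c' t Hc' Ht. apply (HZn (c', t)), Hin; assumption. }
  (* W is anchored at the far end, where the values of [psi] are under control, and not at t = 1,
     where the continuity of [Psi] is the question. *)
  set (wb := psi c (Z (c, T1))).
  assert (HZD : forall c', Qs c' -> Dstrict c' (Z (c', T1))).
  { intros c' Hc'. apply Hfar with T1; [assumption|lra|]. apply (HZn (c', T1)), Hin; [assumption|lra]. }
  destruct (lift_iter K theta hK N (fun _ : X => RtoC 0) bl bh (c, T1) (fun x _ => Ccont_const _ x) HbT
    (fun x => psi (fst x) (top x)) wb) as [W [HWc [HW1 HWn]]].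
  { intros x Hx. destruct (Hout x Hx) as [Hq Ht]. apply (@psi_joint_cont X).
    - apply HQD; tauto.
    - apply Ccont_fstX.
    - apply Htopc. }
  { intros x i Hx _. destruct (Hout x Hx) as [Hq Ht]. rewrite P_at_0.
    apply (bott_neq_0 K theta hK (fst x) (rho (fst x)) (psi (fst x)) (hpsi _) (HQM _ Hq)).
    apply Dstrict_ext, HQD; tauto. }
  { unfold wb, top; simpl fst; simpl snd.
    etransitivity; [apply (bott_iter K theta c (rho c) (psi c) (hpsi c)); apply Dstrict_ext, HZD, HQc|].
    f_equal. apply (HZn (c, T1) HbT). }
  assert (Hnz : forall c' t, Qs c' -> 1 <= t <= T1 -> forall i, psi c' (top (c', t)) <> P i (RtoC 0)).
  { intros c' t Hq Ht i. rewrite P_at_0.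
    apply (bott_neq_0 K theta hK c' (rho c') (psi c') (hpsi _) (HQM _ Hq)).
    apply Dstrict_ext, HQD; tauto. }
  assert (HWn' : forall c' t, Qs c' -> 1 <= t <= T1 ->
    Nat.iter N (f (RtoC 0)) (W (c', t)) = psi c' (RtoC t * P N c')%C).
  { intros c' t Hc' Ht. apply (HWn (c', t)), Hin; assumption. }
  assert (Hpath : forall (V : X -> C) (c' : C), (forall x, inbox bl bh x -> Ccont V x) -> Qs c' ->
    forall t, 1 <= t <= T1 -> Ccont (fun t => V (c', t)) t).
  { intros V c' HV Hc' t Ht. apply (continuous_comp (fun t : R => (c', t) : X) V).
    - apply Xcont_pair; [apply Ccont_const|apply Rcont_id].
    - apply HV, Hin; assumption. }
  set (line := fun (c' : C) (s : R) => (c + RtoC s * (c' - c))%C).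
  assert (Hline : forall c' s, Ccont (line c') s).
  { intros c' s. apply Ccont_plus; [apply Ccont_const|]. apply Ccont_mult; [|apply Ccont_const].
    apply Ccont_RtoC, Rcont_id. }
  assert (Hline0 : forall c', line c' 0 = c) by (intros; unfold line; ring).
  assert (Hline1 : forall c', line c' 1 = c') by (intros; unfold line; ring).
  assert (Hpath' : forall (V : X -> C) (c' : C) (t : R), (forall x, inbox bl bh x -> Ccont V x) -> Qs c' ->
    1 <= t <= T1 -> forall s, 0 <= s <= 1 -> Ccont (fun s => V (line c' s, t)) s).
  { intros V c' t HV Hc' Ht s Hs. apply (continuous_comp (fun s : R => (line c' s, t) : X) V).
    - apply Xcont_pair; [apply Hline|apply Rcont_const].
    - apply HV, Hin; [apply Hseg; assumption|assumption]. }
  (* Z is anchored at the central parameter only. The other parameters are reached along segments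
     inside the box, by uniqueness of lifts. *)
  assert (HZB : forall c', Qs c' -> Z (c', 1) = c').
  { intros c' Hc'. rewrite <- (Hline1 c') at 2. symmetry.
    rewrite <- (Hline1 c') at 2.
    apply (lift_unique K theta hK N (line c') 0 1 0) with (z := fun s => Z (line c' s, 1))
      (z' := line c'); try lra.
    - intros; apply Hline.
    - apply (Hpath' Z c' 1 HZc Hc'). lra.
    - intros; apply Hline.
    - intros t i Ht Hi. rewrite HZn' by (try apply Hseg; assumption || lra).
      apply (Htopav (line c' t, 1)); [apply Hin; [apply Hseg; assumption|lra]|assumption].
    - intros t Ht. rewrite HZn' by (try apply Hseg; assumption || lra).
      rewrite Cmult_1_l. reflexivity.
    - rewrite Hline0. symmetry. exact HZ1. }
  assert (HTop : forall c', Qs c' -> psi c' (Z (c', T1)) = W (c', T1)).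
  { intros c' Hc'. rewrite <- (Hline1 c').
    apply (lift_unique K theta hK N (fun _ => RtoC 0) 0 1 0) with (z := fun s => W (line c' s, T1))
      (z' := fun s => psi (line c' s) (Z (line c' s, T1))); try lra.
    - intros; apply Ccont_const.
    - apply (Hpath' W c' T1 HWc Hc'). lra.
    - intros t Ht. apply (@psi_joint_cont R_UniformSpace).
      + apply HZD, Hseg; assumption.
      + apply Hline.
      + apply (Hpath' Z c' T1 HZc Hc'); lra.
    - intros t i Ht Hi. rewrite HWn' by (try apply Hseg; assumption || lra).
      apply (Hnz (line c' t) T1); [apply Hseg; assumption|lra].
    - intros t Ht. rewrite HWn' by (try apply Hseg; assumption || lra).
      etransitivity; [apply (bott_iter K theta (line c' t) (rho _) (psi _) (hpsi _));
        apply Dstrict_ext, HZD, Hseg; assumption|].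
      f_equal. apply HZn'; [apply Hseg; assumption|lra].
    - rewrite Hline0. symmetry. exact HW1. }
  assert (Heq : forall c', Qs c' -> W (c', 1) = Psi psi_ext c').
  { intros c' Hc'. unfold Psi.
    destruct (ray_value_ext K theta hK c' (rho c') (psi c') (hpsi c') (HQM c' Hc') (psi_ext c')
      (hext c' (HQM c' Hc'))) as [n1 [Hn1 [Hmin Hray]]].
    pose proof (Hmin N (HQr c' Hc')) as Hn1N.
    apply (ray_value_le K theta hK c' (rho c') (psi c') (hpsi c') (HQM c' Hc') n1 (N - n1)) in Hray;
      [|assumption].
    replace (N - n1 + n1)%nat with N in Hray by lia.
    destruct Hray as [T0 [HT0 Hray]].
    (* [T0] depends on [c'] without any uniformity; the path is taken beyond both bounds and then
       compared at the common time [T1]. *)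
    set (T := T0 + T1).
    destruct (Hray T ltac:(unfold T; lra)) as [z [e [Hz [He [Hz1 [He1 [Hzn [Hen HeT]]]]]]]].
    assert (HTT : T1 <= T) by (unfold T; lra).
    assert (Hnz' : forall t i, 1 <= t -> psi c' (RtoC t * P N c')%C <> P i (RtoC 0)).
    { intros t i Ht. rewrite P_at_0.
      apply (bott_neq_0 K theta hK c' (rho c') (psi c') (hpsi _) (HQM _ Hc')).
      apply Dstrict_ext, HQD; tauto. }
    (* The path [e] is known to meet [psi] only at [T]. Uniqueness carries the equality back to
       [T1], since the lift stays in the domain of [psi] in between. *)
    assert (Hend : psi c' (z T1) = e T1).
    { apply (lift_unique K theta hK N (fun _ => RtoC 0) T1 T T) with (z := e)
        (z' := fun t => psi c' (z t)); try lra.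
      - intros; apply Ccont_const.
      - intros t Ht. apply He. lra.
      - intros t Ht. apply Ccont_comp; [apply Hz; lra|].
        apply (bott_cont K theta c' (rho c') (psi c') (hpsi c')).
        apply Dstrict_ext, Hfar with t; [assumption|lra|]. apply Hzn. lra.
      - intros t i Ht Hi. change (Nat.iter N f0 (e t) <> P i (RtoC 0)). rewrite Hen by lra. apply Hnz'. lra.
      - intros t Ht. change (Nat.iter N f0 (psi c' (z t)) = Nat.iter N f0 (e t)). rewrite Hen by lra.
        rewrite <- Hzn by lra. apply (bott_iter K theta c' (rho c') (psi c') (hpsi c')).
        apply Dstrict_ext, Hfar with t; [assumption|lra|]. apply Hzn. lra.
      - symmetry; exact HeT. }
    assert (HzZ : forall t, 1 <= t <= T1 -> z t = Z (c', t)).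
    { apply (lift_unique K theta hK N (fun _ => c') 1 T1 1) with (z := fun t => Z (c', t)) (z' := z); try lra.
      - intros; apply Ccont_const.
      - apply (Hpath Z c' HZc Hc').
      - intros t Ht. apply Hz. lra.
      - intros t i Ht Hi. rewrite HZn' by assumption.
        apply (Htopav (c', t)); [apply Hin; assumption|assumption].
      - intros t Ht. rewrite HZn' by assumption. apply Hzn. lra.
      - rewrite Hz1. symmetry. apply HZB, Hc'. }
    rewrite <- He1. symmetry.
    apply (lift_unique K theta hK N (fun _ => RtoC 0) 1 T1 T1) with (z := fun t => W (c', t)) (z' := e); try lra.
    - intros; apply Ccont_const.
    - apply (Hpath W c' HWc Hc').
    - intros t Ht. apply He. lra.
    - intros t i Ht Hi. rewrite HWn' by assumption. apply (Hnz c' t); assumption.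
    - intros t Ht. rewrite HWn' by assumption.
      change (Nat.iter N f0 (e t) = psi c' (RtoC t * P N c')%C). apply Hen. lra.
    - rewrite <- Hend, HzZ by lra. apply HTop, Hc'. }
  apply (@continuous_ext_loc C_UniformSpace C_UniformSpace) with (g := fun c' => W (c', 1)).
  - exists (mkposreal r (proj1 Hr)). intros c' [B1 B2]. apply Heq. split.
    + change (Rabs (Re c' - Re c) < r) in B1. lra.
    + change (Rabs (Im c' - Im c) < r) in B2. lra.
  - apply (continuous_comp (fun c' : C_UniformSpace => (c', 1) : X) W).
    + apply (@Xcont_pair C_UniformSpace); [exact Hid|apply (@Rcont_const C_UniformSpace)].
    + apply HWc, Hb1.
Qed.

End Plane.

(** * Real derivatives and 2x2 matrices *)

Lemma mat_ext (A B : M2) :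
  coef A 0 0 = coef B 0 0 -> coef A 0 1 = coef B 0 1 ->
  coef A 1 0 = coef B 1 0 -> coef A 1 1 = coef B 1 1 -> A = B.
Proof.
  destruct A as [[a [b []]] [[c [d []]] []]]. destruct B as [[a' [b' []]] [[c' [d' []]] []]].
  unfold coef, coeff_mat. simpl. intros; subst. reflexivity.
Qed.

Lemma coef_mmul (A B : M2) (i j : nat) : (i < 2)%nat -> (j < 2)%nat ->
  coef (mmul A B) i j = coef A i 0 * coef B 0 j + coef A i 1 * coef B 1 j.
Proof.
  intros Hi Hj. unfold coef, mmul, Mmult. rewrite coeff_mat_bij by assumption.
  unfold sum_n, sum_n_m, Iter.iter_nat. simpl. unfold plus, mult, zero; simpl. ring.
Qed.

Lemma coef_madd (A B : M2) (i j : nat) : (i < 2)%nat -> (j < 2)%nat ->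
  coef (madd A B) i j = coef A i j + coef B i j.
Proof.
  intros Hi Hj. unfold coef, madd. unfold plus. simpl. unfold Mplus.
  rewrite coeff_mat_bij by assumption. reflexivity.
Qed.

Lemma coef_msub (A B : M2) (i j : nat) : (i < 2)%nat -> (j < 2)%nat ->
  coef (msub A B) i j = coef A i j - coef B i j.
Proof.
  intros Hi Hj. destruct A as [[a [b []]] [[c [d []]] []]]. destruct B as [[a' [b' []]] [[c' [d' []]] []]].
  destruct i as [|[|i]]; [| |lia]; (destruct j as [|[|j]]; [| |lia]); reflexivity.
Qed.

Lemma coef_mscal (t : R) (A : M2) (i j : nat) : (i < 2)%nat -> (j < 2)%nat ->
  coef (mscal t A) i j = t * coef A i j.
Proof. intros. unfold coef at 1, mscal. rewrite coeff_mat_bij by assumption. reflexivity. Qed.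

Lemma coef_mat2_00 (a b c d : R) : coef (mat2 a b c d) 0 0 = a. Proof. reflexivity. Qed.
Lemma coef_mat2_01 (a b c d : R) : coef (mat2 a b c d) 0 1 = b. Proof. reflexivity. Qed.
Lemma coef_mat2_10 (a b c d : R) : coef (mat2 a b c d) 1 0 = c. Proof. reflexivity. Qed.
Lemma coef_mat2_11 (a b c d : R) : coef (mat2 a b c d) 1 1 = d. Proof. reflexivity. Qed.
Lemma coef_I2_00 : coef I2 0 0 = 1. Proof. reflexivity. Qed.
Lemma coef_I2_01 : coef I2 0 1 = 0. Proof. reflexivity. Qed.
Lemma coef_I2_10 : coef I2 1 0 = 0. Proof. reflexivity. Qed.
Lemma coef_I2_11 : coef I2 1 1 = 1. Proof. reflexivity. Qed.

Ltac mcoef :=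
  repeat first [rewrite coef_mmul by lia | rewrite coef_madd by lia | rewrite coef_msub by lia |
                rewrite coef_mscal by lia];
  rewrite ?coef_mat2_00, ?coef_mat2_01, ?coef_mat2_10, ?coef_mat2_11,
    ?coef_I2_00, ?coef_I2_01, ?coef_I2_10, ?coef_I2_11.

Ltac mact :=
  apply C_ext; unfold mat_act, Re, Im, Cminus, Cplus, Cmult, Copp, RtoC, Ci; cbn [fst snd]; mcoef.

Lemma act_mmul (A B : M2) (z : C) : mat_act (mmul A B) z = mat_act A (mat_act B z).
Proof. mact; ring. Qed.

Lemma act_madd (A B : M2) (z : C) : mat_act (madd A B) z = (mat_act A z + mat_act B z)%C.
Proof. mact; ring. Qed.

Lemma act_msub (A B : M2) (z : C) : mat_act (msub A B) z = (mat_act A z - mat_act B z)%C.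
Proof. mact; ring. Qed.

Lemma act_mscal (t : R) (A : M2) (z : C) : mat_act (mscal t A) z = (RtoC t * mat_act A z)%C.
Proof. mact; ring. Qed.

Lemma act_I2 (z : C) : mat_act I2 z = z.
Proof. mact; ring. Qed.

Lemma act_plus (A : M2) (z w : C) : mat_act A (z + w)%C = (mat_act A z + mat_act A w)%C.
Proof. mact; ring. Qed.

Lemma act_opp (A : M2) (z : C) : mat_act A (- z)%C = (- mat_act A z)%C.
Proof. mact; ring. Qed.

Lemma act_minus (A : M2) (z w : C) : mat_act A (z - w)%C = (mat_act A z - mat_act A w)%C.
Proof. unfold Cminus. rewrite act_plus, act_opp. reflexivity. Qed.

Lemma act_scal (A : M2) (t : R) (z : C) : mat_act A (RtoC t * z)%C = (RtoC t * mat_act A z)%C.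
Proof. mact; ring. Qed.

Lemma act_ext (A B : M2) : (forall z, mat_act A z = mat_act B z) -> A = B.
Proof.
  intros H. pose proof (H (RtoC 1)) as H1. pose proof (H Ci) as H2.
  pose proof (f_equal Re H1) as R1. pose proof (f_equal Im H1) as I1.
  pose proof (f_equal Re H2) as R2. pose proof (f_equal Im H2) as I2'.
  unfold mat_act in *; simpl in *.
  apply mat_ext; lra.
Qed.

Lemma act_lin_mat (L : C -> C) :
  (forall z w, L (z + w)%C = (L z + L w)%C) -> (forall (t : R) z, L (RtoC t * z)%C = (RtoC t * L z)%C) ->
  forall z, mat_act (lin_mat L) z = L z.
Proof.
  intros Hp Hs z.
  assert (E : L z = (RtoC (Re z) * L (RtoC 1) + RtoC (Im z) * L Ci)%C).
  { rewrite <- !Hs, <- Hp. f_equal. apply C_ext; simpl; ring. }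
  rewrite E. unfold lin_mat. mact; ring.
Qed.

Lemma act_mulC (a z : C) : mat_act (lin_mat (fun v => (a * v)%C)) z = (a * z)%C.
Proof. rewrite act_lin_mat; [reflexivity| |]; intros; ring. Qed.

Lemma act_Rot (t : R) (z : C) : mat_act (Rot t) z = (cis t * z)%C.
Proof. apply act_mulC. Qed.

Lemma act_Hmat (K theta : R) (z : C) : mat_act (Hmat K theta) z = h K theta z.
Proof.
  apply act_lin_mat; intros.
  - apply h_plus.
  - apply h_scal.
Qed.

Lemma mdet_mmul (A B : M2) : mdet (mmul A B) = mdet A * mdet B.
Proof. unfold mdet. mcoef. ring. Qed.

Lemma mdet_I2 : mdet I2 = 1.
Proof. unfold mdet. mcoef. ring. Qed.

Lemma mdet_mscal (t : R) (A : M2) : mdet (mscal t A) = t ^ 2 * mdet A.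
Proof. unfold mdet. mcoef. ring. Qed.

Lemma mdet_mulC (a : C) : mdet (lin_mat (fun v => (a * v)%C)) = Cmod a ^ 2.
Proof. rewrite Cmod_sqr. unfold mdet, lin_mat. mcoef.
  unfold Re, Im, Cmult, RtoC, Ci; cbn [fst snd]. ring.
Qed.

Lemma mdet_Rot (t : R) : mdet (Rot t) = 1.
Proof. unfold Rot. rewrite mdet_mulC, Cmod_cis. ring. Qed.

Lemma mdet_Hmat (K theta : R) : mdet (Hmat K theta) = K.
Proof.
  unfold mdet, Hmat, lin_mat. mcoef. unfold h, cis. simpl.
  pose proof (cis_norm (2 * theta)) as H.
  set (c := cos (2 * theta)) in *. set (s := sin (2 * theta)) in *.
  set (a := (K + 1) / 2).
  replace ((K - 1) / 2) with (a - 1) by (unfold a; field).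
  replace K with (2 * a - 1) by (unfold a; field).
  assert (Hs : s * s = 1 - c * c) by lra. clear H.
  ring [Hs].
Qed.

Lemma minv_l (A : M2) (z : C) : mdet A <> 0 -> mat_act (minv A) (mat_act A z) = z.
Proof.
  intros H. unfold minv. unfold mdet in *.
  mact; field; exact H.
Qed.

Lemma minv_r (A : M2) (z : C) : mdet A <> 0 -> mat_act A (mat_act (minv A) z) = z.
Proof.
  intros H. unfold minv. unfold mdet in *.
  mact; field; exact H.
Qed.

Lemma mdet_minv (A : M2) : mdet A <> 0 -> mdet (minv A) = / mdet A.
Proof. intros H. unfold minv, mdet in *. mcoef. field. exact H. Qed.

Lemma minv_mmul (A B : M2) : mdet A <> 0 -> mdet B <> 0 -> minv (mmul A B) = mmul (minv B) (minv A).
Proof.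
  intros HA HB. assert (HAB : mdet (mmul A B) <> 0).
  { rewrite mdet_mmul. apply Rmult_integral_contrapositive_currified; assumption. }
  apply act_ext. intros z. rewrite act_mmul.
  assert (E : z = mat_act (mmul A B) (mat_act (minv B) (mat_act (minv A) z))).
  { rewrite act_mmul, !minv_r by assumption. reflexivity. }
  rewrite E at 1. apply minv_l, HAB.
Qed.

(** Stands in for operator norm bounds without a supremum; [opnorm_bnd] translates at the end. *)
Definition bnd (A : M2) (M : R) : Prop := forall z, Cmod (mat_act A z) <= M * Cmod z.

Lemma bnd_ex (A : M2) : exists M, 0 < M /\ bnd A M.
Proof.
  set (s := Rabs (coef A 0 0) + Rabs (coef A 0 1) + Rabs (coef A 1 0) + Rabs (coef A 1 1)).
  assert (Hs : 0 <= s) by (unfold s; pose proof (Rabs_pos (coef A 0 0)); pose proof (Rabs_pos (coef A 0 1));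
    pose proof (Rabs_pos (coef A 1 0)); pose proof (Rabs_pos (coef A 1 1)); lra).
  exists (1 + 2 * s). split; [lra|]. intros z.
  pose proof (Rmax_Cmod z) as Hz.
  pose proof (Rle_trans _ _ _ (Rmax_l _ _) Hz) as Hz1. pose proof (Rle_trans _ _ _ (Rmax_r _ _) Hz) as Hz2.
  pose proof (Cmod_ge_0 z) as Hz0.
  assert (He : forall i, (i < 2)%nat -> Rabs (coef A i 0 * Re z + coef A i 1 * Im z)
    <= (Rabs (coef A i 0) + Rabs (coef A i 1)) * Cmod z).
  { intros i _. eapply Rle_trans; [apply Rabs_triang|]. rewrite !Rabs_mult.
    pose proof (Rabs_pos (coef A i 0)). pose proof (Rabs_pos (coef A i 1)).
    unfold Re, Im. nra. }
  pose proof (He 0%nat ltac:(lia)) as H0. pose proof (He 1%nat ltac:(lia)) as H1.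
  eapply Rle_trans; [apply Cmod_2Rmax|]. unfold mat_act; simpl fst; simpl snd.
  assert (Hs2 : sqrt 2 * sqrt 2 = 2) by (apply sqrt_sqrt; lra).
  pose proof (sqrt_pos 2). assert (sqrt 2 <= 2) by nra.
  assert (Hm : Rmax (Rabs (coef A 0 0 * Re z + coef A 0 1 * Im z))
    (Rabs (coef A 1 0 * Re z + coef A 1 1 * Im z)) <= s * Cmod z).
  { pose proof (Rabs_pos (coef A 0 0)); pose proof (Rabs_pos (coef A 0 1));
    pose proof (Rabs_pos (coef A 1 0)); pose proof (Rabs_pos (coef A 1 1)).
    unfold s. apply Rmax_lub; nra. }
  assert (0 <= Rmax (Rabs (coef A 0 0 * Re z + coef A 0 1 * Im z))
    (Rabs (coef A 1 0 * Re z + coef A 1 1 * Im z))).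
  { eapply Rle_trans; [apply Rabs_pos|apply Rmax_l]. }
  nra.
Qed.

Lemma bnd_le (A : M2) (M M' : R) : M <= M' -> bnd A M -> bnd A M'.
Proof. intros H HA z. pose proof (HA z). pose proof (Cmod_ge_0 z). nra. Qed.

Lemma bnd_mmul (A B : M2) (M N : R) : 0 <= M -> bnd A M -> bnd B N -> bnd (mmul A B) (M * N).
Proof.
  intros HM HA HB z. rewrite act_mmul. pose proof (HA (mat_act B z)). pose proof (HB z).
  rewrite Rmult_assoc. eapply Rle_trans; [exact H|]. apply Rmult_le_compat_l; assumption.
Qed.

Lemma Cmod_Ci : Cmod Ci = 1.
Proof.
  unfold Cmod, Ci; cbn [fst snd]. replace (0 ^ 2 + 1 ^ 2) with 1 by ring. apply sqrt_1.
Qed.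

Lemma bnd_coef (A : M2) (M : R) (i j : nat) : (i < 2)%nat -> (j < 2)%nat -> bnd A M -> Rabs (coef A i j) <= M.
Proof.
  intros Hi Hj HA.
  assert (Hcol : exists z, Cmod z = 1 /\ (coef A 0 j, coef A 1 j) = mat_act A z).
  { destruct j as [|[|j]]; [exists (RtoC 1) | exists Ci | lia]; split.
    - apply Cmod_1.
    - mact; ring.
    - apply Cmod_Ci.
    - mact; ring. }
  destruct Hcol as [z [Hz1 Hz]]. pose proof (HA z) as H. rewrite <- Hz, Hz1, Rmult_1_r in H.
  eapply Rle_trans; [|exact H]. eapply Rle_trans; [|apply Rmax_Cmod]. simpl fst; simpl snd.
  destruct i as [|[|i]]; [apply Rmax_l | apply Rmax_r | lia].
Qed.

Lemma opnorm_bnd (A : M2) (M : R) : 0 <= M -> bnd A M -> 0 <= opnorm A <= M.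
Proof.
  intros HM HA. unfold opnorm.
  set (E := fun x => exists z : C, Cmod z <= 1 /\ x = Cmod (mat_act A z)).
  assert (Hub : is_ub_Rbar E M).
  { intros x [z [Hz ->]]. simpl. pose proof (HA z). pose proof (Cmod_ge_0 z). nra. }
  (* The value at the zero vector rules out a supremum equal to [m_infty] and makes it
     nonnegative. *)
  assert (H0 : E 0).
  { exists (RtoC 0). rewrite Cmod_0. split; [lra|].
    replace (mat_act A (RtoC 0)) with (RtoC 0) by (mact; ring).
    symmetry; apply Cmod_0. }
  destruct (Lub_Rbar_correct E) as [L1 L2].
  pose proof (L2 _ Hub) as U. pose proof (L1 _ H0) as V.
  destruct (Lub_Rbar E); simpl in *; lra || contradiction.
Qed.

(** The derivative is an explicit matrix, so that chain rules can be stated before [Dmat] is known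
    to be that matrix; [diffat_Dmat] and [diffat_differentiable] convert. *)
Definition diffat (F : C -> C) (z : C) (A : M2) : Prop :=
  forall eps, 0 < eps -> exists d, 0 < d /\ forall v, Cmod v < d ->
    Cmod (F (z + v)%C - F z - mat_act A v)%C <= eps * Cmod v.

Lemma norm_Cmod (z : C) : @norm R_AbsRing C_R_NormedModule z = Cmod z.
Proof.
  change (sqrt (Rabs (fst z) ^ 2 + Rabs (snd z) ^ 2) = Cmod z). unfold Cmod.
  rewrite !pow2_abs. reflexivity.
Qed.

Lemma Cmod_ball (z w : C) (eps : posreal) : Cmod (w - z)%C < eps -> @ball C_UniformSpace z eps w.
Proof.
  intros H. pose proof (Rmax_Cmod (w - z)%C) as Hm.
  pose proof (Rle_trans _ _ _ (Rmax_l _ _) Hm) as H1. pose proof (Rle_trans _ _ _ (Rmax_r _ _) Hm) as H2.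
  split; (eapply Rle_lt_trans; [|exact H]); assumption.
Qed.

Lemma locally_Cmod (Q : C -> Prop) (z : C) :
  @locally C_UniformSpace z Q <-> exists d, 0 < d /\ forall v, Cmod v < d -> Q (z + v)%C.
Proof.
  split.
  - intros [eps H]. exists eps. split; [apply cond_pos|]. intros v Hv. apply H, Cmod_ball.
    replace (z + v - z)%C with v by ring. exact Hv.
  - intros [d [Hd H]]. assert (Hd2 : 0 < d / 2) by lra.
    exists (mkposreal _ Hd2). intros y [B1 B2].
    change (Rabs (fst y - fst z) < d / 2) in B1. change (Rabs (snd y - snd z) < d / 2) in B2.
    replace y with (z + (y - z))%C by ring. apply H.
    eapply Rle_lt_trans; [apply Cmod_2Rmax|].
    assert (Hm : Rmax (Rabs (fst (y - z)%C)) (Rabs (snd (y - z)%C)) < d / 2)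
      by (apply Rmax_lub_lt; assumption).
    assert (Hs2 : sqrt 2 * sqrt 2 = 2) by (apply sqrt_sqrt; lra).
    pose proof (sqrt_pos 2). assert (sqrt 2 < 2) by nra.
    assert (0 <= Rmax (Rabs (fst (y - z)%C)) (Rabs (snd (y - z)%C))).
    { eapply Rle_trans; [apply Rabs_pos|apply Rmax_l]. }
    nra.
Qed.

Lemma act_is_linear (A : M2) : @is_linear R_AbsRing C_R_NormedModule C_R_NormedModule (mat_act A).
Proof.
  split.
  - intros x y. apply act_plus.
  - intros k x.
    change (mat_act A (k * fst x, k * snd x) = (k * fst (mat_act A x), k * snd (mat_act A x))).
    mact; ring.
  - destruct (bnd_ex A) as [M [HM HA]]. exists M. split; [exact HM|].
    intros x. rewrite !norm_Cmod. apply HA.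
Qed.

Lemma diffat_filterdiff (F : C -> C) (z : C) (A : M2) : diffat F z A ->
  @filterdiff R_AbsRing C_R_NormedModule C_R_NormedModule F (@locally C_R_NormedModule z) (mat_act A).
Proof.
  intros H. split; [apply act_is_linear|]. intros x Hx eps.
  apply (@is_filter_lim_locally_unique R_AbsRing C_R_NormedModule) in Hx. subst x.
  destruct (H eps (cond_pos eps)) as [d [Hd HF]].
  apply (proj2 (locally_Cmod _ z)). exists d. split; [exact Hd|]. intros v Hv.
  rewrite !norm_Cmod.
  change (Cmod (F (z + v) - F z - mat_act A (z + v - z))%C <= eps * Cmod (z + v - z)%C).
  replace (z + v - z)%C with v by ring. apply HF, Hv.
Qed.

Lemma diffat_Dmat (F : C -> C) (z : C) (A : M2) : diffat F z A -> Dmat F z = A.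
Proof.
  intros H.
  (* Each entry of [Dmat] is the derivative of p(F(z + s u)) in s, with p one of [Re], [Im] and u
     one of 1, i; the four cases are treated at once. *)
  assert (Hd : forall (p : C -> R) (u : C), Cmod u = 1 -> (forall w, Rabs (p w) <= Cmod w) ->
    (forall w w', p (w - w')%C = p w - p w') -> (forall (t : R) w, p (RtoC t * w)%C = t * p w) ->
    forall (g : R -> C) (x0 : R), (forall t, g t = (z + RtoC (t - x0) * u)%C) ->
    Derive (fun t => p (F (g t))) x0 = p (mat_act A u)).
  { intros p u Hu Hp Hpm Hps g x0 Hg. apply is_derive_unique, is_derive_Reals. intros eps Heps.
    destruct (H (eps / 2)) as [d [Hd HF]]; [lra|]. exists (mkposreal _ Hd).
    intros t Ht Htd. simpl in Htd.
    assert (E1 : g x0 = z) by (rewrite Hg, Rminus_diag; ring).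
    assert (E2 : g (x0 + t) = (z + RtoC t * u)%C).
    { rewrite Hg. f_equal. f_equal. f_equal. ring. }
    rewrite E1, E2.
    assert (Hv : Cmod (RtoC t * u)%C = Rabs t) by (rewrite Cmod_RtoC_mult, Hu; ring).
    specialize (HF (RtoC t * u)%C). rewrite Hv in HF. specialize (HF Htd).
    replace ((p (F (z + RtoC t * u)%C) - p (F z)) / t - p (mat_act A u))
      with (p (F (z + RtoC t * u)%C - F z - mat_act A (RtoC t * u))%C / t).
    - unfold Rdiv. rewrite Rabs_mult, Rabs_inv.
      apply Rle_lt_trans with (eps / 2); [|lra].
      apply Rmult_le_reg_r with (Rabs t); [apply Rabs_pos_lt; assumption|].
      rewrite Rmult_assoc, Rinv_l, Rmult_1_r by (apply Rabs_no_R0; assumption).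
      eapply Rle_trans; [apply Hp|exact HF].
    - rewrite !Hpm, act_scal, Hps. field. assumption. }
  assert (HRe : forall w, Rabs (Re w) <= Cmod w).
  { intros w. eapply Rle_trans; [apply Rmax_l|apply Rmax_Cmod]. }
  assert (HIm : forall w, Rabs (Im w) <= Cmod w).
  { intros w. eapply Rle_trans; [apply Rmax_r|apply Rmax_Cmod]. }
  pose proof Cmod_Ci as HCi.
  assert (G1 : forall t, ((t, Im z) : C) = (z + RtoC (t - Re z) * RtoC 1)%C).
  { intros t. mact; ring. }
  assert (G2 : forall t, ((Re z, t) : C) = (z + RtoC (t - Im z) * Ci)%C).
  { intros t. mact; ring. }
  unfold Dmat. apply mat_ext; mcoef.
  - etransitivity; [refine (Hd Re (RtoC 1) Cmod_1 HRe _ _ (fun t => (t, Im z)) _ G1)|]; intros;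
      unfold mat_act, Re, Im, Cminus, Cplus, Copp, Cmult, RtoC; cbn [fst snd]; ring.
  - etransitivity; [refine (Hd Re Ci HCi HRe _ _ (fun t => (Re z, t)) _ G2)|]; intros;
      unfold mat_act, Re, Im, Cminus, Cplus, Copp, Cmult, RtoC, Ci; cbn [fst snd]; ring.
  - etransitivity; [refine (Hd Im (RtoC 1) Cmod_1 HIm _ _ (fun t => (t, Im z)) _ G1)|]; intros;
      unfold mat_act, Re, Im, Cminus, Cplus, Copp, Cmult, RtoC; cbn [fst snd]; ring.
  - etransitivity; [refine (Hd Im Ci HCi HIm _ _ (fun t => (Re z, t)) _ G2)|]; intros;
      unfold mat_act, Re, Im, Cminus, Cplus, Copp, Cmult, RtoC, Ci; cbn [fst snd]; ring.
Qed.

Lemma diffat_differentiable (F : C -> C) (z : C) (A : M2) : diffat F z A -> differentiable_at F z.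
Proof.
  intros H. unfold differentiable_at. rewrite (diffat_Dmat F z A H). apply diffat_filterdiff, H.
Qed.

Lemma diffat_cont (F : C -> C) (z : C) (A : M2) : diffat F z A ->
  forall eps, 0 < eps -> exists d, 0 < d /\ forall v, Cmod v < d -> Cmod (F (z + v)%C - F z)%C < eps.
Proof.
  intros H eps Heps. destruct (bnd_ex A) as [M [HM HA]]. destruct (H 1) as [d [Hd HF]]; [lra|].
  exists (Rmin d (eps / (2 * (1 + M)))). split.
  { apply Rmin_pos; [exact Hd|]. apply Rdiv_lt_0_compat; lra. }
  intros v Hv. pose proof (Rlt_le_trans _ _ _ Hv (Rmin_l _ _)) as H1.
  pose proof (Rlt_le_trans _ _ _ Hv (Rmin_r _ _)) as H2.
  specialize (HF v H1). pose proof (HA v).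
  replace (F (z + v) - F z)%C with ((F (z + v) - F z - mat_act A v) + mat_act A v)%C by ring.
  eapply Rle_lt_trans; [apply Cmod_triangle|].
  apply Rle_lt_trans with ((1 + M) * Cmod v); [lra|].
  apply Rlt_le_trans with ((1 + M) * (eps / (1 + M))); [|right; field; lra].
  apply Rmult_lt_compat_l; [lra|]. eapply Rlt_le_trans; [exact H2|].
  unfold Rdiv. apply Rmult_le_compat_l; [lra|]. apply Rinv_le_contravar; lra.
Qed.

Lemma diffat_id (z : C) : diffat (fun x => x) z I2.
Proof.
  intros eps Heps. exists 1. split; [lra|]. intros v _. rewrite act_I2.
  replace (z + v - z - v)%C with (RtoC 0) by ring. rewrite Cmod_0.
  pose proof (Cmod_ge_0 v). nra.
Qed.

Lemma diffat_plus (F G : C -> C) (z : C) (A B : M2) :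
  diffat F z A -> diffat G z B -> diffat (fun x => (F x + G x)%C) z (madd A B).
Proof.
  intros HF HG eps Heps. destruct (HF (eps / 2)) as [d1 [Hd1 H1]]; [lra|].
  destruct (HG (eps / 2)) as [d2 [Hd2 H2]]; [lra|].
  exists (Rmin d1 d2). split; [apply Rmin_pos; assumption|]. intros v Hv.
  specialize (H1 v (Rlt_le_trans _ _ _ Hv (Rmin_l _ _))).
  specialize (H2 v (Rlt_le_trans _ _ _ Hv (Rmin_r _ _))).
  rewrite act_madd.
  replace (F (z + v) + G (z + v) - (F z + G z) - (mat_act A v + mat_act B v))%C
    with ((F (z + v) - F z - mat_act A v) + (G (z + v) - G z - mat_act B v))%C by ring.
  eapply Rle_trans; [apply Cmod_triangle|]. lra.
Qed.

Lemma diffat_addconst (F : C -> C) (z c : C) (A : M2) :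
  diffat F z A -> diffat (fun x => (F x + c)%C) z A.
Proof.
  intros H eps Heps. destruct (H eps Heps) as [d [Hd HF]]. exists d. split; [exact Hd|].
  intros v Hv. replace (F (z + v) + c - (F z + c) - mat_act A v)%C with (F (z + v) - F z - mat_act A v)%C by ring.
  apply HF, Hv.
Qed.

(** By linearity of [h], the increment is 2 h(g) h(G) + h(G)^2 with G the increment of [g], and the
    last term is quadratic. *)
Lemma diffat_hsqr (K theta : R) (hK : 1 < K) (g : C -> C) (z : C) (A : M2) :
  diffat g z A ->
  diffat (fun x => (h K theta (g x) * h K theta (g x))%C) z
    (mmul (mmul (lin_mat (fun v => (RtoC 2 * h K theta (g z) * v)%C)) (Hmat K theta)) A).
Proof.
  intros H eps Heps. destruct (bnd_ex A) as [M [HM HA]].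
  set (w := h K theta (g z)).
  (* The added 1 keeps L positive when w = 0. *)
  set (L := 2 * Cmod w * K + 1).
  assert (HL : 1 <= L) by (unfold L; pose proof (Cmod_ge_0 w); nra).
  set (e1 := Rmin 1 (eps / (2 * L))).
  assert (He1 : 0 < e1 /\ e1 <= 1 /\ L * e1 <= eps / 2).
  { split; [|split].
    - apply Rmin_pos; [lra|]. apply Rdiv_lt_0_compat; lra.
    - apply Rmin_l.
    - apply Rle_trans with (L * (eps / (2 * L))); [apply Rmult_le_compat_l; [lra|apply Rmin_r]|].
      right. field. lra. }
  destruct He1 as [He1 [He1' He1'']].
  destruct (H e1 He1) as [d [Hd HF]].
  set (N := K ^ 2 * (M + 1) ^ 2 + 1).
  assert (HN : 1 <= N) by (unfold N; nra).
  exists (Rmin d (eps / (2 * N))). split; [apply Rmin_pos; [exact Hd|apply Rdiv_lt_0_compat; lra]|].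
  intros v Hv. pose proof (Rlt_le_trans _ _ _ Hv (Rmin_r _ _)) as Hv2.
  specialize (HF v (Rlt_le_trans _ _ _ Hv (Rmin_l _ _))).
  set (G := (g (z + v) - g z)%C) in *. set (r := (G - mat_act A v)%C) in *.
  pose proof (HA v) as HAv. pose proof (Cmod_ge_0 v) as Hv0.
  assert (HG : Cmod G <= (M + 1) * Cmod v).
  { replace G with (r + mat_act A v)%C by (unfold r; ring).
    eapply Rle_trans; [apply Cmod_triangle|]. nra. }
  rewrite !act_mmul, act_mulC, act_Hmat. fold w.
  replace (g (z + v)%C) with (g z + G)%C by (unfold G; ring).
  replace (h K theta (g z + G) * h K theta (g z + G) - w * w - RtoC 2 * w * h K theta (mat_act A v))%C
    with (RtoC 2 * w * h K theta r + h K theta G * h K theta G)%C.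
  2:{ unfold r. rewrite h_plus, h_minus. fold w. rewrite <- (Cmult_1_l (w * w)). 
      replace (RtoC 2) with (RtoC 1 + RtoC 1)%C by (apply C_ext; simpl; ring). ring. }
  eapply Rle_trans; [apply Cmod_triangle|]. rewrite !Cmod_mult, Cmod_R, (Rabs_pos_eq 2) by lra.
  pose proof (h_le K theta hK r) as Hr. pose proof (h_le K theta hK G) as HhG.
  pose proof (Cmod_ge_0 (h K theta G)). pose proof (Cmod_ge_0 (h K theta r)). pose proof (Cmod_ge_0 w).
  pose proof (Cmod_ge_0 r). pose proof (Cmod_ge_0 G).
  assert (T1 : 2 * Cmod w * Cmod (h K theta r) <= eps / 2 * Cmod v).
  { apply Rle_trans with (2 * Cmod w * (K * (e1 * Cmod v))).
    - apply Rmult_le_compat_l; [lra|]. eapply Rle_trans; [exact Hr|]. apply Rmult_le_compat_l; lra.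
    - apply Rle_trans with (L * e1 * Cmod v).
      + unfold L. assert (0 <= e1 * Cmod v) by nra. nra.
      + apply Rmult_le_compat_r; assumption. }
  assert (T2 : Cmod (h K theta G) * Cmod (h K theta G) <= eps / 2 * Cmod v).
  { assert (Hb : Cmod (h K theta G) <= K * ((M + 1) * Cmod v)).
    { eapply Rle_trans; [exact HhG|]. apply Rmult_le_compat_l; lra. }
    apply Rle_trans with ((K * ((M + 1) * Cmod v)) * (K * ((M + 1) * Cmod v))).
    { apply Rmult_le_compat; assumption. }
    apply Rle_trans with (N * Cmod v * Cmod v).
    { unfold N. nra. }
    apply Rmult_le_compat_r; [assumption|].
    apply Rle_trans with (N * (eps / (2 * N))); [apply Rmult_le_compat_l; lra|]. right. field. lra. }
  lra.
Qed.

(** Here [g] is already continuous, so no inverse function has to be constructed: the first-order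
    expansions of [F] and [Q] only have to be solved for the increment of [g]. *)
Lemma diffat_implicit (F g Q : C -> C) (z : C) (A B : M2) :
  diffat F (g z) B -> mdet B <> 0 -> diffat Q z A ->
  @continuous C_UniformSpace C_UniformSpace g z ->
  @locally C_UniformSpace z (fun x => F (g x) = Q x) ->
  diffat g z (mmul (minv B) A).
Proof.
  intros HF HB HQ Hg Hloc eps Heps.
  destruct (bnd_ex A) as [M [HM HA]]. destruct (bnd_ex (minv B)) as [m [Hm HmB]].
  set (L := 2 * m * (M + 1)). assert (HL : 0 < L) by (unfold L; nra).
  (* The first bound lets half of |G| be absorbed on the left in [HGL]; the second makes the
     remaining error small. *)
  set (e1 := Rmin (/ (2 * m)) (eps / (2 * m * L))).
  assert (He1 : 0 < e1 /\ m * e1 <= / 2 /\ m * e1 * L <= eps / 2).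
  { split; [|split].
    - apply Rmin_pos; [apply Rinv_0_lt_compat; lra|apply Rdiv_lt_0_compat; [lra|nra]].
    - apply Rle_trans with (m * / (2 * m)); [apply Rmult_le_compat_l; [lra|apply Rmin_l]|].
      right; field; lra.
    - apply Rle_trans with (m * (eps / (2 * m * L)) * L).
      + apply Rmult_le_compat_r; [lra|]. apply Rmult_le_compat_l; [lra|apply Rmin_r].
      + right; field; lra. }
  destruct He1 as [He1 [He1' He1'']].
  set (e2 := Rmin 1 (eps / (2 * m))).
  assert (He2 : 0 < e2 /\ e2 <= 1 /\ m * e2 <= eps / 2).
  { split; [|split].
    - apply Rmin_pos; [lra|apply Rdiv_lt_0_compat; lra].
    - apply Rmin_l.
    - apply Rle_trans with (m * (eps / (2 * m))); [apply Rmult_le_compat_l; [lra|apply Rmin_r]|].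
      right; field; lra. }
  destruct He2 as [He2 [He2' He2'']].
  destruct (HF e1 He1) as [d1 [Hd1 H1]]. destruct (HQ e2 He2) as [d2 [Hd2 H2]].
  pose proof (Ccont_eps g z d1 Hg Hd1) as Lg.
  destruct (proj1 (locally_Cmod _ z) (filter_and _ _ Lg Hloc)) as [d3 [Hd3 H3]].
  exists (Rmin d2 d3). split; [apply Rmin_pos; assumption|]. intros v Hv.
  specialize (H2 v (Rlt_le_trans _ _ _ Hv (Rmin_l _ _))).
  destruct (H3 v (Rlt_le_trans _ _ _ Hv (Rmin_r _ _))) as [HG HE].
  assert (HE0 : F (g z) = Q z).
  { destruct (H3 (RtoC 0)) as [_ E]; [rewrite Cmod_0; assumption|]. rewrite Cplus_0_r in E. exact E. }
  set (G := (g (z + v) - g z)%C) in *.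
  specialize (H1 G HG). replace (g z + G)%C with (g (z + v)%C) in H1 by (unfold G; ring).
  rewrite HE, HE0 in H1.
  set (r1 := (Q (z + v) - Q z - mat_act B G)%C) in *. set (r2 := (Q (z + v) - Q z - mat_act A v)%C) in *.
  assert (HBG : mat_act B G = (mat_act A v + (r2 - r1))%C) by (unfold r1, r2; ring).
  assert (EG : G = (mat_act (minv B) (mat_act A v) + mat_act (minv B) (r2 - r1))%C).
  { rewrite <- act_plus, <- HBG, minv_l by assumption. reflexivity. }
  assert (Hr : Cmod (mat_act (minv B) (r2 - r1)%C) <= m * (e2 * Cmod v + e1 * Cmod G)).
  { eapply Rle_trans; [apply HmB|]. apply Rmult_le_compat_l; [lra|].
    eapply Rle_trans; [apply Cmod_triangle|]. rewrite Cmod_opp. lra. }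
  pose proof (Cmod_ge_0 v) as Hv0. pose proof (Cmod_ge_0 G) as HG0.
  (* A Lipschitz bound must come first, since the error of [F] is measured in |G| and not in |v|. *)
  assert (HGL : Cmod G <= L * Cmod v).
  { assert (Ha : Cmod (mat_act (minv B) (mat_act A v)) <= m * (M * Cmod v)).
    { eapply Rle_trans; [apply HmB|]. apply Rmult_le_compat_l; [lra|apply HA]. }
    assert (Hsum : Cmod G <= m * (M * Cmod v) + m * (e2 * Cmod v + e1 * Cmod G)).
    { rewrite EG at 1. eapply Rle_trans; [apply Cmod_triangle|]. lra. }
    assert (m * (e1 * Cmod G) <= / 2 * Cmod G) by nra.
    assert (m * (e2 * Cmod v) <= m * Cmod v) by (apply Rmult_le_compat_l; nra).
    unfold L. nra. }
  rewrite act_mmul.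
  assert (EG' : (G - mat_act (minv B) (mat_act A v))%C = mat_act (minv B) (r2 - r1)%C).
  { rewrite EG at 1. ring. }
  rewrite EG'. eapply Rle_trans; [exact Hr|].
  assert (m * (e1 * Cmod G) <= eps / 2 * Cmod v).
  { apply Rle_trans with (m * e1 * (L * Cmod v)); [|nra].
    rewrite <- Rmult_assoc. apply Rmult_le_compat_l; [nra|exact HGL]. }
  assert (m * (e2 * Cmod v) <= eps / 2 * Cmod v) by nra.
  lra.
Qed.

(** * The derivative of Psi *)

Section MatCont.
Context {T : UniformSpace}.

Lemma cmat_const (A : M2) (x : T) : continuous_mat (fun _ : T => A) x.
Proof. intros i j _ _. apply Rcont_const. Qed.

Lemma cmat_mmul (F G : T -> M2) (x : T) :
  continuous_mat F x -> continuous_mat G x -> continuous_mat (fun y => mmul (F y) (G y)) x.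
Proof.
  intros HF HG i j Hi Hj.
  apply (continuous_ext (fun y => coef (F y) i 0 * coef (G y) 0 j + coef (F y) i 1 * coef (G y) 1 j)).
  - intros y. rewrite coef_mmul by assumption. reflexivity.
  - apply Rcont_plus; (apply Rcont_mult; [apply HF; lia|apply HG; lia]).
Qed.

Lemma cmat_madd (F G : T -> M2) (x : T) :
  continuous_mat F x -> continuous_mat G x -> continuous_mat (fun y => madd (F y) (G y)) x.
Proof.
  intros HF HG i j Hi Hj.
  apply (continuous_ext (fun y => coef (F y) i j + coef (G y) i j)).
  - intros y. rewrite coef_madd by assumption. reflexivity.
  - apply Rcont_plus; [apply HF; assumption|apply HG; assumption].
Qed.

Lemma cmat_mdet (F : T -> M2) (x : T) : continuous_mat F x -> Rcont (fun y => mdet (F y)) x.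
Proof.
  intros HF. unfold mdet. apply Rcont_minus; apply Rcont_mult; apply HF; lia.
Qed.

Lemma cmat_mat2 (a b c d : T -> R) (x : T) : Rcont a x -> Rcont b x -> Rcont c x -> Rcont d x ->
  continuous_mat (fun y => mat2 (a y) (b y) (c y) (d y)) x.
Proof.
  intros Ha Hb Hc Hd i j Hi Hj.
  destruct i as [|[|i]]; [| |lia]; (destruct j as [|[|j]]; [| |lia]); assumption.
Qed.

Lemma cmat_minv (F : T -> M2) (x : T) : continuous_mat F x -> mdet (F x) <> 0 ->
  continuous_mat (fun y => minv (F y)) x.
Proof.
  intros HF H0 i j Hi Hj. unfold minv.
  assert (HM : continuous_mat
    (fun y => mat2 (coef (F y) 1 1) (- coef (F y) 0 1) (- coef (F y) 1 0) (coef (F y) 0 0)) x).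
  { apply cmat_mat2; [|apply Rcont_opp|apply Rcont_opp|]; apply HF; lia. }
  apply (continuous_ext (fun y => / mdet (F y) *
    coef (mat2 (coef (F y) 1 1) (- coef (F y) 0 1) (- coef (F y) 1 0) (coef (F y) 0 0)) i j)).
  - intros y. rewrite coef_mscal by assumption. reflexivity.
  - apply Rcont_mult; [apply Rcont_inv; [apply cmat_mdet, HF|exact H0]|]. apply HM; assumption.
Qed.

Lemma cmat_mulC (g : T -> C) (x : T) : Ccont g x ->
  continuous_mat (fun y => lin_mat (fun v => (g y * v)%C)) x.
Proof.
  intros Hg. unfold lin_mat.
  assert (H1 : Ccont (fun y => (g y * RtoC 1)%C) x) by (apply Ccont_mult; [exact Hg|apply Ccont_const]).
  assert (H2 : Ccont (fun y => (g y * Ci)%C) x) by (apply Ccont_mult; [exact Hg|apply Ccont_const]).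
  exact (cmat_mat2 _ _ _ _ x (Ccont_Re _ _ H1) (Ccont_Re _ _ H2) (Ccont_Im _ _ H1) (Ccont_Im _ _ H2)).
Qed.

Lemma cmat_ext_loc (F G : T -> M2) (x : T) : locally x (fun y => G y = F y) ->
  continuous_mat G x -> continuous_mat F x.
Proof.
  intros HL HG i j Hi Hj. apply continuous_ext_loc with (g := fun y => coef (G y) i j).
  - revert HL. apply filter_imp. intros y Hy. rewrite Hy. reflexivity.
  - apply HG; assumption.
Qed.

Lemma cmat_comp {S : UniformSpace} (F : S -> M2) (g : T -> S) (x : T) :
  continuous g x -> continuous_mat F (g x) -> continuous_mat (fun y => F (g y)) x.
Proof.
  intros Hg HF i j Hi Hj.
  apply (continuous_comp g (fun s => coef (F s) i j)); [exact Hg|]. apply HF; assumption.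
Qed.
End MatCont.

(** * Products of multiplications, rotations and the stretch *)

Section Products.
Context (K theta : R) (hK : 1 < K).

(** The common form of [Pi_] (g = alpha) and of the derivative of the iterates of [f0] (g =
    beta). *)
Fixpoint mult_prod (g : nat -> C) (n : nat) : M2 :=
  match n with
  | O => I2
  | S i => mmul (mmul (lin_mat (fun v => (g i * v)%C)) (Hmat K theta)) (mult_prod g i)
  end.

Fixpoint mod_prod (g : nat -> C) (n : nat) : R :=
  match n with O => 1 | S i => mod_prod g i * Cmod (g i) end.

Lemma mod_prod_pos (g : nat -> C) (n : nat) : (forall i, (i < n)%nat -> g i <> RtoC 0) -> 0 < mod_prod g n.
Proof.
  induction n as [|n IH]; intros H; simpl; [lra|].
  apply Rmult_lt_0_compat; [apply IH; intros; apply H; lia|]. apply Cmod_gt_0, H. lia.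
Qed.

Lemma mdet_rot_prod (u : nat -> R) (n : nat) : mdet (rot_prod K theta u n) = K ^ n.
Proof.
  induction n as [|n IH]; simpl; [apply mdet_I2|].
  rewrite !mdet_mmul, mdet_Rot, mdet_Hmat, IH. ring.
Qed.

Lemma cis_Arg (z : C) : z <> RtoC 0 -> (RtoC (Cmod z) * cis (Arg z))%C = z.
Proof.
  intros Hz. assert (Hp : 0 < Cmod z) by (apply Cmod_gt_0; exact Hz).
  pose proof (Cmod_sqr z) as Hs.
  set (x := Re z / Cmod z).
  assert (Hx : x * x * Cmod z ^ 2 = Re z ^ 2) by (unfold x; field; lra).
  assert (Hc2 : 0 < Cmod z ^ 2) by nra.
  assert (Hx1 : -1 <= x <= 1).
  { assert (x * x <= 1) by nra. split; nra. }
  assert (Hsin : sin (acos x) = Rabs (Im z) / Cmod z).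
  { rewrite sin_acos by assumption.
    replace (1 - x²) with ((Rabs (Im z) / Cmod z) ^ 2).
    - apply sqrt_pow2. apply Rdiv_le_0_compat; [apply Rabs_pos|lra].
    - unfold Rdiv. rewrite Rpow_mult_distr, pow2_abs. unfold Rsqr.
      apply Rmult_eq_reg_r with (Cmod z ^ 2); [|lra].
      rewrite Rmult_minus_distr_r, Hx, Rmult_assoc, <- Rpow_mult_distr, Rinv_l, pow1 by lra.
      lra. }
  assert (HA : cos (Arg z) = x /\ sin (Arg z) = Im z / Cmod z).
  { unfold Arg. fold x. destruct (Rle_dec 0 (Im z)) as [Hi|Hi].
    - rewrite cos_acos, Hsin, Rabs_pos_eq by assumption. split; reflexivity.
    - rewrite cos_neg, sin_neg, cos_acos, Hsin, Rabs_left by (assumption || lra).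
      split; [reflexivity|field; lra]. }
  destruct HA as [H1 H2]. unfold cis. rewrite H1, H2. unfold x.
  apply C_ext; unfold Re, Im, Cmult, RtoC; cbn [fst snd]; field; lra.
Qed.

Lemma cis_plus (s t : R) : cis (s + t) = (cis s * cis t)%C.
Proof.
  unfold cis. rewrite cos_plus, sin_plus.
  apply C_ext; unfold Re, Im, Cmult; cbn [fst snd]; ring.
Qed.

Lemma cis_principal (t : R) : cis (principal_value t) = cis t.
Proof.
  unfold principal_value.
  assert (H : cis t <> RtoC 0).
  { intros E. pose proof (Cmod_cis t) as H. rewrite E, Cmod_0 in H. lra. }
  rewrite <- (cis_Arg (cis t) H) at 2. rewrite Cmod_cis. ring.
Qed.

(** Positive scalars pass through the real-linear [h], rotations do not; so exactly the moduli can
    be collected in front. *)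
Lemma mult_prod_rot (g : nat -> C) (n : nat) : (forall i, (i < n)%nat -> g i <> RtoC 0) ->
  mult_prod g n = mscal (mod_prod g n) (rot_prod K theta (fun i => Arg (g i)) n).
Proof.
  induction n as [|n IH]; intros H.
  - apply mat_ext; simpl; mcoef; ring.
  - simpl. rewrite IH by (intros; apply H; lia).
    apply act_ext. intros z.
    rewrite !act_mmul, !act_mscal, !act_mmul, act_mulC, act_Rot, !act_Hmat, h_scal, RtoC_mult.
    rewrite <- (cis_Arg (g n)) at 1 by (apply H; lia). ring.
Qed.

Lemma mult_prod_det (g : nat -> C) (n : nat) : (forall i, (i < n)%nat -> g i <> RtoC 0) ->
  mdet (mult_prod g n) <> 0.
Proof.
  intros H. rewrite mult_prod_rot by assumption. rewrite mdet_mscal, mdet_rot_prod.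
  pose proof (mod_prod_pos g n H).
  assert (0 < K ^ n) by (apply pow_lt; lra). assert (0 < mod_prod g n ^ 2) by (apply pow_lt; lra).
  nra.
Qed.

Lemma bnd_I2 : bnd I2 1.
Proof. intros z. rewrite act_I2. lra. Qed.

Lemma bnd_rot_prod (u : nat -> R) (n : nat) : bnd (rot_prod K theta u n) (K ^ n).
Proof.
  induction n as [|n IH]; simpl; [apply bnd_I2|].
  assert (0 <= K ^ n) by (apply pow_le; lra).
  apply bnd_mmul; [lra| |exact IH].
  intros z. rewrite act_mmul, act_Rot, act_Hmat, Cmod_mult, Cmod_cis, Rmult_1_l. apply h_le, hK.
Qed.

Lemma rot_prod_ge (u : nat -> R) (n : nat) (z : C) : Cmod z <= Cmod (mat_act (rot_prod K theta u n) z).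
Proof.
  induction n as [|n IH]; simpl; [rewrite act_I2; lra|].
  rewrite !act_mmul, act_Rot, act_Hmat, Cmod_mult, Cmod_cis, Rmult_1_l.
  eapply Rle_trans; [exact IH|]. apply h_ge, hK.
Qed.

Lemma rot_prod_det (u : nat -> R) (n : nat) : mdet (rot_prod K theta u n) <> 0.
Proof. rewrite mdet_rot_prod. apply pow_nonzero. lra. Qed.

(** No factor shrinks a vector, so inverse products cost nothing; in a conjugation only the forward
    product costs K^n. *)
Lemma bnd_rot_prod_inv (u : nat -> R) (n : nat) : bnd (minv (rot_prod K theta u n)) 1.
Proof.
  intros z. pose proof (rot_prod_ge u n (mat_act (minv (rot_prod K theta u n)) z)) as H.
  rewrite minv_r in H by apply rot_prod_det. lra.
Qed.

Lemma Hmat_det : mdet (Hmat K theta) <> 0.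
Proof. rewrite mdet_Hmat. lra. Qed.

Lemma bnd_Hmat_inv : bnd (minv (Hmat K theta)) 1.
Proof.
  intros z. pose proof (h_ge K theta hK (mat_act (minv (Hmat K theta)) z)) as H.
  rewrite <- act_Hmat, minv_r in H by apply Hmat_det. lra.
Qed.

Lemma minv_mscal (t : R) (A : M2) : t <> 0 -> mdet A <> 0 -> minv (mscal t A) = mscal (/ t) (minv A).
Proof.
  intros Ht HA. unfold minv. rewrite mdet_mscal. apply mat_ext; mcoef; field; split; assumption.
Qed.

Lemma diffat_iter_f0 (n : nat) (w : C) :
  diffat (Nat.iter n (f0 K theta)) w (mult_prod (beta K theta w) n).
Proof.
  induction n as [|n IH]; simpl; [apply diffat_id|].
  apply diffat_addconst. apply (diffat_hsqr K theta hK _ _ _ IH).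
Qed.

(** The chain rule for P_(n+1)(c) = h(P_n(c))^2 + c, the identity being the contribution of the
    explicit c. *)
Fixpoint DP (c : C) (n : nat) : M2 :=
  match n with
  | O => I2
  | S i => madd (mmul (mmul (Amat K theta c i) (Hmat K theta)) (DP c i)) I2
  end.

Lemma diffat_P (n : nat) (c : C) : diffat (P K theta n) c (DP c n).
Proof.
  induction n as [|n IH]; [apply diffat_id|].
  apply diffat_plus; [|apply diffat_id]. apply (diffat_hsqr K theta hK _ _ _ IH).
Qed.

Lemma Pi_mult_prod (c : C) (n : nat) : Pi_ K theta c n = mult_prod (alpha K theta c) n.
Proof. induction n as [|n IH]; [reflexivity|]. simpl. rewrite IH. reflexivity. Qed.

Lemma R_S (c : C) (n : nat) : R_ K theta c (S n) = madd (R_ K theta c n) (minv (Pi_ K theta c (S n))).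
Proof.
  unfold R_, msum. rewrite sum_n_Sm by lia. unfold madd. rewrite plus_assoc. reflexivity.
Qed.

Lemma R_O (c : C) : R_ K theta c 0 = I2.
Proof.
  unfold R_, msum. rewrite sum_n_m_zero by lia. unfold madd. apply plus_zero_r.
Qed.

(** Divided by [Pi_] at n + 1, the recursion of [DP] becomes the addition of one term to [R_]. *)
Lemma DP_R (c : C) (n : nat) : (forall i, (i < n)%nat -> alpha K theta c i <> RtoC 0) ->
  DP c n = mmul (Pi_ K theta c n) (R_ K theta c n).
Proof.
  induction n as [|n IH]; intros H.
  - rewrite R_O. apply mat_ext; simpl; mcoef; ring.
  - assert (Hd : mdet (Pi_ K theta c (S n)) <> 0).
    { rewrite Pi_mult_prod. apply mult_prod_det, H. }
    rewrite R_S. apply act_ext. intros z.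
    rewrite act_mmul, act_madd, act_plus, minv_r by assumption.
    simpl DP. rewrite act_madd, act_I2, IH by (intros; apply H; lia).
    simpl Pi_. rewrite !act_mmul. reflexivity.
Qed.

Lemma cmat_mult_prod {T : UniformSpace} (g : T -> nat -> C) (n : nat) (x : T) :
  (forall i, (i < n)%nat -> Ccont (fun y => g y i) x) ->
  continuous_mat (fun y => mult_prod (g y) n) x.
Proof.
  induction n as [|n IH]; intros H; simpl; [apply cmat_const|].
  apply cmat_mmul; [apply cmat_mmul; [apply cmat_mulC, H; lia|apply cmat_const]|].
  apply IH. intros; apply H; lia.
Qed.

Lemma cmat_DP {T : UniformSpace} (g : T -> C) (n : nat) (x : T) :
  Ccont g x -> continuous_mat (fun y => DP (g y) n) x.
Proof.
  intros Hg. induction n as [|n IH]; simpl; [apply cmat_const|].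
  apply cmat_madd; [|apply cmat_const]. apply cmat_mmul; [|exact IH].
  apply cmat_mmul; [|apply cmat_const]. unfold Amat. apply cmat_mulC. unfold alpha.
  apply Ccont_mult; [apply Ccont_const|]. apply Ccont_h. apply Ccont_P, Hg.
Qed.
End Products.

(** * Differentiating f_0^n(Psi) = Q_n *)

Section PlaneDerivative.
Context (K theta : R) (hK : 1 < K).
Context (rho : C -> R) (psi psi_ext : C -> C -> C).
Hypothesis hpsi : forall c, is_bottcher K theta c (exterior_disc (rho c)) (psi c).
Hypothesis hext : forall c, ~ Mset K theta c ->
  is_bottcher_extension K theta c (exterior_disc (rho c)) (psi c) (psi_ext c).
Context (a C' : R) (ha : 1 <= a).
Hypothesis hest : bottcher_estimates rho psi a C'.
Notation f := (fc K theta).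
Notation h := (h K theta).
Notation P := (P K theta).
Notation f0 := (f0 K theta).
Notation Dstrict := (Dstrict a).
Notation Psi := (Psi psi_ext).

(** Passing through 0 would bring the orbit back to c = P_0. *)
Lemma orbit_neq_0 (c : C) (i : nat) : ~ Mset K theta c -> P i c <> RtoC 0.
Proof.
  intros hc E. apply (orbit_neq K theta c hc (S i) 0); [lia|].
  rewrite P_S, E. apply fc_0.
Qed.

Lemma alpha_neq_0 (c : C) (i : nat) : ~ Mset K theta c -> alpha K theta c i <> RtoC 0.
Proof.
  intros hc. apply Cmult_neq_0; [intros E; apply RtoC_inj in E; lra|].
  intros E. apply (h_eq_0 K theta hK) in E. exact (orbit_neq_0 c i hc E).
Qed.

Lemma w_orbit (c : C) (j : nat) : ~ Mset K theta c -> rho c < Cmod (P j c) ->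
  Nat.iter j f0 (Psi c) = psi c (P j c).
Proof.
  intros hc Hj. destruct (hext c hc) as [n [HA [_ [HEU [_ [_ HEf]]]]]].
  assert (HEn : forall k, exterior_disc (rho c) (Nat.iter n (f c) (P k c)) /\
    Nat.iter k f0 (psi_ext c c) = psi_ext c (P k c)).
  { induction k as [|k [I1 I2]]; [split; [exact HA|reflexivity]|]. split.
    - rewrite P_S, <- iter_shift. simpl. apply (bott_inv K theta c _ _ (hpsi c)). exact I1.
    - simpl. rewrite I2. symmetry. apply HEf, I1. }
  unfold Defs.Psi. rewrite (proj2 (HEn j)). apply HEU, Hj.
Qed.

(** 0 is fixed by [f0], so a zero would persist to times at which w_j is a value of [psi]. *)
Lemma w_neq_0 (c : C) (j : nat) : ~ Mset K theta c -> w_ K theta (Psi c) j <> RtoC 0.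
Proof.
  intros hc E. destruct (escapes_large K theta c hc (rho c)) as [N HN].
  specialize (HN (N + j)%nat ltac:(lia)).
  pose proof (w_orbit c (N + j) hc HN) as H. rewrite iter_plus in H.
  unfold w_ in E. rewrite E in H.
  apply (bott_neq_0 K theta hK c _ _ (hpsi c) hc _ HN). rewrite <- H.
  clear. induction N as [|N IH]; [reflexivity|]. simpl. rewrite IH. apply fc_0.
Qed.

Lemma beta_neq_0 (c : C) (i : nat) : ~ Mset K theta c -> beta K theta (Psi c) i <> RtoC 0.
Proof.
  intros hc. apply Cmult_neq_0; [intros E; apply RtoC_inj in E; lra|].
  intros E. apply (h_eq_0 K theta hK) in E. exact (w_neq_0 c i hc E).
Qed.

Definition DQ (c : C) (n : nat) : M2 :=
  madd (D_c psi (c, P n c)) (mmul (D_z psi (c, P n c)) (DP K theta c n)).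

Lemma diffat_Q (c : C) (n : nat) : Dstrict c (P n c) -> diffat (Q K theta psi n) c (DQ c n).
Proof.
  intros HD eps Heps.
  destruct (proj1 (proj2 hest) (c, P n c) (Dstrict_Dint a _ _ HD)) as [Hfd _].
  pose proof (diffat_P K theta hK n c) as HP.
  destruct (bnd_ex (DP K theta c n)) as [M [HM HMb]].
  destruct (bnd_ex (D_z psi (c, P n c))) as [Z [HZ HZb]].
  (* The joint increment has norm at most |v| + |G| <= (2 + M) |v|. *)
  set (e1 := eps / (2 * (2 + M))). assert (He1 : 0 < e1) by (apply Rdiv_lt_0_compat; lra).
  destruct Hfd as [_ Hfd].
  specialize (Hfd (c, P n c) (fun Q H => H) (mkposreal _ He1)). destruct Hfd as [d1 Hd1].
  set (e2 := Rmin 1 (eps / (2 * Z))). assert (He2 : 0 < e2).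
  { apply Rmin_pos; [lra|apply Rdiv_lt_0_compat; lra]. }
  destruct (HP e2 He2) as [d2 [Hd2 HP2]].
  destruct (diffat_cont _ _ _ HP d1 (cond_pos d1)) as [d3 [Hd3 HP3]].
  exists (Rmin d1 (Rmin d2 d3)). split.
  { apply Rmin_pos; [apply cond_pos|apply Rmin_pos; assumption]. }
  intros v Hv.
  pose proof (Rlt_le_trans _ _ _ Hv (Rmin_l _ _)) as Hv1.
  pose proof (Rlt_le_trans _ _ _ (Rlt_le_trans _ _ _ Hv (Rmin_r _ _)) (Rmin_l _ _)) as Hv2.
  pose proof (Rlt_le_trans _ _ _ (Rlt_le_trans _ _ _ Hv (Rmin_r _ _)) (Rmin_r _ _)) as Hv3.
  specialize (HP2 v Hv2). specialize (HP3 v Hv3). pose proof (HMb v) as HMv.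
  set (G := (P n (c + v) - P n c)%C) in *. set (r := (G - mat_act (DP K theta c n) v)%C) in *.
  assert (HG : Cmod G <= (1 + M) * Cmod v).
  { replace G with (r + mat_act (DP K theta c n) v)%C by (unfold r; ring).
    eapply Rle_trans; [apply Cmod_triangle|].
    pose proof (Rmin_l 1 (eps / (2 * Z))). fold e2 in H. pose proof (Cmod_ge_0 v). nra. }
  specialize (Hd1 ((c + v)%C, P n (c + v)%C)).
  assert (Hball : @ball CC (c, P n c) d1 ((c + v)%C, P n (c + v)%C)).
  { split; apply Cmod_ball; simpl.
    - replace (c + v - c)%C with v by ring. exact Hv1.
    - exact HP3. }
  specialize (Hd1 Hball).
  set (A1 := D_c psi (c, P n c)) in *. set (A2 := D_z psi (c, P n c)) in *.
  assert (Hb : Cmod (psi (c + v)%C (P n (c + v)%C) - psi c (P n c) - (mat_act A1 v + mat_act A2 G))%C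
    <= e1 * (Cmod v + Cmod G)).
  { assert (Hn : @norm R_AbsRing (prod_NormedModule R_AbsRing C_R_NormedModule C_R_NormedModule) (v, G)
      <= Cmod v + Cmod G).
    { change (sqrt (@norm R_AbsRing C_R_NormedModule v ^ 2 + @norm R_AbsRing C_R_NormedModule G ^ 2)
        <= Cmod v + Cmod G). rewrite !norm_Cmod.
      pose proof (Cmod_ge_0 v). pose proof (Cmod_ge_0 G).
      rewrite <- (sqrt_pow2 (Cmod v + Cmod G)) by lra. apply sqrt_le_1; nra. }
    rewrite norm_Cmod in Hd1.
    assert (Em : (@minus (prod_NormedModule R_AbsRing C_R_NormedModule C_R_NormedModule)
       ((c + v)%C, P n (c + v)%C) (c, P n c)) = (v, G)).
    { change ((((c + v) - c)%C, G) = (v, G)). f_equal. ring. }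
    rewrite Em in Hd1.
    change (Cmod (psi (c + v)%C (P n (c + v)%C) - psi c (P n c) - (mat_act A1 v + mat_act A2 G))%C
      <= e1 * @norm R_AbsRing (prod_NormedModule R_AbsRing C_R_NormedModule C_R_NormedModule) (v, G)) in Hd1.
    eapply Rle_trans; [exact Hd1|]. apply Rmult_le_compat_l; lra. }
  unfold Q, DQ. rewrite act_madd, act_mmul. fold A1 A2.
  replace (psi (c + v) (P n (c + v)) - psi c (P n c) - (mat_act A1 v + mat_act A2 (mat_act (DP K theta c n) v)))%C
    with ((psi (c + v)%C (P n (c + v)%C) - psi c (P n c) - (mat_act A1 v + mat_act A2 G)) + mat_act A2 r)%C.
  2:{ unfold r. rewrite act_minus. ring. }
  eapply Rle_trans; [apply Cmod_triangle|].
  pose proof (Cmod_ge_0 v) as Hv0.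
  assert (S1 : e1 * (Cmod v + Cmod G) <= eps / 2 * Cmod v).
  { apply Rle_trans with (e1 * ((2 + M) * Cmod v)); [apply Rmult_le_compat_l; lra|].
    right. unfold e1. field. lra. }
  assert (S2 : Cmod (mat_act A2 r) <= eps / 2 * Cmod v).
  { eapply Rle_trans; [apply HZb|]. apply Rle_trans with (Z * (e2 * Cmod v)).
    - apply Rmult_le_compat_l; lra.
    - apply Rle_trans with (Z * (eps / (2 * Z) * Cmod v)).
      + apply Rmult_le_compat_l; [lra|]. apply Rmult_le_compat_r; [lra|]. apply Rmin_r.
      + right. field. lra. }
  lra.
Qed.

(** Two times are involved: a late [N] certifies escape through [notM_of_large], while the given [n]
    is kept for the estimates. *)
Lemma escape_open (c : C) (n : nat) : ~ Mset K theta c -> Dstrict c (P n c) ->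
  @locally C_UniformSpace c (fun c' => ~ Mset K theta c' /\ Dstrict c' (P n c')).
Proof.
  intros hc HD.
  destruct (escapes_large K theta c hc (Rmax 4 (Cmod c))) as [N HN]. specialize (HN N (le_n N)).
  assert (H1 : 4 < Cmod (P N c)) by (eapply Rle_lt_trans; [apply Rmax_l|exact HN]).
  assert (H2 : Cmod c < Cmod (P N c)) by (eapply Rle_lt_trans; [apply Rmax_r|exact HN]).
  assert (Hid : @continuous C_UniformSpace C_UniformSpace (fun y => y) c) by apply continuous_id.
  assert (HPc : forall k, @continuous C_UniformSpace R_UniformSpace (fun y => Cmod (P k y)) c).
  { intros k. apply (@Rcont_Cmod C_UniformSpace), (@Ccont_P K theta C_UniformSpace). exact Hid. }
  assert (L : @locally C_UniformSpace c (fun c' => 4 < Cmod (P N c') /\ Cmod c' < Cmod (P N c') /\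
    a * sqrt (1 + Cmod c') < Cmod (P n c'))).
  { apply filter_and; [|apply filter_and]; apply (@locally_lt C_UniformSpace); try apply HPc; try assumption.
    - apply (@Rcont_const C_UniformSpace).
    - apply (@Rcont_Cmod C_UniformSpace); exact Hid.
    - apply (@Rcont_Dbound a C_UniformSpace); exact Hid. }
  revert L. apply filter_imp. intros c' [A1 [A2 A3]]. split; [|exact A3].
  apply (notM_of_large K theta hK c' N); lra.
Qed.

Definition DPsi (c : C) (n : nat) : M2 :=
  mmul (minv (mult_prod K theta (beta K theta (Psi c)) n)) (DQ c n).

Lemma diffat_Psi (c : C) (n : nat) : ~ Mset K theta c -> Dstrict c (P n c) -> diffat Psi c (DPsi c n).
Proof.
  intros hc HD.
  apply (diffat_implicit (Nat.iter n f0) Psi (Q K theta psi n)).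
  - apply diffat_iter_f0, hK.
  - apply mult_prod_det; [exact hK|]. intros i _. apply beta_neq_0, hc.
  - apply diffat_Q, HD.
  - exact (Psi_cont K theta hK rho psi psi_ext hpsi hext a C' ha hest c hc).
  - generalize (escape_open c n hc HD). apply filter_imp. intros c' [H1 H2].
    apply w_orbit; [exact H1|]. apply (Dstrict_ext rho psi a C' hest), H2.
Qed.

(** One fixed [n] serves a whole neighbourhood, where the derivative is therefore a formula with
    continuous entries. *)
Lemma DPsi_cont (c : C) (n : nat) : ~ Mset K theta c -> Dstrict c (P n c) ->
  @continuous_mat C_UniformSpace (Dmat Psi) c.
Proof.
  intros hc HD.
  assert (Hid : @continuous C_UniformSpace C_UniformSpace (fun y => y) c) by apply continuous_id.
  apply (@cmat_ext_loc C_UniformSpace) with (G := fun c' => DPsi c' n).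
  - generalize (escape_open c n hc HD). apply filter_imp. intros c' [H1 H2].
    symmetry. apply diffat_Dmat, diffat_Psi; assumption.
  - unfold DPsi. apply (@cmat_mmul C_UniformSpace).
    + apply (@cmat_minv C_UniformSpace).
      * apply (@cmat_mult_prod K theta C_UniformSpace). intros i _. unfold beta, w_.
        apply (@Ccont_mult C_UniformSpace); [apply (@Ccont_const C_UniformSpace)|].
        apply (@Ccont_h C_UniformSpace).
        apply (@Ccont_iter C_UniformSpace K theta i (fun _ => RtoC 0)); [apply (@Ccont_const C_UniformSpace)|].
        exact (Psi_cont K theta hK rho psi psi_ext hpsi hext a C' ha hest c hc).
      * apply mult_prod_det; [exact hK|]. intros i _. apply beta_neq_0, hc.
    + destruct (proj1 (proj2 hest) (c, P n c) (Dstrict_Dint a _ _ HD)) as [_ [HDc HDz]].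
      assert (Hpair : @continuous C_UniformSpace CC (fun c' => (c', P n c')) c).
      { pose proof (@Ccont_P K theta C_UniformSpace n (fun y => y) c Hid) as HPn.
        intros S [eps HS].
        assert (L1 := Hid _ (locally_ball (T := C_UniformSpace) c eps)).
        assert (L2 := HPn _ (locally_ball (T := C_UniformSpace) (P n c) eps)).
        unfold filtermap in *. generalize (filter_and _ _ L1 L2). apply filter_imp.
        intros y [U V]. apply HS. split; assumption. }
      unfold DQ. apply (@cmat_madd C_UniformSpace); [|apply (@cmat_mmul C_UniformSpace)].
      * exact (@cmat_comp C_UniformSpace CC (D_c psi) _ c Hpair HDc).
      * exact (@cmat_comp C_UniformSpace CC (D_z psi) _ c Hpair HDz).
      * apply (@cmat_DP K theta C_UniformSpace). exact Hid.
Qed.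

Lemma Psi_C1 (c : C) (n : nat) : ~ Mset K theta c -> Dstrict c (P n c) -> C1_near Psi c.
Proof.
  intros hc HD. unfold C1_near. generalize (escape_open c n hc HD). apply filter_imp.
  intros c' [H1 H2]. split.
  - exact (diffat_differentiable _ _ _ (diffat_Psi c' n H1 H2)).
  - exact (DPsi_cont c' n H1 H2).
Qed.
End PlaneDerivative.

(** * Limits *)

Lemma half_pow_pos (i : nat) : 0 < (/ 2) ^ i.
Proof. apply pow_lt. lra. Qed.

Lemma ex_series_half (T : R) : ex_series (fun i => T * (/ 2) ^ i).
Proof.
  apply (@ex_series_scal R_AbsRing R_NormedModule T (fun i => (/ 2) ^ i)). apply ex_series_geom. rewrite Rabs_pos_eq; lra.
Qed.

Lemma Series_half (T : R) : Series (fun i => T * (/ 2) ^ i) = 2 * T.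
Proof.
  rewrite Series_scal_l, Series_geom by (rewrite Rabs_pos_eq; lra). field.
Qed.

Lemma series_geom_tail (m : nat) (u : nat -> R) (M T : R) :
  (forall n, 0 <= u n) -> (forall n, (n < m)%nat -> u n <= M) ->
  (forall i, u (i + m)%nat <= T * (/ 2) ^ i) ->
  ex_series u /\ Series u <= INR m * M + 2 * T.
Proof.
  revert u. induction m as [|m IH]; intros u H0 HM HT.
  - assert (Hle : forall n, 0 <= u n <= T * (/ 2) ^ n).
    { intros n. split; [apply H0|]. specialize (HT n). rewrite Nat.add_0_r in HT. exact HT. }
    split.
    + apply (ex_series_le u (fun i => T * (/ 2) ^ i)); [|apply ex_series_half].
      intros n. change (Rabs (u n) <= T * (/ 2) ^ n). rewrite Rabs_pos_eq; apply Hle.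
    + simpl INR. rewrite Rmult_0_l, Rplus_0_l, <- Series_half.
      apply Series_le; [exact Hle|apply ex_series_half].
  - destruct (IH (fun n => u (S n))) as [I1 I2].
    + intros; apply H0.
    + intros n Hn; apply HM; lia.
    + intros i. replace (S (i + m)) with (i + S m)%nat by lia. apply HT.
    + apply ex_series_incr_1 in I1. split; [exact I1|].
      rewrite Series_incr_1 by exact I1. rewrite S_INR.
      pose proof (HM 0%nat ltac:(lia)). lra.
Qed.

Lemma seq_geom_conv (m : nat) (u : nat -> R) (T : R) :
  (forall i, Rabs (u (S (i + m)) - u (i + m)%nat) <= T * (/ 2) ^ i) -> ex_finite_lim_seq u.
Proof.
  intros H.
  set (d := fun i => u (S (i + m)) - u (i + m)%nat).
  assert (Hd : ex_series d).
  { apply (ex_series_le d (fun i => T * (/ 2) ^ i)); [exact H|apply ex_series_half]. }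
  destruct Hd as [l Hl].
  assert (Hs : forall n, sum_n d n = u (S n + m)%nat - u m).
  { induction n as [|n IH].
    - rewrite sum_O. reflexivity.
    - rewrite sum_Sn, IH. unfold plus, d; simpl. ring. }
  exists (l + u m). apply (is_lim_seq_incr_n u (S m)).
  apply is_lim_seq_ext with (fun n => sum_n d n + u m).
  - intros n. rewrite Hs. replace (n + S m)%nat with (S n + m)%nat by lia. ring.
  - apply is_lim_seq_plus'; [exact Hl|apply is_lim_seq_const].
Qed.

Lemma lim_seq_bounded (u : nat -> R) (l : R) : is_lim_seq u l -> exists M, forall n, Rabs (u n) <= M.
Proof.
  intros H. apply is_lim_seq_Reals in H.
  assert (Hc : { l : R | Un_cv u l }) by (exists l; exact H).
  destruct (maj_by_pos u Hc) as [M [_ HM]]. exists M. exact HM.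
Qed.

Lemma lim_geom_0 (m : nat) (u : nat -> R) (T : R) :
  (forall i, Rabs (u (i + m)%nat) <= T * (/ 2) ^ i) -> is_lim_seq u 0.
Proof.
  intros H. apply (is_lim_seq_incr_n u m).
  apply is_lim_seq_abs_0.
  apply is_lim_seq_le_le with (fun _ => 0) (fun i => T * (/ 2) ^ i).
  - intros i. split; [apply Rabs_pos|apply H].
  - apply is_lim_seq_const.
  - replace (Finite 0) with (Rbar_mult T 0) by (simpl; f_equal; ring).
    apply is_lim_seq_scal_l. apply is_lim_seq_geom. rewrite Rabs_pos_eq; lra.
Qed.

Lemma least_nat (Q : nat -> Prop) (n : nat) : Q n -> exists m, Q m /\ forall i, (i < m)%nat -> ~ Q i.
Proof.
  revert Q. induction n as [|n IH]; intros Q Hn.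
  - exists O. split; [exact Hn|]. intros; lia.
  - destruct (classic (Q O)) as [H0|H0].
    + exists O. split; [exact H0|]. intros; lia.
    + destruct (IH (fun k => Q (S k)) Hn) as [m [Hm Hmin]].
      exists (S m). split; [exact Hm|]. intros [|i] Hi; [exact H0|]. apply Hmin. lia.
Qed.

(** Apply ln x <= x - 1 to q and to 1 / q. *)
Lemma ln_near_1 (q e : R) : Rabs (q - 1) <= e -> e <= / 2 -> Rabs (ln q) <= 2 * e.
Proof.
  intros Hq He. apply Rabs_le_between in Hq.
  assert (Hpos : 0 < q) by lra.
  assert (Hln : forall x, 0 < x -> ln x <= x - 1).
  { intros x Hx. destruct (Req_dec (ln x) 0) as [E|E].
    - rewrite E. assert (x = 1) by (rewrite <- (exp_ln x Hx), E; apply exp_0). lra.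
    - pose proof (exp_ineq1 (ln x) E) as H. rewrite exp_ln in H by exact Hx. lra. }
  pose proof (Hln q Hpos) as H1.
  pose proof (Hln (/ q) (Rinv_0_lt_compat q Hpos)) as H2. rewrite ln_Rinv in H2 by exact Hpos.
  assert (/ q - 1 <= 2 * e).
  { apply Rmult_le_reg_r with q; [exact Hpos|]. rewrite Rmult_minus_distr_r, Rinv_l by lra.
    assert (0 <= e * (2 * q - 1)) by (apply Rmult_le_pos; lra). lra. }
  apply Rabs_le. lra.
Qed.

Lemma act_wirtinger (A : M2) (v : C) : mat_act A v = (wd A * v + wdbar A * Cconj v)%C.
Proof.
  unfold wd, wdbar.
  transitivity (RtoC (Re v) * mat_act A (RtoC 1) + RtoC (Im v) * mat_act A Ci)%C.
  - mact; ring.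
  - set (p := mat_act A (RtoC 1)). set (q := mat_act A Ci).
    apply C_ext; unfold Re, Im, Cdiv, Cminus, Cplus, Cmult, Copp, Cconj, Cinv, RtoC, Ci; cbn [fst snd]; field.
Qed.

Lemma bnd_wirtinger (A : M2) (s t : R) : Cmod (wd A) <= s -> Cmod (wdbar A) <= t -> bnd A (s + t).
Proof.
  intros Hs Ht z. rewrite act_wirtinger. eapply Rle_trans; [apply Cmod_triangle|].
  rewrite !Cmod_mult, Cmod_conj. pose proof (Cmod_ge_0 z). nra.
Qed.

Lemma wd_msub_I2 (A : M2) : wd (msub A I2) = (wd A - RtoC 1)%C /\ wdbar (msub A I2) = wdbar A.
Proof.
  unfold wd, wdbar. rewrite !act_msub, !act_I2.
  assert (Hi : (Ci * Ci)%C = (- RtoC 1)%C) by (apply C_ext; unfold Re, Im, Ci, Cmult, Copp, RtoC; cbn [fst snd]; ring).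
  assert (H2' : (RtoC 2 = RtoC 1 + RtoC 1)%C) by (apply C_ext; simpl; ring).
  set (p := mat_act A (RtoC 1)). set (q := mat_act A Ci).
  split.
  - replace (p - RtoC 1 - Ci * (q - Ci))%C with (p - Ci * q - RtoC 1 + Ci * Ci)%C by ring.
    rewrite Hi. replace (p - Ci * q - RtoC 1 + - RtoC 1)%C with (p - Ci * q - RtoC 2)%C by (rewrite H2'; ring).
    field.
  - replace (p - RtoC 1 + Ci * (q - Ci))%C with (p + Ci * q - RtoC 1 - Ci * Ci)%C by ring.
    rewrite Hi. f_equal. ring.
Qed.

Lemma bnd_madd (A B : M2) (M N : R) : bnd A M -> bnd B N -> bnd (madd A B) (M + N).
Proof.
  intros HA HB z. rewrite act_madd. eapply Rle_trans; [apply Cmod_triangle|].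
  pose proof (HA z). pose proof (HB z). lra.
Qed.

Lemma bnd_mscal (t : R) (A : M2) (M : R) : bnd A M -> bnd (mscal t A) (Rabs t * M).
Proof.
  intros HA z. rewrite act_mscal, Cmod_RtoC_mult, Rmult_assoc.
  apply Rmult_le_compat_l; [apply Rabs_pos|apply HA].
Qed.

Lemma bnd_of_coefs (A : M2) (M : R) :
  (forall i j, (i < 2)%nat -> (j < 2)%nat -> Rabs (coef A i j) <= M) -> bnd A (4 * M).
Proof.
  intros H z.
  assert (E : mat_act A z = (RtoC (Re z) * (coef A 0 0, coef A 1 0) + RtoC (Im z) * (coef A 0 1, coef A 1 1))%C)
    by (mact; ring).
  pose proof (Rmax_Cmod z) as Hz.
  pose proof (Rle_trans _ _ _ (Rmax_l _ _) Hz) as Hz1. pose proof (Rle_trans _ _ _ (Rmax_r _ _) Hz) as Hz2.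
  assert (Hc : forall p q : R, Rabs p <= M -> Rabs q <= M -> Cmod (p, q) <= 2 * M).
  { intros p q Hp Hq. apply Cmod_le_of_sqr; [pose proof (Rabs_pos p); lra|]. simpl Re; simpl Im.
    rewrite <- (pow2_abs p), <- (pow2_abs q). pose proof (Rabs_pos p). pose proof (Rabs_pos q). nra. }
  pose proof (Hc _ _ (H 0%nat 0%nat ltac:(lia) ltac:(lia)) (H 1%nat 0%nat ltac:(lia) ltac:(lia))) as H1.
  pose proof (Hc _ _ (H 0%nat 1%nat ltac:(lia) ltac:(lia)) (H 1%nat 1%nat ltac:(lia) ltac:(lia))) as H2.
  rewrite E. eapply Rle_trans; [apply Cmod_triangle|]. rewrite !Cmod_RtoC_mult.
  pose proof (Cmod_ge_0 (coef A 0 0, coef A 1 0)). pose proof (Cmod_ge_0 (coef A 0 1, coef A 1 1)).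
  change (fst z) with (Re z) in *. change (snd z) with (Im z) in *.
  pose proof (Rabs_pos (Re z)). pose proof (Rabs_pos (Im z)).
  pose proof (Cmod_ge_0 z). nra.
Qed.

(** * Growth of the orbit and convergence *)

Section Limits.
Context (K theta : R) (hK : 1 < K).
Context (rho : C -> R) (psi psi_ext : C -> C -> C).
Hypothesis hpsi : forall c, is_bottcher K theta c (exterior_disc (rho c)) (psi c).
Hypothesis hext : forall c, ~ Mset K theta c ->
  is_bottcher_extension K theta c (exterior_disc (rho c)) (psi c) (psi_ext c).
Context (a C' : R) (ha : 1 <= a).
Hypothesis hest : bottcher_estimates rho psi a C'.
Context (c : C) (m : nat).
Hypothesis hc : ~ Mset K theta c.
Hypothesis hm : kappa K a C' c <= Cmod (P K theta m c).
Notation f := (fc K theta).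
Notation h := (h K theta).
Notation P := (P K theta).
Notation f0 := (f0 K theta).
Notation w := (Psi psi_ext c).
Notation x := (Cmod (P m c)).
Notation y := (fun i => Cmod (P (i + m) c)).
Notation al := (alpha K theta c).
Notation be := (beta K theta w).

Lemma x_bounds : Cmod c <= x /\ 4 <= x /\ 2 * K <= (x - 1) ^ 2 /\ 2 * K * C' <= x /\ a ^ 2 + 1 <= x.
Proof.
  unfold kappa, kappa0 in hm.
  pose proof (Rmax_l (Cmod c) (Rmax 4 (Rmax (1 + sqrt (2 * K)) (Rmax (2 * K * C') (a ^ 2 + 1))))).
  pose proof (Rmax_r (Cmod c) (Rmax 4 (Rmax (1 + sqrt (2 * K)) (Rmax (2 * K * C') (a ^ 2 + 1))))).
  pose proof (Rmax_l 4 (Rmax (1 + sqrt (2 * K)) (Rmax (2 * K * C') (a ^ 2 + 1)))).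
  pose proof (Rmax_r 4 (Rmax (1 + sqrt (2 * K)) (Rmax (2 * K * C') (a ^ 2 + 1)))).
  pose proof (Rmax_l (1 + sqrt (2 * K)) (Rmax (2 * K * C') (a ^ 2 + 1))).
  pose proof (Rmax_r (1 + sqrt (2 * K)) (Rmax (2 * K * C') (a ^ 2 + 1))).
  pose proof (Rmax_l (2 * K * C') (a ^ 2 + 1)).
  pose proof (Rmax_r (2 * K * C') (a ^ 2 + 1)).
  assert (Hs : sqrt (2 * K) * sqrt (2 * K) = 2 * K) by (apply sqrt_sqrt; lra).
  assert (Hs' : sqrt (2 * K) <= x - 1) by lra. pose proof (sqrt_pos (2 * K)).
  split; [lra|]. split; [lra|]. split; [|split; lra]. nra.
Qed.

(** Since |c| <= y_i, one step gives (y_i - 1)^2 <= y_(i+1) - 1. As (y_i - 1)^2 >= 2K, squaring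
    gains at least a factor 2K per step: K to pay for the distortion and 2 for summability. *)
Lemma y_growth (i : nat) : x <= y i /\ (x - 1) ^ 2 * (2 * K) ^ i <= (y i - 1) ^ 2.
Proof.
  destruct x_bounds as [Hc [H4 [HK2 _]]].
  induction i as [|i [IH1 IH2]]; [simpl; lra|].
  cbv beta in *. change (S i + m)%nat with (S (i + m)). rewrite P_S.
  set (z := Cmod (P (i + m) c)) in *.
  pose proof (Cmod_fc_ge K theta hK c (P (i + m) c)) as Hg. fold z in Hg.
  set (z' := Cmod (f c (P (i + m) c))) in *.
  assert (Hz : (z - 1) ^ 2 <= z' - 1) by nra.
  assert (H2K : 2 * K <= (z - 1) ^ 2) by nra.
  split; [nra|].
  apply Rle_trans with ((z - 1) ^ 2 * (z - 1) ^ 2).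
  - replace ((x - 1) ^ 2 * (2 * K) ^ S i) with ((2 * K) * ((x - 1) ^ 2 * (2 * K) ^ i))
      by (rewrite <- (tech_pow_Rmult (2 * K)); ring).
    apply Rmult_le_compat; [lra| |exact H2K|exact IH2].
    apply Rmult_le_pos; [nra|]. apply pow_le. lra.
  - assert (0 <= (z - 1) ^ 2) by nra. nra.
Qed.

Lemma y_geom (i : nat) : K ^ i / y i ^ 2 <= / (x - 1) ^ 2 * (/ 2) ^ i.
Proof.
  destruct (y_growth i) as [H1 H2]. destruct x_bounds as [_ [H4 _]]. cbv beta in *.
  set (z := Cmod (P (i + m) c)) in *.
  assert (Hx : 0 < (x - 1) ^ 2) by nra.
  assert (Hz : (x - 1) ^ 2 * (2 * K) ^ i <= z ^ 2) by nra.
  assert (HKi : 0 < K ^ i) by (apply pow_lt; lra).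
  assert (H2i : 0 < 2 ^ i) by (apply pow_lt; lra).
  rewrite Rpow_mult_distr in Hz.
  apply Rmult_le_reg_r with (z ^ 2); [nra|].
  unfold Rdiv. rewrite Rmult_assoc, Rinv_l, Rmult_1_r by nra.
  rewrite pow_inv.
  apply Rle_trans with (/ (x - 1) ^ 2 * / 2 ^ i * ((x - 1) ^ 2 * (2 ^ i * K ^ i))).
  - right. field. split; [lra|]. intros E. nra.
  - apply Rmult_le_compat_l; [|exact Hz].
    apply Rmult_le_pos; left; apply Rinv_0_lt_compat; assumption.
Qed.

(** From |c| <= x and a^2 <= x - 1 one gets a^2 (1 + |c|) <= x^2 - 1 < x^2. *)
Lemma Dstrict_m (i : nat) : Dstrict a c (P (i + m) c).
Proof.
  destruct (y_growth i) as [H1 _]. destruct x_bounds as [Hc [H4 [_ [_ Ha]]]]. cbv beta in *.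
  apply Rlt_le_trans with x; [|exact H1]. pose proof (Cmod_ge_0 c).
  assert (Hs : sqrt (1 + Cmod c) * sqrt (1 + Cmod c) = 1 + Cmod c) by (apply sqrt_sqrt; lra).
  pose proof (sqrt_pos (1 + Cmod c)) as Hp.
  apply Rsqr_incrst_0; [|nra|lra]. unfold Rsqr.
  replace (a * sqrt (1 + Cmod c) * (a * sqrt (1 + Cmod c))) with (a ^ 2 * (sqrt (1 + Cmod c) * sqrt (1 + Cmod c))) by ring.
  rewrite Hs. nra.
Qed.

Lemma w_close (i : nat) :
  Cmod (w_ K theta w (i + m) - P (i + m) c)%C <= C' * Cmod c / y i.
Proof.
  pose proof (Dstrict_m i) as HD.
  unfold w_. rewrite (w_orbit K theta rho psi psi_ext hpsi hext c (i + m) hc (Dstrict_ext rho psi a C' hest _ _ HD)).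
  apply (proj2 (proj2 (proj2 hest))). left. exact HD.
Qed.

(** The sign of [C'] is not among the hypotheses; it follows from the estimate at the escape time,
    because c is not 0. *)
Lemma C'_nonneg : 0 <= C'.
Proof.
  pose proof (w_close 0) as H. destruct x_bounds as [_ [H4 _]].
  pose proof (Cmod_ge_0 (w_ K theta w (0 + m) - P (0 + m) c)%C) as H0.
  assert (Hc : 0 < Cmod c) by (apply Cmod_gt_0, (notM_neq_0 K theta c hc)).
  cbv beta in H. change (0 + m)%nat with m in *. apply Rnot_lt_le. intros Hn.
  assert (C' * Cmod c / x < 0).
  { apply Rmult_neg_pos; [nra|]. apply Rinv_0_lt_compat; lra. }
  lra.
Qed.

Lemma hw_close (i : nat) :
  Cmod (h (P (i + m) c) - h (w_ K theta w (i + m)))%C <= K * (C' * Cmod c) / y i.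
Proof.
  rewrite <- h_minus. eapply Rle_trans; [apply (h_le K theta hK)|].
  unfold Rdiv. rewrite Rmult_assoc. apply Rmult_le_compat_l; [lra|].
  replace (P (i + m) c - w_ K theta w (i + m))%C with (- (w_ K theta w (i + m) - P (i + m) c))%C by ring.
  rewrite Cmod_opp. apply w_close.
Qed.

(** The chord |exp(i delta_j) - 1|; unlike the angle it is linear in the complex numbers being
    compared. *)
Definition dev (j : nat) : R := Cmod (cis (delta K theta c w j) - RtoC 1)%C.

Lemma cis_delta (j : nat) : (cis (chi K theta w j) * cis (delta K theta c w j))%C = cis (phi K theta c j).
Proof.
  unfold delta. rewrite cis_principal, <- cis_plus. f_equal. ring.
Qed.

Lemma dev_nonneg (j : nat) : 0 <= dev j.
Proof. apply Cmod_ge_0. Qed.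

Lemma dev_le_2 (j : nat) : dev j <= 2.
Proof.
  unfold dev, Cminus. eapply Rle_trans; [apply Cmod_triangle|]. rewrite Cmod_opp, Cmod_cis, Cmod_1. lra.
Qed.

(** With unit vectors p, q of alpha, beta one has |alpha| (p - q) = (alpha - beta) + (|beta| -
    |alpha|) q, so |alpha| |p - q| <= 2 |alpha - beta|; moreover |alpha| >= 2 |P_j|. *)
Lemma dev_tail (i : nat) : dev (i + m) <= 2 * K * (C' * Cmod c) / y i ^ 2.
Proof.
  set (j := (i + m)%nat). destruct (y_growth i) as [H1 _]. destruct x_bounds as [_ [H4 _]]. cbv beta in *.
  pose proof (hw_close i) as Hh. cbv beta in Hh. fold j in Hh, H1 |- *.
  pose proof (cis_Arg (al j) (alpha_neq_0 K theta hK c j hc)) as Ha. fold (phi K theta c j) in Ha.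
  pose proof (cis_Arg (be j) (beta_neq_0 K theta hK rho psi psi_ext hpsi hext c j hc)) as Hb.
  fold (chi K theta w j) in Hb.
  set (p := cis (phi K theta c j)) in *. set (q := cis (chi K theta w j)) in *.
  assert (Hdev : dev j = Cmod (p - q)%C).
  { unfold dev. transitivity (Cmod (q * (cis (delta K theta c w j) - RtoC 1))%C).
    - rewrite Cmod_mult. unfold q. rewrite Cmod_cis. ring.
    - f_equal. unfold p. rewrite <- cis_delta. fold q. ring. }
  assert (Hab : Cmod (al j - be j)%C <= 2 * (K * (C' * Cmod c) / Cmod (P j c))).
  { unfold alpha, beta.
    replace (RtoC 2 * h (P j c) - RtoC 2 * h (w_ K theta w j))%C
      with (RtoC 2 * (h (P j c) - h (w_ K theta w j)))%C by ring.
    rewrite Cmod_RtoC_mult, Rabs_pos_eq by lra. lra. }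
  assert (Hal : 2 * Cmod (P j c) <= Cmod (al j)).
  { unfold alpha. rewrite Cmod_RtoC_mult, Rabs_pos_eq by lra.
    pose proof (h_ge K theta hK (P j c)). lra. }
  assert (Hmain : Cmod (al j) * Cmod (p - q)%C <= 2 * Cmod (al j - be j)%C).
  { replace (Cmod (al j) * Cmod (p - q)%C) with (Cmod (RtoC (Cmod (al j)) * (p - q))%C)
      by (rewrite Cmod_RtoC_mult, Rabs_pos_eq by apply Cmod_ge_0; reflexivity).
    replace (RtoC (Cmod (al j)) * (p - q))%C
      with ((al j - be j) + RtoC (Cmod (be j) - Cmod (al j)) * q)%C
      by (rewrite <- Ha at 1; rewrite <- Hb at 1; rewrite RtoC_minus; ring).
    eapply Rle_trans; [apply Cmod_triangle|].
    rewrite Cmod_RtoC_mult. unfold q at 1. rewrite Cmod_cis, Rmult_1_r.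
    assert (Rabs (Cmod (be j) - Cmod (al j)) <= Cmod (al j - be j)%C).
    { apply Rabs_le. split.
      - assert (Cmod (al j) <= Cmod (al j - be j)%C + Cmod (be j)).
        { replace (al j) with ((al j - be j) + be j)%C at 1 by ring. apply Cmod_triangle. } lra.
      - assert (Cmod (be j) <= Cmod (al j - be j)%C + Cmod (al j)).
        { replace (be j) with (- (al j - be j) + al j)%C at 1 by ring.
          eapply Rle_trans; [apply Cmod_triangle|]. rewrite Cmod_opp. lra. } lra. }
    lra. }
  rewrite Hdev. set (Y := Cmod (P j c)) in *.
  apply Rmult_le_reg_l with (2 * Y); [lra|].
  apply Rle_trans with (Cmod (al j) * Cmod (p - q)%C).
  { apply Rmult_le_compat_r; [apply Cmod_ge_0|exact Hal]. }
  eapply Rle_trans; [exact Hmain|].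
  apply Rle_trans with (2 * (2 * (K * (C' * Cmod c) / Y))); [lra|].
  right. field. lra.
Qed.

(** v - I is h^-1 (exp(i delta) - 1) h, whose factors have norms at most 1, [dev] and K. *)
Lemma bnd_v (j : nat) : bnd (msub (v_ K theta c w j) I2) (K * dev j).
Proof.
  intros z. rewrite act_msub, act_I2. unfold v_. rewrite !act_mmul, act_Rot, act_Hmat.
  replace (mat_act (minv (Hmat K theta)) (cis (delta K theta c w j) * h z)%C - z)%C
    with (mat_act (minv (Hmat K theta)) ((cis (delta K theta c w j) - RtoC 1) * h z)%C).
  - eapply Rle_trans; [apply (bnd_Hmat_inv K theta hK)|]. rewrite Rmult_1_l, Cmod_mult.
    fold (dev j). pose proof (h_le K theta hK z). pose proof (dev_nonneg j). nra.
  - assert (Ez : mat_act (minv (Hmat K theta)) (h z) = z).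
    { rewrite <- act_Hmat. apply minv_l, Hmat_det, hK. }
    replace ((cis (delta K theta c w j) - RtoC 1) * h z)%C
      with (cis (delta K theta c w j) * h z - h z)%C by ring.
    rewrite act_minus, Ez. reflexivity.
Qed.

(** The angles of the left factor are free: [phi] gives [E_], and [chi] gives the increments of
    [S_]. *)
Lemma bnd_conj_v (j : nat) (u : nat -> R) :
  bnd (mmul (minv (rot_prod K theta u j)) (mmul (msub (v_ K theta c w j) I2) (Y K theta c j)))
    (K * dev j * K ^ j).
Proof.
  rewrite <- (Rmult_1_l (K * dev j * K ^ j)).
  apply bnd_mmul; [lra|apply bnd_rot_prod_inv, hK|].
  apply bnd_mmul; [pose proof (dev_nonneg j); nra|apply bnd_v|apply bnd_rot_prod, hK].
Qed.

(** As phi = chi + delta modulo 2 pi, (R_chi h)^-1 R_phi h = v, so passing to n + 1 inserts v_n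
    between the two products. *)
Lemma S_step (n : nat) : S_ K theta c w (S n) =
  madd (S_ K theta c w n)
    (mmul (minv (Ytilde K theta w n)) (mmul (msub (v_ K theta c w n) I2) (Y K theta c n))).
Proof.
  assert (HY : mdet (Ytilde K theta w n) <> 0) by apply rot_prod_det, hK.
  assert (HH : mdet (Hmat K theta) <> 0) by apply Hmat_det, hK.
  assert (HR : forall t, mdet (Rot t) <> 0) by (intros; rewrite mdet_Rot; lra).
  assert (HRH : mdet (mmul (Rot (chi K theta w n)) (Hmat K theta)) <> 0).
  { rewrite mdet_mmul. apply Rmult_integral_contrapositive_currified; auto. }
  apply act_ext. intros z. rewrite act_madd. unfold S_.
  rewrite !act_mmul, act_msub, act_I2, act_minus.
  set (u := mat_act (Y K theta c n) z).
  assert (E1 : mat_act (Y K theta c (S n)) z = (cis (phi K theta c n) * h u)%C).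
  { unfold Y. simpl. rewrite !act_mmul, act_Rot, act_Hmat. reflexivity. }
  assert (E2 : forall q, mat_act (minv (Ytilde K theta w (S n))) q =
    mat_act (minv (Ytilde K theta w n)) (mat_act (minv (Hmat K theta)) (mat_act (minv (Rot (chi K theta w n))) q))).
  { intros q. unfold Ytilde. simpl. rewrite minv_mmul by assumption.
    rewrite act_mmul, minv_mmul by auto. rewrite act_mmul. reflexivity. }
  rewrite E1, E2. unfold v_. rewrite !act_mmul, act_Rot, act_Hmat.
  assert (E3 : mat_act (minv (Rot (chi K theta w n))) (cis (phi K theta c n) * h u)%C
    = (cis (delta K theta c w n) * h u)%C).
  { rewrite <- cis_delta, <- Cmult_assoc, <- act_Rot, minv_l by auto. reflexivity. }
  rewrite E3. ring.
Qed.

Lemma dev_geom (i : nat) :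
  K * dev (i + m) * K ^ (i + m) <= 2 * C' * K ^ 2 * Cmod c * K ^ m / (x - 1) ^ 2 * (/ 2) ^ i.
Proof.
  pose proof (y_geom i) as Hg. pose proof (dev_tail i) as Hd. destruct x_bounds as [_ [H4 _]].
  destruct (y_growth i) as [H1 _]. pose proof C'_nonneg as HC. pose proof (Cmod_ge_0 c) as Hc0.
  cbv beta in *. set (z := Cmod (P (i + m) c)) in *.
  assert (HKi : 0 < K ^ (i + m)) by (apply pow_lt; lra).
  assert (HKm : 0 < K ^ m) by (apply pow_lt; lra).
  apply Rle_trans with (K * (2 * K * (C' * Cmod c) / z ^ 2) * K ^ (i + m)).
  { apply Rmult_le_compat_r; [lra|]. apply Rmult_le_compat_l; lra. }
  rewrite pow_add.
  replace (K * (2 * K * (C' * Cmod c) / z ^ 2) * (K ^ i * K ^ m))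
    with (2 * C' * K ^ 2 * Cmod c * K ^ m * (K ^ i / z ^ 2)) by (field; lra).
  replace (2 * C' * K ^ 2 * Cmod c * K ^ m / (x - 1) ^ 2 * (/ 2) ^ i)
    with (2 * C' * K ^ 2 * Cmod c * K ^ m * (/ (x - 1) ^ 2 * (/ 2) ^ i)).
  2:{ unfold Rdiv. ring. }
  apply Rmult_le_compat_l; [|exact Hg].
  repeat apply Rmult_le_pos; try lra.
Qed.

Lemma E_bounds (j : nat) : 0 <= opnorm (E_ K theta c w j) <= K * dev j * K ^ j.
Proof.
  apply opnorm_bnd.
  - pose proof (dev_nonneg j). assert (0 < K ^ j) by (apply pow_lt; lra).
    apply Rmult_le_pos; [nra|lra].
  - apply bnd_conj_v.
Qed.

Lemma E_series :
  ex_series (fun j => opnorm (E_ K theta c w j)) /\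
  Series (fun j => opnorm (E_ K theta c w j)) <=
    PI * INR m * K ^ m + 4 * C' * K ^ 2 * Cmod c * K ^ m / (x - 1) ^ 2.
Proof.
  (* Before the escape time [dev] <= 2, and K^(n+1) <= K^m since n < m; then 2 <= PI gives the
     stated term. The tail sums to 2 T, whence the factor 4. *)
  destruct (series_geom_tail m (fun j => opnorm (E_ K theta c w j)) (2 * K ^ m)
    (2 * C' * K ^ 2 * Cmod c * K ^ m / (x - 1) ^ 2)) as [S1 S2].
  - intros n. apply E_bounds.
  - intros n Hn. eapply Rle_trans; [apply E_bounds|].
    pose proof (dev_le_2 n). pose proof (dev_nonneg n).
    apply Rle_trans with (2 * K ^ S n).
    + simpl. assert (0 < K ^ n) by (apply pow_lt; lra).
      replace (2 * (K * K ^ n)) with (2 * (K * K ^ n)) by ring.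
      replace (K * dev n * K ^ n) with (dev n * (K * K ^ n)) by ring.
      apply Rmult_le_compat_r; [nra|lra].
    + apply Rmult_le_compat_l; [lra|]. apply Rle_pow; [lra|lia].
  - intros i. eapply Rle_trans; [apply E_bounds|apply dev_geom].
  - split; [exact S1|]. eapply Rle_trans; [exact S2|].
    apply Rplus_le_compat.
    + replace (PI * INR m * K ^ m) with (INR m * (PI * K ^ m)) by ring.
      apply Rmult_le_compat_l; [apply pos_INR|]. apply Rmult_le_compat_r; [apply pow_le; lra|].
      pose proof PI2_1. lra.
    + right. destruct x_bounds as [_ [H4 _]]. field. lra.
Qed.

Lemma S_conv : exists Sinf, is_lim_mat (S_ K theta c w) Sinf.
Proof.
  assert (H : forall i j, (i < 2)%nat -> (j < 2)%nat -> ex_finite_lim_seq (fun n => coef (S_ K theta c w n) i j)).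
  { intros i j Hi Hj. apply (seq_geom_conv m) with (T := 2 * C' * K ^ 2 * Cmod c * K ^ m / (x - 1) ^ 2).
    intros k. rewrite S_step, coef_madd by assumption.
    match goal with |- Rabs (?p + ?q - ?p) <= _ => replace (p + q - p) with q by ring end.
    eapply Rle_trans; [apply (bnd_coef _ _ i j Hi Hj (bnd_conj_v (k + m) (chi K theta w)))|apply dev_geom]. }
  destruct (H 0%nat 0%nat) as [s00 H00]; [lia|lia|]. destruct (H 0%nat 1%nat) as [s01 H01]; [lia|lia|].
  destruct (H 1%nat 0%nat) as [s10 H10]; [lia|lia|]. destruct (H 1%nat 1%nat) as [s11 H11]; [lia|lia|].
  exists (mat2 s00 s01 s10 s11). intros i j Hi Hj.
  destruct i as [|[|i]]; [| |lia]; (destruct j as [|[|j]]; [| |lia]); assumption.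
Qed.

Lemma al_ge (i : nat) : 2 <= Cmod (al (i + m)).
Proof.
  destruct (y_growth i) as [H1 _]. destruct x_bounds as [_ [H4 _]]. cbv beta in *.
  unfold alpha. rewrite Cmod_RtoC_mult, Rabs_pos_eq by lra.
  pose proof (h_ge K theta hK (P (i + m) c)). lra.
Qed.

Lemma mod_prod_al_pos (n : nat) : 0 < mod_prod al n.
Proof. apply mod_prod_pos. intros i _. apply alpha_neq_0; assumption. Qed.

Lemma mod_prod_be_pos (n : nat) : 0 < mod_prod be n.
Proof. apply mod_prod_pos. intros i _. apply (beta_neq_0 K theta hK rho psi psi_ext hpsi hext c i hc). Qed.

Lemma mod_prod_al_geom (i : nat) : / mod_prod al (i + m) <= / mod_prod al m * (/ 2) ^ i.
Proof.
  pose proof (mod_prod_al_pos m) as Hm0.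
  assert (H : mod_prod al m * 2 ^ i <= mod_prod al (i + m)).
  { induction i as [|i IH]; [simpl; lra|]. simpl. pose proof (al_ge i).
    assert (0 < 2 ^ i) by (apply pow_lt; lra). pose proof (mod_prod_al_pos (i + m)). nra. }
  assert (0 < 2 ^ i) by (apply pow_lt; lra).
  rewrite pow_inv, <- Rinv_mult. apply Rinv_le_contravar; [nra|exact H].
Qed.

Lemma bnd_Pi_inv (g : nat -> C) (n : nat) : (forall i, g i <> RtoC 0) ->
  bnd (minv (mult_prod K theta g n)) (/ mod_prod g n).
Proof.
  intros Hg. assert (Hp : 0 < mod_prod g n) by (apply mod_prod_pos; auto).
  rewrite mult_prod_rot by auto.
  rewrite minv_mscal by (try apply rot_prod_det; assumption || lra).
  apply bnd_le with (Rabs (/ mod_prod g n) * 1).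
  - rewrite Rabs_pos_eq by (left; apply Rinv_0_lt_compat; exact Hp). lra.
  - apply bnd_mscal, bnd_rot_prod_inv, hK.
Qed.

Lemma R_conv : exists Rinf, is_lim_mat (R_ K theta c) Rinf.
Proof.
  assert (H : forall i j, (i < 2)%nat -> (j < 2)%nat -> ex_finite_lim_seq (fun n => coef (R_ K theta c n) i j)).
  { intros i j Hi Hj. apply (seq_geom_conv m) with (T := / mod_prod al m).
    intros k. rewrite R_S, coef_madd by assumption.
    match goal with |- Rabs (?p + ?q - ?p) <= _ => replace (p + q - p) with q by ring end.
    rewrite Pi_mult_prod.
    eapply Rle_trans; [apply (bnd_coef _ _ i j Hi Hj (bnd_Pi_inv al (S (k + m)) (fun i => alpha_neq_0 K theta hK c i hc)))|].
    change (S (k + m)) with (S k + m)%nat. eapply Rle_trans; [apply mod_prod_al_geom|].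
    apply Rmult_le_compat_l; [left; apply Rinv_0_lt_compat, mod_prod_al_pos|].
    simpl. pose proof (half_pow_pos k). lra. }
  destruct (H 0%nat 0%nat) as [s00 H00]; [lia|lia|]. destruct (H 0%nat 1%nat) as [s01 H01]; [lia|lia|].
  destruct (H 1%nat 0%nat) as [s10 H10]; [lia|lia|]. destruct (H 1%nat 1%nat) as [s11 H11]; [lia|lia|].
  exists (mat2 s00 s01 s10 s11). intros i j Hi Hj.
  destruct i as [|[|i]]; [| |lia]; (destruct j as [|[|j]]; [| |lia]); assumption.
Qed.

Lemma lambda_mod_prod (n : nat) : lambda_ K theta c w n = mod_prod al n / mod_prod be n.
Proof.
  induction n as [|n IH]; [simpl; field|]. simpl. rewrite IH.
  pose proof (mod_prod_be_pos n). pose proof (mod_prod_be_pos (S n)) as Hb. simpl in Hb.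
  assert (Hbn : Cmod (be n) <> 0) by (intros E; rewrite E in Hb; lra).
  unfold alpha, beta in *. rewrite !Cmod_RtoC_mult, !Rabs_pos_eq in * by lra.
  field. split; [|lra]. intros E. apply Hbn. rewrite E. ring.
Qed.

(** Convergence is proved for the logarithms, which also makes the limit strictly positive. *)
Lemma lambda_conv : exists l : R, is_lim_seq (lambda_ K theta c w) l /\ 0 < l.
Proof.
  assert (Hpos : forall n, 0 < lambda_ K theta c w n).
  { intros n. rewrite lambda_mod_prod. apply Rdiv_lt_0_compat; [apply mod_prod_al_pos|apply mod_prod_be_pos]. }
  destruct x_bounds as [Hcx [H4 [_ [HKC _]]]]. pose proof C'_nonneg as HC. pose proof (Cmod_ge_0 c) as Hc0.
  assert (Hln : ex_finite_lim_seq (fun n => ln (lambda_ K theta c w n))).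
  { apply (seq_geom_conv m) with (T := 2 * (K * (C' * Cmod c)) * / (x - 1) ^ 2).
    intros i. destruct (y_growth i) as [H1 _]. pose proof (y_geom i) as Hg. pose proof (hw_close i) as Hh.
    cbv beta in *. simpl lambda_. set (j := (i + m)%nat) in *. set (z := Cmod (P j c)) in *.
    set (p := Cmod (h (P j c))) in *. set (q := Cmod (h (w_ K theta w j))).
    assert (Hp : z <= p) by apply (h_ge K theta hK).
    assert (Hq : 0 < q).
    { apply Cmod_gt_0. intros E. apply (h_eq_0 K theta hK) in E.
      exact (w_neq_0 K theta hK rho psi psi_ext hpsi hext c j hc E). }
    assert (Hpq : 0 < p / q) by (apply Rdiv_lt_0_compat; lra).
    rewrite ln_mult by (apply Hpos || exact Hpq).
    match goal with |- Rabs (?r + ?s - ?r) <= _ => replace (r + s - r) with s by ring end.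
    replace (p / q) with (/ (q / p)) by (field; lra).
    rewrite ln_Rinv, Rabs_Ropp by (apply Rdiv_lt_0_compat; lra).
    set (e := K * (C' * Cmod c) / z ^ 2).
    assert (Hz2 : 0 < z ^ 2) by nra.
    assert (HKC0 : 0 <= K * (C' * Cmod c)) by (apply Rmult_le_pos; [lra|]; apply Rmult_le_pos; lra).
    apply Rle_trans with (2 * e).
    - apply ln_near_1.
      + replace (q / p - 1) with ((q - p) / p) by (field; lra).
        unfold Rdiv. rewrite Rabs_mult, (Rabs_pos_eq (/ p)) by (left; apply Rinv_0_lt_compat; lra).
        assert (Hqp : Rabs (q - p) <= K * (C' * Cmod c) / z).
        { eapply Rle_trans; [|exact Hh]. apply Rabs_le. unfold p, q. split.
          - assert (Cmod (h (P j c)) <= Cmod (h (P j c) - h (w_ K theta w j))%C + Cmod (h (w_ K theta w j))).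
            { replace (h (P j c)) with ((h (P j c) - h (w_ K theta w j)) + h (w_ K theta w j))%C at 1 by ring.
              apply Cmod_triangle. } lra.
          - assert (Cmod (h (w_ K theta w j)) <= Cmod (h (P j c) - h (w_ K theta w j))%C + Cmod (h (P j c))).
            { replace (h (w_ K theta w j)) with (- (h (P j c) - h (w_ K theta w j)) + h (P j c))%C at 1 by ring.
              eapply Rle_trans; [apply Cmod_triangle|]. rewrite Cmod_opp. lra. } lra. }
        apply Rle_trans with (K * (C' * Cmod c) / z * / z).
        * apply Rmult_le_compat; [apply Rabs_pos|left; apply Rinv_0_lt_compat; lra|exact Hqp|].
          apply Rinv_le_contravar; lra.
        * right. unfold e. field. lra.
      + unfold e. apply Rmult_le_reg_r with (z ^ 2); [exact Hz2|].
        unfold Rdiv. rewrite Rmult_assoc, Rinv_l by lra.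
        (* The entry 2KC' of [kappa0] is used here, together with |c| <= x, to apply [ln_near_1]. *)
        assert (K * (C' * Cmod c) <= x / 2 * x).
        { replace (K * (C' * Cmod c)) with (K * C' * Cmod c) by ring.
          apply Rmult_le_compat; [nra|lra|lra|lra]. }
        nra.
    - unfold e.
      apply Rle_trans with (2 * (K * (C' * Cmod c)) * (K ^ i / z ^ 2)).
      (* A factor K^i >= 1 is inserted only to reuse [y_geom]. *)
      + assert (1 <= K ^ i) by (apply pow_R1_Rle; lra).
        apply Rle_trans with (2 * (K * (C' * Cmod c)) * (1 / z ^ 2)); [right; field; lra|].
        apply Rmult_le_compat_l; [lra|]. apply Rmult_le_compat_r; [left; apply Rinv_0_lt_compat; lra|lra].
      + rewrite (Rmult_assoc (2 * (K * (C' * Cmod c)))). apply Rmult_le_compat_l; [lra|exact Hg]. }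
  destruct Hln as [L HL]. exists (exp L). split; [|apply exp_pos].
  apply is_lim_seq_ext with (fun n => exp (ln (lambda_ K theta c w n))).
  - intros n. apply exp_ln, Hpos.
  - apply is_lim_seq_continuous; [|exact HL]. apply derivable_continuous_pt, derivable_pt_exp.
Qed.

(* With [G n] the [n]-th term of the limit, [D Psi - G n] is
   [(D f0^n)^-1 (D_c psi + (D_z psi - I) D P_n)], which tends to [0] geometrically. *)
Lemma Psi_formula (Rinf Sinf : M2) (l : R) :
  is_lim_mat (R_ K theta c) Rinf -> is_lim_mat (S_ K theta c w) Sinf ->
  is_lim_seq (lambda_ K theta c w) l ->
  Dmat (Psi psi_ext) c = mscal l (mmul Sinf Rinf).
Proof.
  intros HR HS Hl.
  destruct x_bounds as [Hcx [H4 _]]. pose proof (Cmod_ge_0 c) as Hc0.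
  set (A := Dmat (Psi psi_ext) c).
  set (G := fun n => mscal (lambda_ K theta c w n) (mmul (S_ K theta c w n) (R_ K theta c n))).
  assert (HG : forall i j, (i < 2)%nat -> (j < 2)%nat ->
    is_lim_seq (fun n => coef (G n) i j) (coef (mscal l (mmul Sinf Rinf)) i j)).
  { intros i j Hi Hj. rewrite coef_mscal, coef_mmul by assumption.
    apply is_lim_seq_ext with (fun n => lambda_ K theta c w n *
      (coef (S_ K theta c w n) i 0 * coef (R_ K theta c n) 0 j +
       coef (S_ K theta c w n) i 1 * coef (R_ K theta c n) 1 j)).
    - intros n. unfold G. rewrite coef_mscal, coef_mmul by assumption. reflexivity.
    - apply is_lim_seq_mult'; [exact Hl|]. apply is_lim_seq_plus'; apply is_lim_seq_mult';
      (apply HS || apply HR); assumption || lia. }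
  destruct (lim_seq_bounded _ _ Hl) as [Lb HLb].
  assert (HRb : exists Rb, 0 <= Rb /\ forall n, bnd (R_ K theta c n) Rb).
  { destruct (lim_seq_bounded _ _ (HR 0%nat 0%nat ltac:(lia) ltac:(lia))) as [M00 HM00].
    destruct (lim_seq_bounded _ _ (HR 0%nat 1%nat ltac:(lia) ltac:(lia))) as [M01 HM01].
    destruct (lim_seq_bounded _ _ (HR 1%nat 0%nat ltac:(lia) ltac:(lia))) as [M10 HM10].
    destruct (lim_seq_bounded _ _ (HR 1%nat 1%nat ltac:(lia) ltac:(lia))) as [M11 HM11].
    pose proof (Rle_trans _ _ _ (Rabs_pos _) (HM00 O)). pose proof (Rle_trans _ _ _ (Rabs_pos _) (HM01 O)).
    pose proof (Rle_trans _ _ _ (Rabs_pos _) (HM10 O)). pose proof (Rle_trans _ _ _ (Rabs_pos _) (HM11 O)).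
    exists (4 * (M00 + M01 + M10 + M11)). split; [lra|]. intros n. apply bnd_of_coefs. intros i j Hi Hj.
    specialize (HM00 n). specialize (HM01 n). specialize (HM10 n). specialize (HM11 n).
    destruct i as [|[|i]]; [| |lia]; (destruct j as [|[|j]]; [| |lia]); lra. }
  destruct HRb as [Rb [HRb0 HRb]].
  (* [B] comes without a sign, hence the absolute value. *)
  destruct hest as [_ [_ [[B HB] _]]]. set (B' := Rabs B).
  assert (HB0 : 0 <= B') by apply Rabs_pos.
  (* The first summand bounds the part with D_c psi, which decays with the moduli of Pi_n. In the
     second, the norm K^n of the rotated product is beaten by D_z psi - I = O(|c| / |P_n|^2), and
     the moduli combine to lambda_n. *)
  set (T := Lb * (2 * B' * / mod_prod al m + 2 * B' * Cmod c * Rb * K ^ m * / (x - 1) ^ 2)).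
  assert (HLb0 : 0 <= Lb) by (eapply Rle_trans; [apply Rabs_pos|apply (HLb O)]).
  assert (Herr : forall k i j, (i < 2)%nat -> (j < 2)%nat ->
    Rabs (coef A i j - coef (G (k + m)%nat) i j) <= T * (/ 2) ^ k).
  { intros k i j Hi Hj. set (n := (k + m)%nat).
    destruct (y_growth k) as [H1 _]. pose proof (y_geom k) as Hg. cbv beta in *. fold n in Hg, H1.
    pose proof (Dstrict_m k) as HD. fold n in HD.
    pose proof (diffat_Psi K theta hK rho psi psi_ext hpsi hext a C' ha hest c n hc HD) as HPsi.
    apply diffat_Dmat in HPsi.
    set (z := Cmod (P n c)) in *.
    assert (Hz2 : 0 < z ^ 2) by nra.
    destruct (HB c (P n c) (Dstrict_Dint a c (P n c) HD)) as [B1 [B2 [B3 B4]]]. fold z in B1, B2, B3, B4.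
    assert (HBB : forall t, 0 < t -> B / t <= B' / t).
    { intros t Ht. apply Rmult_le_compat_r; [left; apply Rinv_0_lt_compat, Ht|]. apply Rle_abs. }
    assert (HBc : B * Cmod c / z ^ 2 <= B' * Cmod c / z ^ 2).
    { apply Rmult_le_compat_r; [left; apply Rinv_0_lt_compat, Hz2|].
      apply Rmult_le_compat_r; [exact Hc0|]. apply Rle_abs. }
    assert (Bc : bnd (D_c psi (c, P n c)) (2 * B')).
    { apply bnd_le with (B' / z + B' / z).
      - assert (B' / z <= B').
        { apply Rmult_le_reg_r with z; [lra|]. unfold Rdiv. rewrite Rmult_assoc, Rinv_l by lra. nra. }
        lra.
      - apply bnd_wirtinger; (eapply Rle_trans; [eassumption|apply HBB; lra]). }
    assert (Bz : bnd (msub (D_z psi (c, P n c)) I2) (2 * (B' * Cmod c / z ^ 2))).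
    { destruct (wd_msub_I2 (D_z psi (c, P n c))) as [W1 W2].
      apply bnd_le with (B' * Cmod c / z ^ 2 + B' * Cmod c / z ^ 2); [lra|].
      apply bnd_wirtinger; [rewrite W1|rewrite W2]; (eapply Rle_trans; [eassumption|exact HBc]). }
    set (Pt := mult_prod K theta be n).
    assert (Hbe : forall i, be i <> RtoC 0)
      by (intros; apply (beta_neq_0 K theta hK rho psi psi_ext hpsi hext c i0 hc)).
    assert (Hal : forall i, al i <> RtoC 0) by (intros; apply alpha_neq_0; assumption).
    pose proof (mod_prod_al_pos n) as Hma. pose proof (mod_prod_be_pos n) as Hmb.
    (* The moduli of the two products form lambda_n and the rotated parts form S_n, so the n-th term
       is exactly (D f_0^n)^-1 D P_n. *)
    assert (HGn : G n = mmul (minv Pt) (DP K theta c n)).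
    { rewrite DP_R by auto. unfold G, S_, Pt. rewrite Pi_mult_prod, !mult_prod_rot by auto.
      fold (phi K theta c). fold (chi K theta w).
      rewrite minv_mscal by (try apply rot_prod_det; assumption || lra).
      apply act_ext. intros q. rewrite lambda_mod_prod.
      rewrite !act_mscal, !act_mmul, !act_mscal, act_scal, Cmult_assoc.
      change (rot_prod K theta (fun i0 : nat => Arg (al i0)) n) with (Y K theta c n).
      change (rot_prod K theta (fun i0 : nat => Arg (be i0)) n) with (Ytilde K theta w n).
      f_equal. unfold Rdiv. rewrite RtoC_mult. ring. }
    assert (HX : msub A (G n) = madd (mmul (minv Pt) (D_c psi (c, P n c)))
      (mmul (minv Pt) (mmul (msub (D_z psi (c, P n c)) I2) (mmul (Pi_ K theta c n) (R_ K theta c n))))).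
    { unfold A. rewrite HPsi, HGn. unfold DPsi, DQ. fold Pt. rewrite <- DP_R by auto.
      apply act_ext. intros q. rewrite act_msub, act_madd, !act_mmul, act_madd, act_msub, act_I2, act_mmul, !act_plus, act_minus.
      ring. }
    replace (coef A i j - coef (G n) i j) with (coef (msub A (G n)) i j) by (apply coef_msub; assumption).
    assert (Hlam : / mod_prod be n = lambda_ K theta c w n * / mod_prod al n).
    { rewrite lambda_mod_prod. field. lra. }
    assert (Hlam' : / mod_prod be n * mod_prod al n = lambda_ K theta c w n).
    { rewrite lambda_mod_prod. field. lra. }
    assert (Hlp : 0 <= lambda_ K theta c w n <= Lb).
    { split; [rewrite lambda_mod_prod; left; apply Rdiv_lt_0_compat; assumption|].
      eapply Rle_trans; [apply Rle_abs|apply HLb]. }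
    assert (HKn : 0 < K ^ n) by (apply pow_lt; lra).
    assert (BP : bnd (Pi_ K theta c n) (mod_prod al n * K ^ n)).
    { rewrite Pi_mult_prod, mult_prod_rot by auto.
      apply bnd_le with (Rabs (mod_prod al n) * K ^ n); [rewrite Rabs_pos_eq by lra; lra|].
      apply bnd_mscal, bnd_rot_prod, hK. }
    pose proof (bnd_Pi_inv be n Hbe) as BPt. fold Pt in BPt.
    assert (Hbinv : 0 < / mod_prod be n) by (apply Rinv_0_lt_compat, Hmb).
    assert (Hsm : 0 <= 2 * (B' * Cmod c / z ^ 2)).
    { apply Rmult_le_pos; [lra|]. apply Rmult_le_pos; [nra|left; apply Rinv_0_lt_compat, Hz2]. }
    assert (HB2 := bnd_madd _ _ _ _ (bnd_mmul _ _ _ _ (Rlt_le _ _ Hbinv) BPt Bc)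
      (bnd_mmul _ _ _ _ (Rlt_le _ _ Hbinv) BPt
        (bnd_mmul _ _ _ _ Hsm Bz (bnd_mmul _ _ _ _ (Rlt_le _ _ (Rmult_lt_0_compat _ _ Hma HKn)) BP (HRb n))))).
    rewrite <- HX in HB2. eapply Rle_trans; [apply (bnd_coef _ _ i j Hi Hj HB2)|].
    replace (T * (/ 2) ^ k) with (Lb * (2 * B' * / mod_prod al m * (/ 2) ^ k) +
      Lb * (2 * B' * Cmod c * Rb * K ^ m * / (x - 1) ^ 2 * (/ 2) ^ k)) by (unfold T; ring).
    apply Rplus_le_compat.
    - rewrite Hlam. pose proof (mod_prod_al_geom k) as Hgeo. fold n in Hgeo.
      assert (0 < / mod_prod al n) by (apply Rinv_0_lt_compat, Hma).
      apply Rle_trans with (Lb * / mod_prod al n * (2 * B')).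
      { apply Rmult_le_compat_r; [lra|]. apply Rmult_le_compat_r; lra. }
      replace (Lb * (2 * B' * / mod_prod al m * (/ 2) ^ k)) with (Lb * (2 * B') * (/ mod_prod al m * (/ 2) ^ k)) by ring.
      replace (Lb * / mod_prod al n * (2 * B')) with (Lb * (2 * B') * / mod_prod al n) by ring.
      apply Rmult_le_compat_l; [nra|exact Hgeo].
    - replace (/ mod_prod be n * (2 * (B' * Cmod c / z ^ 2) * (mod_prod al n * K ^ n * Rb)))
        with ((/ mod_prod be n * mod_prod al n) * (2 * B' * Cmod c * Rb * (K ^ n / z ^ 2))) by (field; lra).
      rewrite Hlam'.
      assert (Hq0 : 0 <= 2 * B' * Cmod c * Rb) by (repeat apply Rmult_le_pos; lra).
      assert (0 <= K ^ n / z ^ 2) by (apply Rmult_le_pos; [lra|left; apply Rinv_0_lt_compat, Hz2]).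
      apply Rle_trans with (Lb * (2 * B' * Cmod c * Rb * (K ^ n / z ^ 2))).
      { apply Rmult_le_compat_r; [apply Rmult_le_pos; assumption|lra]. }
      apply Rmult_le_compat_l; [exact HLb0|].
      replace (2 * B' * Cmod c * Rb * K ^ m * / (x - 1) ^ 2 * (/ 2) ^ k)
        with (2 * B' * Cmod c * Rb * (K ^ m * (/ (x - 1) ^ 2 * (/ 2) ^ k))) by ring.
      apply Rmult_le_compat_l; [exact Hq0|].
      unfold n. rewrite pow_add. fold n.
      replace (K ^ k * K ^ m / z ^ 2) with (K ^ m * (K ^ k / z ^ 2)) by (field; lra).
      apply Rmult_le_compat_l; [apply pow_le; lra|exact Hg]. }
  assert (Hcoef : forall i j, (i < 2)%nat -> (j < 2)%nat -> coef A i j = coef (mscal l (mmul Sinf Rinf)) i j).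
  { intros i j Hi Hj.
    pose proof (lim_geom_0 m (fun n => coef A i j - coef (G n) i j) T (fun k => Herr k i j Hi Hj)) as H0.
    pose proof (is_lim_seq_plus' _ _ _ _ H0 (HG i j Hi Hj)) as H1.
    assert (H2 : is_lim_seq (fun _ : nat => coef A i j) (0 + coef (mscal l (mmul Sinf Rinf)) i j)).
    { apply is_lim_seq_ext with (2 := H1). intros n. ring. }
    apply is_lim_seq_unique in H2. rewrite Lim_seq_const in H2. injection H2 as H2. lra. }
  apply mat_ext; apply Hcoef; lia.
Qed.

(** Both rotated products have determinant K^n, so every S_n has determinant 1. *)
Lemma S_det (Sinf : M2) : is_lim_mat (S_ K theta c w) Sinf -> mdet Sinf = 1.
Proof.
  intros HS.
  assert (H1 : forall n, mdet (S_ K theta c w n) = 1).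
  { intros n. unfold S_. rewrite mdet_mmul, mdet_minv by apply rot_prod_det, hK.
    unfold Y, Ytilde. rewrite !mdet_rot_prod. field. apply pow_nonzero. lra. }
  assert (H2 : is_lim_seq (fun n => mdet (S_ K theta c w n)) (mdet Sinf)).
  { unfold mdet. apply is_lim_seq_minus'; apply is_lim_seq_mult'; apply HS; lia. }
  assert (H3 : is_lim_seq (fun _ : nat => 1) (mdet Sinf)).
  { apply is_lim_seq_ext with (2 := H2). exact H1. }
  apply is_lim_seq_unique in H3. rewrite Lim_seq_const in H3. injection H3 as H3. symmetry. exact H3.
Qed.
End Limits.

(** * Assembly at the least escape time *)

Theorem proposition4p12 (K theta : R) (hK : 1 < K)
  (htheta : - PI / 2 < theta <= PI / 2)
  (rho : C -> R) (psi psi_ext : C -> C -> C)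
  (hpsi : forall c, is_bottcher K theta c (exterior_disc (rho c)) (psi c))
  (hext : forall c, ~ Mset K theta c ->
     is_bottcher_extension K theta c (exterior_disc (rho c)) (psi c) (psi_ext c))
  (a C' : R) (ha : 1 <= a)
  (hest : bottcher_estimates rho psi a C')
  (c : C) (hc : ~ Mset K theta c) :
  exists m : nat,
    is_escape_time K theta a C' c m /\
    C1_near (Psi psi_ext) c /\
    (forall n, (m + 1 <= n)%nat ->
       differentiable_at (Nat.iter n (f0 K theta)) (Psi psi_ext c) /\
       mdet (Dmat (Nat.iter n (f0 K theta)) (Psi psi_ext c)) <> 0 /\
       differentiable_at (Q K theta psi n) c /\
       Dmat (Psi psi_ext) c =
         mmul (minv (Dmat (Nat.iter n (f0 K theta)) (Psi psi_ext c)))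
              (Dmat (Q K theta psi n) c)) /\
    (exists (Rinf Sinf : M2) (laminf : R),
       is_lim_mat (R_ K theta c) Rinf /\
       is_lim_mat (S_ K theta c (Psi psi_ext c)) Sinf /\
       is_lim_seq (lambda_ K theta c (Psi psi_ext c)) laminf /\
       0 < laminf /\
       mdet Sinf = 1 /\
       Dmat (Psi psi_ext) c = mscal laminf (mmul Sinf Rinf) /\
       sign (mdet (Dmat (Psi psi_ext) c)) = sign (mdet Rinf)) /\
    @continuous C_UniformSpace R_UniformSpace
      (fun c' => mdet (Dmat (Psi psi_ext) c')) c /\
    ex_series (fun j => opnorm (E_ K theta c (Psi psi_ext c) j)) /\
    Series (fun j => opnorm (E_ K theta c (Psi psi_ext c) j)) <=
      PI * INR m * K ^ m +
      4 * C' * K ^ 2 * Cmod c * K ^ m / (Cmod (P K theta m c) - 1) ^ 2.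
Proof.
  destruct (escapes_large K theta c hc (kappa K a C' c)) as [N HN].
  destruct (least_nat (fun k => kappa K a C' c <= Cmod (P K theta k c)) N) as [m [Hm Hmin]].
  { left. apply HN. lia. }
  pose proof (Dstrict_m K theta hK a C' ha c m Hm) as HD.
  exists m. split; [|split; [|split; [|split; [|split]]]].
  - split; [exact Hm|]. intros i Hi. apply Rnot_le_lt, Hmin, Hi.
  - exact (Psi_C1 K theta hK rho psi psi_ext hpsi hext a C' ha hest c m hc (HD O)).
  - intros n Hn. specialize (HD (n - m)%nat). replace (n - m + m)%nat with n in HD by lia.
    pose proof (diffat_iter_f0 K theta hK n (Psi psi_ext c)) as H1.
    pose proof (diffat_Q K theta hK rho psi a C' hest c n HD) as H2.
    pose proof (diffat_Psi K theta hK rho psi psi_ext hpsi hext a C' ha hest c n hc HD) as H3.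
    split; [exact (diffat_differentiable _ _ _ H1)|]. split.
    { rewrite (diffat_Dmat _ _ _ H1). apply mult_prod_det; [exact hK|]. intros i _.
      apply (beta_neq_0 K theta hK rho psi psi_ext hpsi hext c i hc). }
    split; [exact (diffat_differentiable _ _ _ H2)|].
    rewrite (diffat_Dmat _ _ _ H1), (diffat_Dmat _ _ _ H2), (diffat_Dmat _ _ _ H3). reflexivity.
  - destruct (R_conv K theta hK a C' c m hc Hm) as [Rinf HR].
    destruct (S_conv K theta hK rho psi psi_ext hpsi hext a C' ha hest c m hc Hm) as [Sinf HS].
    destruct (lambda_conv K theta hK rho psi psi_ext hpsi hext a C' ha hest c m hc Hm) as [l [Hl Hl0]].
    pose proof (S_det K theta hK psi_ext c Sinf HS) as HdS.
    pose proof (Psi_formula K theta hK rho psi psi_ext hpsi hext a C' ha hest c m hc Hm Rinf Sinf l HR HS Hl) as HF.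
    exists Rinf, Sinf, l. do 6 (split; [assumption|]).
    rewrite HF, mdet_mscal, mdet_mmul, HdS, Rmult_1_l, sign_mult.
    rewrite (sign_eq_1 (l ^ 2)) by (apply pow_lt; exact Hl0). apply Rmult_1_l.
  - apply (@cmat_mdet C_UniformSpace).
    exact (DPsi_cont K theta hK rho psi psi_ext hpsi hext a C' ha hest c m hc (HD O)).
  - exact (E_series K theta hK rho psi psi_ext hpsi hext a C' ha hest c m hc Hm).
Qed.
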